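(* A prime ideal $P$ of $\mathfrak{A}$ is maximal if and only if $P$ contains an element $f$ with $m(f)=1$.
   Context: $\mathfrak{A}$ denotes the ring (an integral domain) of integer-valued entire functions, i.e. the entire functions $f:\mathbb{C}\to\mathbb{C}$ with $f(\mathbb{Z})\subset\mathbb{Z}$, under pointwise operations. For $f\in\mathfrak{A}$, $\Pi(f)$ is the set of irreducible elements of $\mathfrak{A}$ dividing $f$ in $\mathfrak{A}$. For $\delta\in\Pi(f)$, $o(\delta,f)=\max\{k:\delta^k\text{ divides }f\text{ in }\mathfrak{A}\}$, with $o(\delta,f)=\infty$ if $\delta^k$ divides $f$ for all $k$ (in particular $o(\delta,0)=\infty$). Finally $m(f)=\sup\{o(\delta,f):\delta\in\Pi(f)\}$, with the supremum of the empty set taken to be $0$. *)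

(* Defs.v *)
From Stdlib Require Import Reals ZArith FunctionalExtensionality ProofIrrelevance.
From Coquelicot Require Import Coquelicot.

Definition entire (f : C -> C) : Prop :=
  forall z : C, ex_derive (K := C_AbsRing) (V := C_NormedModule) f z.

Definition integer_valued (f : C -> C) : Prop :=
  forall n : Z, exists k : Z, f (RtoC (IZR n)) = RtoC (IZR k).

Record ivef : Type := Ivef {
  ivef_fun :> C -> C;
  ivef_entire : entire ivef_fun;
  ivef_int : integer_valued ivef_fun
}.

Lemma ivef_ext (f g : ivef) : (forall z, f z = g z) -> f = g.
Proof.
destruct f as [f ef zf], g as [g eg zg]; simpl; intros H.
apply functional_extensionality in H; subst g.
now rewrite (proof_irrelevance _ ef eg), (proof_irrelevance _ zf zg).
Qed.

Lemma entire_const (c : C) : entire (fun _ => c).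
Proof. intros z; apply ex_derive_const. Qed.

Lemma entire_plus (f g : C -> C) :
  entire f -> entire g -> entire (fun z => Cplus (f z) (g z)).
Proof.
intros Hf Hg z.
exact (ex_derive_plus (V := C_NormedModule) f g z (Hf z) (Hg z)).
Qed.

Lemma entire_opp (f : C -> C) : entire f -> entire (fun z => Copp (f z)).
Proof. intros Hf z; exact (ex_derive_opp (V := C_NormedModule) f z (Hf z)). Qed.

(* [is_derive_mult] is stated for the topology of the codomain induced by
   [C_AbsRing]; the derivative only sees the norm, which is the same. *)
Lemma is_derive_C_AbsRing (f : C -> C) (z l : C) :
  is_derive (V := C_NormedModule) f z l <->
  is_derive (V := AbsRing_NormedModule C_AbsRing) f z l.
Proof.
split; intros [_ H]; (split; [apply is_linear_scal_l | exact H]).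
Qed.

Lemma entire_mult (f g : C -> C) :
  entire f -> entire g -> entire (fun z => Cmult (f z) (g z)).
Proof.
intros Hf Hg z; destruct (Hf z) as [lf Df], (Hg z) as [lg Dg].
apply is_derive_C_AbsRing in Df, Dg.
eexists; apply is_derive_C_AbsRing.
exact (is_derive_mult (K := C_AbsRing) f g z lf lg Df Dg Cmult_comm).
Qed.

Lemma integer_valued_const (k : Z) : integer_valued (fun _ => RtoC (IZR k)).
Proof. intros n; now exists k. Qed.

Lemma integer_valued_plus (f g : C -> C) : integer_valued f ->
  integer_valued g -> integer_valued (fun z => Cplus (f z) (g z)).
Proof.
intros Hf Hg n; destruct (Hf n) as [a Ha], (Hg n) as [b Hb].
exists (a + b)%Z; now rewrite Ha, Hb, plus_IZR, RtoC_plus.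
Qed.

Lemma integer_valued_opp (f : C -> C) :
  integer_valued f -> integer_valued (fun z => Copp (f z)).
Proof.
intros Hf n; destruct (Hf n) as [a Ha].
exists (- a)%Z; now rewrite Ha, opp_IZR, RtoC_opp.
Qed.

Lemma integer_valued_mult (f g : C -> C) : integer_valued f ->
  integer_valued g -> integer_valued (fun z => Cmult (f z) (g z)).
Proof.
intros Hf Hg n; destruct (Hf n) as [a Ha], (Hg n) as [b Hb].
exists (a * b)%Z; now rewrite Ha, Hb, mult_IZR, RtoC_mult.
Qed.

Definition ivef_const (k : Z) : ivef :=
  Ivef _ (entire_const (RtoC (IZR k))) (integer_valued_const k).

Definition ivef_plus (f g : ivef) : ivef :=
  Ivef _ (entire_plus f g (ivef_entire f) (ivef_entire g))
         (integer_valued_plus f g (ivef_int f) (ivef_int g)).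

Definition ivef_opp (f : ivef) : ivef :=
  Ivef _ (entire_opp f (ivef_entire f)) (integer_valued_opp f (ivef_int f)).

Definition ivef_mult (f g : ivef) : ivef :=
  Ivef _ (entire_mult f g (ivef_entire f) (ivef_entire g))
         (integer_valued_mult f g (ivef_int f) (ivef_int g)).

Definition ivef_AbelianMonoid_mixin : AbelianMonoid.mixin_of ivef.
Proof.
apply (AbelianMonoid.Mixin ivef ivef_plus (ivef_const 0));
  intros; apply ivef_ext; intros t; simpl; ring.
Defined.

Canonical ivef_AbelianMonoid : AbelianMonoid :=
  AbelianMonoid.Pack ivef ivef_AbelianMonoid_mixin ivef.

Definition ivef_AbelianGroup_mixin : AbelianGroup.mixin_of ivef_AbelianMonoid.
Proof.
apply (AbelianGroup.Mixin ivef_AbelianMonoid ivef_opp).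
intros x; apply ivef_ext; intros t; simpl; ring.
Defined.

Canonical ivef_AbelianGroup : AbelianGroup :=
  AbelianGroup.Pack ivef
    (AbelianGroup.Class ivef ivef_AbelianMonoid_mixin ivef_AbelianGroup_mixin)
    ivef.

Definition ivef_Ring_mixin : Ring.mixin_of ivef_AbelianGroup.
Proof.
apply (Ring.Mixin ivef_AbelianGroup ivef_mult (ivef_const 1));
  intros; apply ivef_ext; intros t; simpl; ring.
Defined.

Canonical ivef_Ring : Ring :=
  Ring.Pack ivef (Ring.Class ivef (AbelianGroup.class _) ivef_Ring_mixin) ivef.

Lemma ivef_mult_comm (f g : ivef) : mult f g = mult g f.
Proof. apply ivef_ext; intros t; simpl; ring. Qed.

(* Coquelicot's [Ring] is not assumed commutative; the definitions below are the
   commutative ones, and are only meant for rings such as [ivef_Ring]. *)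
Section CommutativeRing.

Context {K : Ring}.

Definition divides (a b : K) : Prop := exists c : K, b = mult a c.

Definition is_unit (a : K) : Prop := divides a one.

Definition irreducible (a : K) : Prop :=
  a <> zero /\ ~ is_unit a /\
  forall b c : K, a = mult b c -> is_unit b \/ is_unit c.

Definition ideal (I : K -> Prop) : Prop :=
  I zero /\
  (forall a b : K, I a -> I b -> I (plus a b)) /\
  (forall r a : K, I a -> I (mult r a)).

Definition proper (I : K -> Prop) : Prop := exists a : K, ~ I a.

Definition prime_ideal (I : K -> Prop) : Prop :=
  ideal I /\ proper I /\ forall a b : K, I (mult a b) -> I a \/ I b.

Definition maximal_ideal (I : K -> Prop) : Prop :=
  ideal I /\ proper I /\
  forall J : K -> Prop, ideal J -> proper J ->
    (forall a : K, I a -> J a) -> forall a : K, J a -> I a.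

Definition irreducible_divisor (f d : K) : Prop :=
  irreducible d /\ divides d f.

(* The exponents k such that d^k divides f form an initial segment of nat that
   contains 0, so this supremum is their maximum when there is one, and [p_infty]
   when every power of d divides f. *)
Definition mult_order (d f : K) : Rbar :=
  Rbar_lub (fun x => exists k : nat,
    x = Finite (INR k) /\ divides (pow_n d k) f).

Lemma mult_order_max (d f : K) (n : nat) :
  divides (pow_n d n) f ->
  (forall k : nat, divides (pow_n d k) f -> (k <= n)%nat) ->
  mult_order d f = Finite (INR n).
Proof.
intros Hn Hmax; apply Rbar_is_lub_unique; split.
- intros x [k [-> Hk]]; apply le_INR, Hmax, Hk.
- intros b Hb; apply Hb; now exists n.
Qed.

Lemma mult_order_infty (d f : K) :
  (forall k : nat, divides (pow_n d k) f) -> mult_order d f = p_infty.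
Proof.
intros Hall; apply Rbar_is_lub_unique; split.
- intros x _; now destruct x.
- intros b Hb.
  assert (H : forall k : nat, Rbar_le (INR k) b) by (intros k; apply Hb; eauto).
  destruct b as [r | |]; simpl in *; try easy.
  + destruct (INR_unbounded r) as [n Hn].
    exact (Rlt_not_le _ _ Hn (H n)).
  + exact (H 0%nat).
Qed.

(* All orders are nonnegative, so adjoining 0 to the set only affects the case
   without irreducible divisors, where the supremum has to be 0 and not
   [m_infty]. *)
Definition max_order (f : K) : Rbar :=
  Rbar_lub (fun x => x = Finite 0 \/
    exists d : K, irreducible_divisor f d /\ x = mult_order d f).

End CommutativeRing.

(* Main.v *)
Require Import Defs.
From Stdlib Require Import Reals Lra Lia ZArith Znumtheory List Classical ClassicalEpsilon.
From Coquelicot Require Import Coquelicot.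
Import ListNotations.
Open Scope R_scope.

(* The irreducible elements of the ring that matter are, for a prime p and an
   integer n, a zero-free function with value p at n and 1 at the other
   integers, and, for a non-integer point w, a function with a single simple
   zero at w and value 1 at the integers. They show that m(f) = 1 iff f is a
   nonunit that is squarefree: its values at the integers are squarefree (so
   nonzero) and its zeros are simple.

   If f in P is squarefree then the ring modulo f is von Neumann regular: for
   each g, interpolation yields v with f | g (g v - 1). So g v - 1 lies in the
   prime ideal P as soon as g does not, and P is maximal.

   Conversely let P be maximal. If 2 is in P, take f = 2. Otherwise P contains
   some q = 1 - 2 u, which does not vanish at the integers. By Weierstrass'
   theorem there is a squarefree f with the same zeros as q, such that q(n)
   divides a power of f(n) for each integer n. If f were not in P, then P would
   contain some b = 1 - a f; now b is invertible modulo q at each zero of q (to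
   any multiplicity) and at each integer, hence globally by interpolation, so 1
   would be in P.

   The function theory rests on Goursat's theorem for rectangles: it gives
   Cauchy's formula on squares, hence removable singularities, locally uniform
   limits and the estimates that bound the number of zeros in a disc. *)

(** * Complex differentiability and integrals along segments *)

(** Divisibility by [q] in the ring splits into divisibility among entire functions and divisibility
    of the values at the integers, provided [q] has no integer zeros; at an integer zero the value
    of the quotient would depend on derivatives. This is why an arbitrary maximal ideal is first
    searched for an element [q = 1 - 2 u]: its values at the integers are odd. The two conditions
    are then independent of each other. Adding [q * e] to a solution of the analytic congruence
    preserves it, and interpolation of [e] gives the solution any prescribed values at the integers.
    Similarly, a factor [exp g] prescribes nonzero values without moving zeros, at the price of
    interpolating logarithms.

    Squares take the place of circles because integrals along segments are all that Goursat's
    theorem involves. Cauchy's formula presents a function as a quotient of two contour integrals,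
    the denominator being that of 1/(w - z); for this denominator a positive lower bound
    suffices. *)

Definition holo (f : C -> C) (z : C) : Prop :=
  ex_derive (K := C_AbsRing) (V := C_NormedModule) f z.

Lemma is_cderive_iff (f : C -> C) (z l : C) :
  is_derive (K := C_AbsRing) (V := C_NormedModule) f z l <->
  forall eps, 0 < eps -> exists delta, 0 < delta /\ forall w, Cmod (w - z) < delta ->
    Cmod (f w - f z - (w - z) * l)%C <= eps * Cmod (w - z).
Proof.
split.
- intros [_ H] eps He.
  destruct (H z (fun P HP => HP) (mkposreal eps He)) as [d Hd].
  exists d; split; [apply cond_pos|].
  intros w Hw; exact (Hd w Hw).
- intros H; split; [apply is_linear_scal_l|].
  intros x Hx eps.
  (* [is_derive] asks for the estimate at every limit [x] of the filter of neighbourhoods of [z];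
     separation leaves only [z] itself. *)
  assert (Ex : z = x).
  { apply (is_filter_lim_locally_unique (V := AbsRing_NormedModule C_AbsRing)); exact Hx. }
  subst x.
  destruct (H eps (cond_pos eps)) as [d [d0 Hd]].
  exists (mkposreal d d0); intros w Hw; exact (Hd w Hw).
Qed.

Lemma holo_iff (f : C -> C) (z : C) :
  holo f z <->
  exists l, forall eps, 0 < eps -> exists delta, 0 < delta /\
    forall w, Cmod (w - z) < delta ->
    Cmod (f w - f z - (w - z) * l)%C <= eps * Cmod (w - z).
Proof.
split; intros [l H]; exists l; now apply is_cderive_iff.
Qed.

Definition ccont (f : C -> C) (z : C) : Prop :=
  forall eps, 0 < eps -> exists delta, 0 < delta /\
    forall w, Cmod (w - z) < delta -> Cmod (f w - f z) < eps.

Lemma Cmod_triangle3 (a b : C) : Cmod a <= Cmod (a - b) + Cmod b.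
Proof. replace a with ((a - b) + b)%C at 1 by ring. apply Cmod_triangle. Qed.

Lemma Cmod_sub_comm (a b : C) : Cmod (a - b) = Cmod (b - a).
Proof. rewrite <- Cmod_opp; f_equal; ring. Qed.

Lemma holo_ccont (f : C -> C) (z : C) : holo f z -> ccont f z.
Proof.
intros H eps He; apply holo_iff in H; destruct H as [l H].
destruct (H 1 Rlt_0_1) as [d [d0 Hd]].
pose proof (Cmod_ge_0 l) as L.
exists (Rmin d (eps / (2 + Cmod l))); split.
- apply Rmin_glb_lt; auto. apply Rdiv_lt_0_compat; lra.
- intros w Hw.
  assert (W1 := Rlt_le_trans _ _ _ Hw (Rmin_l _ _)).
  assert (W2 := Rlt_le_trans _ _ _ Hw (Rmin_r _ _)).
  specialize (Hd w W1).
  apply Rle_lt_trans with (1 := Cmod_triangle3 _ ((w - z) * l)%C).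
  rewrite Cmod_mult.
  apply Rle_lt_trans with (Cmod (w - z) * (1 + Cmod l)); [lra|].
  apply Rmult_lt_reg_r with (/ (2 + Cmod l)); [apply Rinv_0_lt_compat; lra|].
  apply Rle_lt_trans with (Cmod (w - z)); [|exact W2].
  rewrite <- (Rmult_1_r (Cmod (w - z))) at 2.
  rewrite Rmult_assoc; apply Rmult_le_compat_l; [apply Cmod_ge_0|].
  apply Rmult_le_reg_r with (2 + Cmod l); [lra|]. field_simplify; lra.
Qed.

Lemma holo_const (c z : C) : holo (fun _ => c) z.
Proof. apply entire_const. Qed.

Lemma holo_id (z : C) : holo (fun w => w) z.
Proof.
apply holo_iff; exists 1%C; intros eps He; exists 1; split; [lra|].
intros w _. assert (E : (w - z - (w - z) * 1)%C = 0%C) by ring.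
rewrite E, Cmod_0; apply Rmult_le_pos; [lra|apply Cmod_ge_0].
Qed.

Lemma holo_plus f g z : holo f z -> holo g z -> holo (fun w => f w + g w)%C z.
Proof. intros; now apply (ex_derive_plus (V := C_NormedModule) f g z). Qed.

Lemma holo_opp f z : holo f z -> holo (fun w => - f w)%C z.
Proof. intros; now apply (ex_derive_opp (V := C_NormedModule) f z). Qed.

Lemma holo_minus f g z : holo f z -> holo g z -> holo (fun w => f w - g w)%C z.
Proof. intros; apply holo_plus; auto; now apply holo_opp. Qed.

Lemma holo_mult f g z : holo f z -> holo g z -> holo (fun w => f w * g w)%C z.
Proof.
intros [lf Df] [lg Dg].
apply is_derive_C_AbsRing in Df, Dg.
eexists; apply is_derive_C_AbsRing.
exact (is_derive_mult (K := C_AbsRing) f g z lf lg Df Dg Cmult_comm).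
Qed.

Lemma holo_comp f g z : holo f (g z) -> holo g z -> holo (fun w => f (g w)) z.
Proof.
intros Hf [lg Dg]; apply is_derive_C_AbsRing in Dg.
apply (ex_derive_comp (K := C_AbsRing) (V := C_NormedModule) f g z Hf).
now exists lg.
Qed.

Lemma holo_Cinv (z : C) : z <> 0%C -> holo Cinv z.
Proof.
intros Hz; apply holo_iff; exists (- / (z * z))%C; intros eps He.
assert (Z := proj1 (Cmod_gt_0 z) Hz).
set (m := Cmod z) in *.
exists (Rmin (m / 2) (eps * m * m * m / 2)); split.
{ apply Rmin_glb_lt; [lra|]. apply Rdiv_lt_0_compat; [|lra].
  repeat apply Rmult_lt_0_compat; auto. }
intros w Hw.
assert (W1 := Rlt_le_trans _ _ _ Hw (Rmin_l _ _)).
assert (W2 := Rlt_le_trans _ _ _ Hw (Rmin_r _ _)).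
assert (Wm : m / 2 < Cmod w).
{ pose proof (Cmod_triangle3 z w) as T. rewrite Cmod_sub_comm in T. fold m in T. lra. }
assert (Hw0 : w <> 0%C) by (intros ->; rewrite Cmod_0 in Wm; lra).
replace (/ w - / z - (w - z) * - / (z * z))%C
  with ((w - z) * (w - z) * / (w * (z * z)))%C by (field; auto).
rewrite !Cmod_mult, Cmod_inv, !Cmod_mult by (repeat apply Cmult_neq_0; auto).
fold m. rewrite (Rmult_comm eps), Rmult_assoc.
apply Rmult_le_compat_l; [apply Cmod_ge_0|].
assert (P : 0 < Cmod w * (m * m)) by (repeat apply Rmult_lt_0_compat; lra).
apply Rmult_le_reg_r with (Cmod w * (m * m)); [exact P|].
rewrite Rmult_assoc, Rinv_l by lra.
assert (eps * m * m * m / 2 <= eps * (Cmod w * (m * m))).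
{ assert (0 < eps * m * m) by (repeat apply Rmult_lt_0_compat; auto). nra. }
lra.
Qed.

Lemma holo_inv f z : holo f z -> f z <> 0%C -> holo (fun w => / f w)%C z.
Proof. intros Hf Hz; apply (holo_comp Cinv f); auto; now apply holo_Cinv. Qed.

Lemma holo_div f g z : holo f z -> holo g z -> g z <> 0%C ->
  holo (fun w => f w / g w)%C z.
Proof. intros; apply holo_mult; auto; now apply holo_inv. Qed.

Lemma holo_ext_loc f g z (r : R) : 0 < r ->
  (forall w, Cmod (w - z) < r -> f w = g w) -> holo f z -> holo g z.
Proof.
intros Hr H; apply ex_derive_ext_loc.
exists (mkposreal r Hr); intros w Hw; apply H, Hw.
Qed.

Lemma entire_id : entire (fun z => z).
Proof. intros z; apply holo_id. Qed.

Lemma entire_minus f g : entire f -> entire g -> entire (fun z => f z - g z)%C.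
Proof. intros Hf Hg z; apply holo_minus; [apply Hf | apply Hg]. Qed.

Lemma entire_ccont f : entire f -> forall z, ccont f z.
Proof. intros H z; apply holo_ccont, H. Qed.

Lemma Cmod_pair_le (x y : R) : Cmod (x, y) <= Rabs x + Rabs y.
Proof.
replace (x, y) with (RtoC x + Ci * RtoC y)%C.
- eapply Rle_trans; [apply Cmod_triangle|].
  rewrite Cmod_mult, !Cmod_R, Cmod_Ci; lra.
- unfold Cplus, Cmult, Ci, RtoC; simpl; f_equal; ring.
Qed.

Definition line_int (f : R -> C) (a b : R) : C :=
  RInt (V := C_R_CompleteNormedModule) f a b.

Definition lcont (f : R -> C) : Prop := forall t,
  continuous (U := C_R_NormedModule) f t.

Lemma lcont_intro (f : R -> C) :
  (forall t eps, 0 < eps -> exists delta, 0 < delta /\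
    forall s, Rabs (s - t) < delta -> Cmod (f s - f t) < eps) -> lcont f.
Proof.
intros H t; apply filterlim_locally; intros eps.
destruct (H t eps (cond_pos eps)) as [d [d0 Hd]].
exists (mkposreal d d0); intros s Hs.
apply (norm_compat1 (V := C_R_NormedModule)); rewrite <- Cmod_norm; exact (Hd s Hs).
Qed.

Lemma lcont_ccont_h f (y : R) : (forall x : R, ccont f (x, y)) ->
  lcont (fun x => f (x, y)).
Proof.
intros H; apply lcont_intro; intros t eps He.
destruct (H t eps He) as [d [d0 Hd]].
exists d; split; auto; intros s Hs; apply Hd.
eapply Rle_lt_trans; [|exact Hs].
replace ((s, y) - (t, y))%C with (RtoC (s - t)).
- rewrite Cmod_R; lra.
- unfold Cminus, Cplus, Copp, RtoC; simpl; f_equal; ring.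
Qed.

Lemma lcont_ccont_v f (x : R) : (forall y : R, ccont f (x, y)) ->
  lcont (fun y => f (x, y)).
Proof.
intros H; apply lcont_intro; intros t eps He.
destruct (H t eps He) as [d [d0 Hd]].
exists d; split; auto; intros s Hs; apply Hd.
eapply Rle_lt_trans; [|exact Hs].
replace ((x, s) - (x, t))%C with (Ci * RtoC (s - t))%C.
- rewrite Cmod_mult, Cmod_R, Cmod_Ci; lra.
- unfold Cminus, Cplus, Copp, Cmult, Ci, RtoC; simpl; f_equal; ring.
Qed.

Lemma lcont_ex f a b : lcont f -> ex_RInt (V := C_R_CompleteNormedModule) f a b.
Proof. intros H; apply ex_RInt_continuous; intros z _; apply H. Qed.

Lemma line_int_chasles f a b c : lcont f -> (line_int f a b + line_int f b c)%C = line_int f a c.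
Proof.
intros H; apply (RInt_Chasles (V := C_R_CompleteNormedModule)); now apply lcont_ex.
Qed.

Lemma line_int_point f a : line_int f a a = 0%C.
Proof. apply (RInt_point (V := C_R_CompleteNormedModule)). Qed.

Lemma line_int_ext f g a b : (forall t, f t = g t) -> line_int f a b = line_int g a b.
Proof. intros H; apply (RInt_ext (V := C_R_CompleteNormedModule)); intros; apply H. Qed.

Lemma line_int_plus f g a b : lcont f -> lcont g ->
  line_int (fun t => f t + g t)%C a b = (line_int f a b + line_int g a b)%C.
Proof.
intros; apply (RInt_plus (V := C_R_CompleteNormedModule)); now apply lcont_ex.
Qed.

(** The integral is taken in C as a real normed module, whose linearity covers real scalars only. A
    complex scalar mixes the two components, so these are integrated separately. *)
Lemma line_int_scal c f a b : lcont f ->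
  line_int (fun t => c * f t)%C a b = (c * line_int f a b)%C.
Proof.
intros H.
assert (I := RInt_correct (V := C_R_CompleteNormedModule) f a b (lcont_ex f a b H)).
fold (line_int f a b) in I.
pose proof (is_RInt_fct_extend_fst _ _ _ _ I) as I1.
pose proof (is_RInt_fct_extend_snd _ _ _ _ I) as I2.
apply (is_RInt_unique (V := C_R_CompleteNormedModule)).
destruct c as [c1 c2]; destruct (line_int f a b) as [l1 l2]; simpl in I1, I2.
apply (is_RInt_fct_extend_pair (U := R_NormedModule) (V := R_NormedModule)); simpl.
- apply (is_RInt_minus (V := R_NormedModule)); now apply (is_RInt_scal (V := R_NormedModule)).
- apply (is_RInt_plus (V := R_NormedModule)); now apply (is_RInt_scal (V := R_NormedModule)).
Qed.

Lemma line_int_bound f a b M : a <= b -> lcont f ->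
  (forall t, a <= t <= b -> Cmod (f t) <= M) -> Cmod (line_int f a b) <= (b - a) * M.
Proof.
intros Hab H HM.
rewrite Cmod_norm.
apply (norm_RInt_le_const (V := C_R_NormedModule) f a b (line_int f a b) M Hab).
- intros x Hx; rewrite <- Cmod_norm; exact (HM x Hx).
- apply (RInt_correct (V := C_R_CompleteNormedModule)), lcont_ex, H.
Qed.

(** * Goursat's theorem *)

(** The full lines that carry the four sides: continuity there makes the integrand of each side
    continuous on all of R, as [lcont] demands. *)
Definition on_lines (a b c d : R) (z : C) : Prop :=
  Re z = a \/ Re z = b \/ Im z = c \/ Im z = d.

Definition line_cont (k : C -> C) (a b c d : R) : Prop :=
  forall z, on_lines a b c d z -> ccont k z.

Definition rect_contour (k : C -> C) (a b c d : R) : C :=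
  (line_int (fun x => k (x, c)) a b - line_int (fun x => k (x, d)) a b
   + Ci * (line_int (fun y => k (b, y)) c d - line_int (fun y => k (a, y)) c d))%C.

Lemma line_cont_lcont k a b c d : line_cont k a b c d ->
  lcont (fun x => k (x, c)) /\ lcont (fun x => k (x, d)) /\
  lcont (fun y => k (b, y)) /\ lcont (fun y => k (a, y)).
Proof.
intros H; repeat split.
1, 2: apply lcont_ccont_h; intros; apply H; unfold on_lines; simpl; auto.
all: apply lcont_ccont_v; intros; apply H; unfold on_lines; simpl; auto.
Qed.

Lemma rect_contour_ext k1 k2 a b c d :
  (forall z, on_lines a b c d z -> k1 z = k2 z) ->
  rect_contour k1 a b c d = rect_contour k2 a b c d.
Proof.
intros H; unfold rect_contour.
rewrite (line_int_ext (fun x => k1 (x, c)) (fun x => k2 (x, c))),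
 (line_int_ext (fun x => k1 (x, d)) (fun x => k2 (x, d))),
 (line_int_ext (fun x => k1 (b, x)) (fun x => k2 (b, x))),
 (line_int_ext (fun x => k1 (a, x)) (fun x => k2 (a, x))); auto;
 intros; apply H; unfold on_lines; simpl; auto.
Qed.

Lemma rect_contour_plus k1 k2 a b c d : line_cont k1 a b c d -> line_cont k2 a b c d ->
  rect_contour (fun z => k1 z + k2 z)%C a b c d = (rect_contour k1 a b c d + rect_contour k2 a b c d)%C.
Proof.
intros H1 H2; unfold rect_contour.
apply line_cont_lcont in H1; apply line_cont_lcont in H2.
destruct H1 as (A1 & A2 & A3 & A4), H2 as (B1 & B2 & B3 & B4).
rewrite (line_int_plus (fun x => k1 (x, c)) (fun x => k2 (x, c))),
 (line_int_plus (fun x => k1 (x, d)) (fun x => k2 (x, d))),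
 (line_int_plus (fun x => k1 (b, x)) (fun x => k2 (b, x))),
 (line_int_plus (fun x => k1 (a, x)) (fun x => k2 (a, x))) by auto.
ring.
Qed.

Lemma rect_contour_scal v k a b c d : line_cont k a b c d ->
  rect_contour (fun z => v * k z)%C a b c d = (v * rect_contour k a b c d)%C.
Proof.
intros H; unfold rect_contour; apply line_cont_lcont in H.
destruct H as (A1 & A2 & A3 & A4).
rewrite (line_int_scal v (fun x => k (x, c))), (line_int_scal v (fun x => k (x, d))),
 (line_int_scal v (fun x => k (b, x))), (line_int_scal v (fun x => k (a, x))) by auto.
ring.
Qed.

Definition on_boundary (a b c d : R) (z : C) : Prop :=
  on_lines a b c d z /\ a <= Re z <= b /\ c <= Im z <= d.

Lemma rect_contour_bound k a b c d M : a <= b -> c <= d -> line_cont k a b c d ->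
  (forall z, on_boundary a b c d z -> Cmod (k z) <= M) ->
  Cmod (rect_contour k a b c d) <= 2 * ((b - a) + (d - c)) * M.
Proof.
intros Hab Hcd H HM; unfold rect_contour; apply line_cont_lcont in H.
destruct H as (A1 & A2 & A3 & A4).
assert (B1 : Cmod (line_int (fun x => k (x, c)) a b) <= (b - a) * M).
{ apply line_int_bound; auto; intros; apply HM; unfold on_boundary, on_lines; simpl; lra. }
assert (B2 : Cmod (line_int (fun x => k (x, d)) a b) <= (b - a) * M).
{ apply line_int_bound; auto; intros; apply HM; unfold on_boundary, on_lines; simpl; lra. }
assert (B3 : Cmod (line_int (fun y => k (b, y)) c d) <= (d - c) * M).
{ apply line_int_bound; auto; intros; apply HM; unfold on_boundary, on_lines; simpl; lra. }
assert (B4 : Cmod (line_int (fun y => k (a, y)) c d) <= (d - c) * M).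
{ apply line_int_bound; auto; intros; apply HM; unfold on_boundary, on_lines; simpl; lra. }
eapply Rle_trans; [apply Cmod_triangle|].
rewrite Cmod_mult, Cmod_Ci, Rmult_1_l.
eapply Rle_trans; [apply Rplus_le_compat; apply Cmod_triangle|].
rewrite !Cmod_opp; lra.
Qed.

Lemma rect_contour_split_x k a m b c d : (forall z, ccont k z) ->
  rect_contour k a b c d = (rect_contour k a m c d + rect_contour k m b c d)%C.
Proof.
intros H; unfold rect_contour.
rewrite <- (line_int_chasles (fun x => k (x, c)) a m b), <- (line_int_chasles (fun x => k (x, d)) a m b)
  by (apply lcont_ccont_h; auto).
ring.
Qed.

Lemma rect_contour_split_y k a b c m d : (forall z, ccont k z) ->
  rect_contour k a b c d = (rect_contour k a b c m + rect_contour k a b m d)%C.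
Proof.
intros H; unfold rect_contour.
rewrite <- (line_int_chasles (fun y => k (b, y)) c m d), <- (line_int_chasles (fun y => k (a, y)) c m d)
  by (apply lcont_ccont_v; auto).
ring.
Qed.

Lemma rect_contour_x_degenerate k a c d : rect_contour k a a c d = 0%C.
Proof. unfold rect_contour; rewrite !line_int_point; ring. Qed.

Lemma rect_contour_y_degenerate k a b c : rect_contour k a b c c = 0%C.
Proof. unfold rect_contour; rewrite !line_int_point; ring. Qed.

Lemma line_int_const v a b : line_int (fun _ => v) a b = (RtoC (b - a) * v)%C.
Proof.
unfold line_int; rewrite (RInt_const (V := C_R_CompleteNormedModule)).
apply scal_R_Cmult.
Qed.

Lemma is_RInt_id a b : is_RInt (V := R_NormedModule) (fun x => x) a b ((b * b - a * a) / 2).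
Proof.
replace ((b * b - a * a) / 2) with (minus (b * b / 2) (a * a / 2))
  by (unfold minus, plus, opp; simpl; field).
apply (is_RInt_derive (V := R_CompleteNormedModule) (fun x => x * x / 2) (fun x => x)).
- intros x _; auto_derive; auto; field.
- intros x _; apply continuous_id.
Qed.

Lemma line_int_id_h a b c :
  line_int (fun x => (x, c)) a b = ((b * b - a * a) / 2, (b - a) * c).
Proof.
apply (is_RInt_unique (V := C_R_CompleteNormedModule)).
apply (is_RInt_fct_extend_pair (U := R_NormedModule) (V := R_NormedModule)); simpl.
- apply is_RInt_id.
- apply (is_RInt_const (V := R_NormedModule)).
Qed.

Lemma line_int_id_v a c d :
  line_int (fun y => (a, y)) c d = ((d - c) * a, (d * d - c * c) / 2).
Proof.
apply (is_RInt_unique (V := C_R_CompleteNormedModule)).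
apply (is_RInt_fct_extend_pair (U := R_NormedModule) (V := R_NormedModule)); simpl.
- apply (is_RInt_const (V := R_NormedModule)).
- apply is_RInt_id.
Qed.

Lemma ccont_id z : ccont (fun w => w) z.
Proof. apply holo_ccont, holo_id. Qed.

Lemma ccont_const v z : ccont (fun _ => v) z.
Proof. apply holo_ccont, holo_const. Qed.

Lemma rect_contour_affine u v a b c d : rect_contour (fun z => u + v * z)%C a b c d = 0%C.
Proof.
assert (L : line_cont (fun z => v * z)%C a b c d).
{ intros z _; apply holo_ccont, holo_mult; [apply holo_const | apply holo_id]. }
rewrite rect_contour_plus; [| intros z _; apply ccont_const | exact L].
rewrite rect_contour_scal by (intros z _; apply ccont_id).
unfold rect_contour; rewrite !line_int_const, !line_int_id_h, !line_int_id_v.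
destruct u, v; unfold Cplus, Cminus, Cmult, Copp, Ci, RtoC; simpl; f_equal; field.
Qed.

(** Meant for either coordinate of the lower left corners of repeatedly bisected rectangles: a
    halving moves the coordinate by at most half of the current width, so the intervals are
    nested. *)
Lemma nested_limit (u : nat -> R) (w : R) : 0 <= w ->
  (forall n, u n <= u (S n) <= u n + w * (1 / 2) ^ S n) ->
  exists L, forall n, u n <= L <= u n + w * (1 / 2) ^ n.
Proof.
intros Hw H.
assert (H1 : forall n m, u n <= u (n + m)%nat).
{ intros n m; induction m as [|m IH]; [rewrite Nat.add_0_r; lra|].
  rewrite Nat.add_succ_r; specialize (H (n + m)%nat); lra. }
assert (H2 : forall n m, u (n + m)%nat + w * (1 / 2) ^ (n + m) <= u n + w * (1 / 2) ^ n).
{ intros n m; induction m as [|m IH]; [rewrite Nat.add_0_r; lra|].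
  rewrite Nat.add_succ_r; specialize (H (n + m)%nat); simpl in *; lra. }
assert (H3 : forall n m, u m <= u n + w * (1 / 2) ^ n).
{ intros n m; assert (0 <= w * (1 / 2) ^ n).
  { apply Rmult_le_pos; auto; apply pow_le; lra. }
  assert (0 <= w * (1 / 2) ^ m).
  { apply Rmult_le_pos; auto; apply pow_le; lra. }
  destruct (Nat.le_ge_cases n m).
  - replace m with (n + (m - n))%nat in * by lia.
    pose proof (H2 n (m - n)%nat); lra.
  - replace n with (m + (n - m))%nat in * by lia.
    pose proof (H1 m (n - m)%nat); lra. }
destruct (completeness (fun x => exists n, x = u n)) as [L [U1 U2]].
- exists (u O + w * (1 / 2) ^ 0); intros x [n ->]; apply H3.
- now exists (u O), O.
- exists L; intros n; split.
  + apply U1; now exists n.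
  + apply U2; intros x [m ->]; apply H3.
Qed.

Lemma pow_half_small (K eps : R) : 0 < eps -> exists n, K * (1 / 2) ^ n < eps.
Proof.
intros He.
destruct (Rle_lt_dec K 0) as [Hk|Hk].
{ exists O; simpl; lra. }
destruct (pow_lt_1_zero (1 / 2) ltac:(rewrite Rabs_pos_eq; lra) (eps / K)) as [n Hn].
{ now apply Rdiv_lt_0_compat. }
exists n; specialize (Hn n (Nat.le_refl n)).
rewrite Rabs_pos_eq in Hn by (apply pow_le; lra).
apply Rmult_lt_compat_l with (r := K) in Hn; auto.
replace (K * (eps / K)) with eps in Hn by (field; lra); exact Hn.
Qed.

Lemma Cmod_le_components z x : Cmod (z - x) <= Rabs (Re z - Re x) + Rabs (Im z - Im x).
Proof.
destruct z as [z1 z2], x as [x1 x2]; apply Cmod_pair_le.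
Qed.

Lemma dependent_choice {A : Type} (P : nat -> A -> Prop) (Q : nat -> A -> A -> Prop) :
  (exists a, P O a) -> (forall n a, P n a -> exists a', P (S n) a' /\ Q n a a') ->
  exists s, forall n, P n (s n) /\ Q n (s n) (s (S n)).
Proof.
intros H0 HS.
destruct (constructive_indefinite_description _ H0) as [a0 Ha0].
set (next n (q : {a | P n a}) :=
  let (a', H) := constructive_indefinite_description _ (HS n (proj1_sig q) (proj2_sig q)) in
  exist (P (S n)) a' (proj1 H)).
set (sq := fix sq n : {a | P n a} :=
  match n with O => exist _ a0 Ha0 | S n => next n (sq n) end).
exists (fun n => proj1_sig (sq n)); intros n; split; [apply proj2_sig|].
simpl; unfold next.
destruct (constructive_indefinite_description _ _) as [a' [H1 H2]]; exact H2.
Qed.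

(** One of the four quarters of a rectangle keeps at least a quarter of the modulus of the integral.
    Repeated quartering closes in on a point near which [k] is affine up to o(distance). The affine
    part integrates to 0, and perimeter times remainder is o(4^-n), against the lower bound
    [eta * (1 / 4) ^ n]. *)
Lemma goursat k a b c d : a <= b -> c <= d -> (forall z, ccont k z) ->
  (forall z, a <= Re z <= b -> c <= Im z <= d -> holo k z) ->
  rect_contour k a b c d = 0%C.
Proof.
intros Hab Hcd Hk Hh.
apply NNPP; intros Hne.
apply Cmod_gt_0 in Hne.
set (eta := Cmod (rect_contour k a b c d)) in *.
set (w := b - a); set (h := d - c).
set (sub n (p : R * R) := rect_contour k (fst p) (fst p + w * (1 / 2) ^ n)
                               (snd p) (snd p + h * (1 / 2) ^ n)).
set (Fail n p := eta * (1 / 4) ^ n <= Cmod (sub n p)).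
assert (Hstep : forall n p, Fail n p -> exists p', Fail (S n) p' /\
  fst p <= fst p' <= fst p + w * (1 / 2) ^ S n /\
  snd p <= snd p' <= snd p + h * (1 / 2) ^ S n).
{ intros n [x y] Hf; apply NNPP; intros Hn.
  assert (P : 0 < (1 / 2) ^ n) by (apply pow_lt; lra).
  assert (W : 0 <= w * (1 / 2) ^ S n) by (apply Rmult_le_pos; [unfold w; lra | apply pow_le; lra]).
  assert (H' : 0 <= h * (1 / 2) ^ S n) by (apply Rmult_le_pos; [unfold h; lra | apply pow_le; lra]).
  assert (Q : forall x' y', x' = x \/ x' = x + w * (1 / 2) ^ S n ->
    y' = y \/ y' = y + h * (1 / 2) ^ S n -> Cmod (sub (S n) (x', y')) < eta * (1 / 4) ^ S n).
  { intros x' y' Hx Hy; apply Rnot_le_lt; intros Hc; apply Hn.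
    exists (x', y'); split; [exact Hc|]; simpl fst; simpl snd.
    destruct Hx as [-> | ->], Hy as [-> | ->]; (split; [lra|]); cbn [fst snd]; lra. }
  pose proof (Q x y (or_introl eq_refl) (or_introl eq_refl)) as Q1.
  pose proof (Q x _ (or_introl eq_refl) (or_intror eq_refl)) as Q2.
  pose proof (Q _ y (or_intror eq_refl) (or_introl eq_refl)) as Q3.
  pose proof (Q _ _ (or_intror eq_refl) (or_intror eq_refl)) as Q4.
  unfold Fail in Hf; unfold sub in *; cbn [fst snd] in *.
  rewrite (rect_contour_split_x k _ (x + w * (1 / 2) ^ S n)) in Hf by auto.
  rewrite (rect_contour_split_y k x _ _ (y + h * (1 / 2) ^ S n)) in Hf by auto.
  rewrite (rect_contour_split_y k (x + w * (1 / 2) ^ S n) _ _ (y + h * (1 / 2) ^ S n)) in Hf by auto.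
  replace (x + w * (1 / 2) ^ S n + w * (1 / 2) ^ S n) with (x + w * (1 / 2) ^ n) in *
    by (simpl; field).
  replace (y + h * (1 / 2) ^ S n + h * (1 / 2) ^ S n) with (y + h * (1 / 2) ^ n) in *
    by (simpl; field).
  apply (Rlt_irrefl (eta * (1 / 4) ^ n)).
  eapply Rle_lt_trans; [exact Hf|].
  eapply Rle_lt_trans; [apply Cmod_triangle|].
  eapply Rle_lt_trans; [apply Rplus_le_compat; apply Cmod_triangle|].
  change ((1 / 4) ^ S n) with (1 / 4 * (1 / 4) ^ n) in *. lra. }
assert (F0 : Fail O (a, c)).
{ unfold Fail, sub; simpl fst; simpl snd.
  replace (a + w * (1 / 2) ^ 0) with b by (unfold w; simpl; ring).
  replace (c + h * (1 / 2) ^ 0) with d by (unfold h; simpl; ring).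
  unfold eta; simpl; lra. }
destruct (dependent_choice (fun n p => Fail n p /\ (n = O -> p = (a, c)))
  (fun n p p' => fst p <= fst p' <= fst p + w * (1 / 2) ^ S n /\
     snd p <= snd p' <= snd p + h * (1 / 2) ^ S n)) as [sq Hsq].
{ exists (a, c); auto. }
{ intros n p [Hf _]; destruct (Hstep n p Hf) as (p' & Hf' & Hp'); exists p'; repeat split; easy. }
assert (Hsq0 : sq O = (a, c)) by (now apply (Hsq O)).
destruct (nested_limit (fun n => fst (sq n)) w) as [X HX];
  [unfold w; lra | intros n; apply (Hsq n)|].
destruct (nested_limit (fun n => snd (sq n)) h) as [Y HY];
  [unfold h; lra | intros n; apply (Hsq n)|].
assert (HP : holo k (X, Y)).
{ apply Hh; simpl.
  - specialize (HX O); rewrite Hsq0 in HX; simpl in HX; unfold w in HX; lra.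
  - specialize (HY O); rewrite Hsq0 in HY; simpl in HY; unfold h in HY; lra. }
apply holo_iff in HP; destruct HP as [l Hl].
(* At scale s = 2^-n the perimeter is 2 (w + h) s and the remainder at most eps (w + h) s; this
   choice makes their product less than eta s^2. The added 1 keeps the denominator positive for a
   degenerate rectangle. *)
set (eps := eta / (4 * (1 + w + h) * (1 + w + h))).
assert (W : 0 <= w) by (unfold w; lra).
assert (H' : 0 <= h) by (unfold h; lra).
assert (D0 : 0 < 4 * (1 + w + h) * (1 + w + h)) by nra.
assert (E0 : 0 < eps) by (now apply Rdiv_lt_0_compat).
destruct (Hl eps E0) as [delta [d0 Hd]].
destruct (pow_half_small (w + h) delta d0) as [n Hn].
specialize (HX n); specialize (HY n); cbv beta in HX, HY.
destruct (Hsq n) as [[Hf _] _]; destruct (sq n) as [x y]; cbn [fst snd] in *.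
unfold Fail, sub in Hf; cbn [fst snd] in *.
set (s := (1 / 2) ^ n) in *.
assert (S0 : 0 < s) by (apply pow_lt; lra).
assert (Ss : (1 / 4) ^ n = s * s).
{ unfold s; rewrite <- Rpow_mult_distr; f_equal; lra. }
assert (Ws : 0 <= w * s) by nra. assert (Hs : 0 <= h * s) by nra.
set (aff := fun z => (k (X, Y) - (X, Y) * l + l * z)%C).
set (rem := fun z => (k z - k (X, Y) - (z - (X, Y)) * l)%C).
assert (Ca : forall z, ccont aff z).
{ intros z; apply holo_ccont, holo_plus; [apply holo_const|].
  apply holo_mult; [apply holo_const | apply holo_id]. }
assert (Cr : forall z, ccont rem z).
{ intros z eps' He'.
  destruct (Hk z (eps' / 2)) as [d1 [P1 Q1]]; [lra|].
  destruct (Ca z (eps' / 2)) as [d2 [P2 Q2]]; [lra|].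
  exists (Rmin d1 d2); split; [now apply Rmin_glb_lt|].
  intros v Hv.
  specialize (Q1 v (Rlt_le_trans _ _ _ Hv (Rmin_l _ _))).
  specialize (Q2 v (Rlt_le_trans _ _ _ Hv (Rmin_r _ _))).
  replace (rem v - rem z)%C with ((k v - k z) + - (aff v - aff z))%C
    by (unfold rem, aff; ring).
  eapply Rle_lt_trans; [apply Cmod_triangle|]; rewrite Cmod_opp; lra. }
assert (R1 : rect_contour k x (x + w * s) y (y + h * s) = rect_contour rem x (x + w * s) y (y + h * s)).
{ rewrite (rect_contour_ext k (fun z => aff z + rem z)%C).
  - rewrite rect_contour_plus by (intros z _; auto).
    unfold aff at 1; rewrite rect_contour_affine; ring.
  - intros z _; unfold aff, rem; ring. }
rewrite R1, Ss in Hf.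
assert (R2 : Cmod (rect_contour rem x (x + w * s) y (y + h * s)) <=
  2 * ((x + w * s - x) + (y + h * s - y)) * (eps * ((w + h) * s))).
{ apply rect_contour_bound; try lra; [intros z _; auto|].
  intros z [_ [Hz1 Hz2]].
  assert (Hz : Cmod (z - (X, Y)) <= (w + h) * s).
  { eapply Rle_trans; [apply Cmod_le_components|]; simpl Re; simpl Im.
    assert (Rabs (Re z - X) <= w * s) by (apply Rabs_le; lra).
    assert (Rabs (Im z - Y) <= h * s) by (apply Rabs_le; lra).
    lra. }
  eapply Rle_trans; [apply Hd; lra|].
  apply Rmult_le_compat_l; lra. }
assert (R3 : 2 * ((x + w * s - x) + (y + h * s - y)) * (eps * ((w + h) * s)) =
  (eps * (2 * (w + h) * (w + h))) * (s * s)) by ring.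
assert (R4 : eps * (4 * (1 + w + h) * (1 + w + h)) = eta) by (unfold eps; field; lra).
assert (SS : 0 < s * s) by nra.
assert (eta * (s * s) <= eps * (2 * (w + h) * (w + h)) * (s * s)) by lra.
apply Rmult_le_reg_r in H; auto.
assert (eps * (2 * (w + h) * (w + h)) < eps * (4 * (1 + w + h) * (1 + w + h))).
{ apply Rmult_lt_compat_l; auto; nra. }
lra.
Qed.

(** Near a point where [k] is merely continuous it is still bounded, so a small rectangle around
    that point contributes arbitrarily little. The four pieces around it avoid that point and fall
    under the induction hypothesis. *)
Lemma goursat_except (E : list C) k a b c d :
  a <= b -> c <= d -> (forall z, ccont k z) ->
  (forall z, ~ In z E -> a <= Re z <= b -> c <= Im z <= d -> holo k z) ->
  rect_contour k a b c d = 0%C.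
Proof.
revert a b c d; induction E as [|p E IH]; intros a b c d Hab Hcd Hk Hh.
{ apply goursat; auto; intros z; now apply Hh. }
destruct (classic (a <= Re p <= b /\ c <= Im p <= d)) as [[Px Py]|Hp].
2:{ apply IH; auto; intros z Hz Hx Hy; apply Hh; auto.
    intros [->|H]; auto. }
assert (Hside : forall a' b' c' d', a <= a' -> b' <= b -> c <= c' -> d' <= d ->
  a' <= b' -> c' <= d' -> ~ (a' <= Re p <= b' /\ c' <= Im p <= d') ->
  rect_contour k a' b' c' d' = 0%C).
{ intros a' b' c' d' A1 A2 A3 A4 A5 A6 Hp; apply IH; auto.
  intros z Hz Hx Hy; apply Hh; try lra; intros [->|H]; auto. }
apply Cmod_eq_0, Rle_antisym; [|apply Cmod_ge_0].
apply Rnot_lt_le; intros He; set (eps := Cmod (rect_contour k a b c d)) in *.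
destruct (Hk p 1 Rlt_0_1) as [delta [d0 Hd]].
pose proof (Cmod_ge_0 (k p)) as K0.
set (r := Rmin (delta / 3) (eps / (16 * (1 + Cmod (k p))))).
assert (r0 : 0 < r).
{ apply Rmin_glb_lt; [lra|apply Rdiv_lt_0_compat; lra]. }
assert (r1 : r <= delta / 3) by apply Rmin_l.
assert (r2 : r * (16 * (1 + Cmod (k p))) <= eps).
{ apply Rle_trans with (eps / (16 * (1 + Cmod (k p))) * (16 * (1 + Cmod (k p)))).
  - apply Rmult_le_compat_r; [lra|apply Rmin_r].
  - right; field; lra. }
(* The small rectangle is clamped to the large one. If [p] lies on or close to a side, the outer
   piece beyond that side degenerates and has integral 0. *)
assert (X1 : exists x1, a <= x1 <= Re p /\ Re p - r <= x1 /\ (x1 = a \/ x1 < Re p)).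
{ exists (Rmax a (Re p - r)); unfold Rmax; destruct (Rle_dec _ _); lra. }
assert (X2 : exists x2, Re p <= x2 <= b /\ x2 <= Re p + r /\ (x2 = b \/ Re p < x2)).
{ exists (Rmin b (Re p + r)); unfold Rmin; destruct (Rle_dec _ _); lra. }
assert (Y1 : exists y1, c <= y1 <= Im p /\ Im p - r <= y1 /\ (y1 = c \/ y1 < Im p)).
{ exists (Rmax c (Im p - r)); unfold Rmax; destruct (Rle_dec _ _); lra. }
assert (Y2 : exists y2, Im p <= y2 <= d /\ y2 <= Im p + r /\ (y2 = d \/ Im p < y2)).
{ exists (Rmin d (Im p + r)); unfold Rmin; destruct (Rle_dec _ _); lra. }
destruct X1 as (x1 & X11 & X12 & X13), X2 as (x2 & X21 & X22 & X23),
  Y1 as (y1 & Y11 & Y12 & Y13), Y2 as (y2 & Y21 & Y22 & Y23).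
assert (Eq : rect_contour k a b c d = rect_contour k x1 x2 y1 y2).
{ rewrite (rect_contour_split_x k a x1 b), (rect_contour_split_x k x1 x2 b) by auto.
  rewrite (rect_contour_split_y k x1 x2 c y1 d), (rect_contour_split_y k x1 x2 y1 y2 d) by auto.
  assert (Z1 : rect_contour k a x1 c d = 0%C).
  { destruct X13 as [->|]; [apply rect_contour_x_degenerate|apply Hside; lra]. }
  assert (Z2 : rect_contour k x2 b c d = 0%C).
  { destruct X23 as [->|]; [apply rect_contour_x_degenerate|apply Hside; lra]. }
  assert (Z3 : rect_contour k x1 x2 c y1 = 0%C).
  { destruct Y13 as [->|]; [apply rect_contour_y_degenerate|apply Hside; lra]. }
  assert (Z4 : rect_contour k x1 x2 y2 d = 0%C).
  { destruct Y23 as [->|]; [apply rect_contour_y_degenerate|apply Hside; lra]. }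
  rewrite Z1, Z2, Z3, Z4; ring. }
assert (B : Cmod (rect_contour k x1 x2 y1 y2) <=
   2 * ((x2 - x1) + (y2 - y1)) * (1 + Cmod (k p))).
{ apply rect_contour_bound; try lra; [intros z _; apply Hk|].
  intros z [_ [Hz1 Hz2]].
  assert (Cmod (z - p) < delta).
  { eapply Rle_lt_trans; [apply Cmod_le_components|].
    assert (Rabs (Re z - Re p) <= r) by (apply Rabs_le; lra).
    assert (Rabs (Im z - Im p) <= r) by (apply Rabs_le; lra).
    lra. }
  pose proof (Hd z H); pose proof (Cmod_triangle3 (k z) (k p)); lra. }
rewrite <- Eq in B; fold eps in B.
assert (2 * ((x2 - x1) + (y2 - y1)) * (1 + Cmod (k p)) <= 2 * (4 * r) * (1 + Cmod (k p))).
{ apply Rmult_le_compat_r; lra. }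
lra.
Qed.

(** * Square contours and the Cauchy kernel *)

Definition square_contour (k : C -> C) (p : C) (r : R) : C :=
  rect_contour k (Re p - r) (Re p + r) (Im p - r) (Im p + r).

Definition sq_lines (p : C) (r : R) : C -> Prop :=
  on_lines (Re p - r) (Re p + r) (Im p - r) (Im p + r).

Definition sq_boundary (p : C) (r : R) : C -> Prop :=
  on_boundary (Re p - r) (Re p + r) (Im p - r) (Im p + r).

(** Points of this half-size square stay at distance at least r/2 from the contour, and at least r/4
    after a perturbation by less than r/4; this leaves room for differentiating in [z]. *)
Definition sq_core (p : C) (r : R) (z : C) : Prop :=
  Rabs (Re z - Re p) <= r / 2 /\ Rabs (Im z - Im p) <= r / 2.

Lemma re_le_Cmod_sub z w : Rabs (Re z - Re w) <= Cmod (z - w).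
Proof. eapply Rle_trans; [|apply re_le_Cmod]; unfold Cminus; rewrite re_plus, re_opp; right; f_equal; ring. Qed.

Lemma im_le_Cmod_sub z w : Rabs (Im z - Im w) <= Cmod (z - w).
Proof.
eapply Rle_trans; [|apply (Rmax_Cmod (z - w)%C)].
eapply Rle_trans; [|apply Rmax_r]; destruct z, w; simpl; right; f_equal; ring.
Qed.

Lemma sq_lines_dist p r z w : sq_lines p r z ->
  Rabs (Re w - Re p) <= r - r / 4 -> Rabs (Im w - Im p) <= r - r / 4 ->
  r / 4 <= Cmod (z - w).
Proof.
intros H H1 H2.
apply Rabs_le_between in H1; apply Rabs_le_between in H2.
destruct H as [H|[H|[H|H]]].
1, 2: eapply Rle_trans; [|apply re_le_Cmod_sub].
3, 4: eapply Rle_trans; [|apply im_le_Cmod_sub].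
all: unfold Rabs; destruct (Rcase_abs _); lra.
Qed.

Lemma sq_core_dist p r z w : sq_lines p r z -> sq_core p r w -> r / 2 <= Cmod (z - w).
Proof.
intros H [H1 H2].
apply Rabs_le_between in H1; apply Rabs_le_between in H2.
destruct H as [H|[H|[H|H]]].
1, 2: eapply Rle_trans; [|apply re_le_Cmod_sub].
3, 4: eapply Rle_trans; [|apply im_le_Cmod_sub].
all: unfold Rabs; destruct (Rcase_abs _); lra.
Qed.

Lemma ccont_mult f g z : ccont f z -> ccont g z -> ccont (fun w => f w * g w)%C z.
Proof.
intros Hf Hg eps He.
set (M := 1 + Cmod (f z) + Cmod (g z)).
pose proof (Cmod_ge_0 (f z)) as F0. pose proof (Cmod_ge_0 (g z)) as G0.
assert (M0 : 1 <= M) by (unfold M; lra).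
set (e := Rmin 1 (eps / (2 * M))).
assert (e0 : 0 < e) by (apply Rmin_glb_lt; [lra|apply Rdiv_lt_0_compat; lra]).
assert (e1 : e <= 1) by apply Rmin_l.
assert (e2 : e * (2 * M) <= eps).
{ apply Rle_trans with (eps / (2 * M) * (2 * M)).
  - apply Rmult_le_compat_r; [lra|apply Rmin_r].
  - right; field; lra. }
destruct (Hf e e0) as [d1 [P1 Q1]], (Hg e e0) as [d2 [P2 Q2]].
exists (Rmin d1 d2); split; [now apply Rmin_glb_lt|].
intros v Hv.
specialize (Q1 v (Rlt_le_trans _ _ _ Hv (Rmin_l _ _))).
specialize (Q2 v (Rlt_le_trans _ _ _ Hv (Rmin_r _ _))).
replace (f v * g v - f z * g z)%C
  with ((f v - f z) * (g v - g z) + (f v - f z) * g z + f z * (g v - g z))%C by ring.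
eapply Rle_lt_trans; [apply Cmod_triangle|].
eapply Rle_lt_trans; [apply Rplus_le_compat_r, Cmod_triangle|].
rewrite !Cmod_mult.
pose proof (Cmod_ge_0 (f v - f z)); pose proof (Cmod_ge_0 (g v - g z)).
assert (Cmod (f v - f z) * Cmod (g v - g z) <= e * 1) by (apply Rmult_le_compat; lra).
assert (Cmod (f v - f z) * Cmod (g z) <= e * Cmod (g z)) by (apply Rmult_le_compat_r; lra).
assert (Cmod (f z) * Cmod (g v - g z) <= Cmod (f z) * e) by (apply Rmult_le_compat_l; lra).
assert (e * M < e * (2 * M)) by (apply Rmult_lt_compat_l; lra).
unfold M in *; lra.
Qed.

Lemma ccont_plus f g z : ccont f z -> ccont g z -> ccont (fun w => f w + g w)%C z.
Proof.
intros Hf Hg eps He.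
destruct (Hf (eps / 2)) as [d1 [P1 Q1]]; [lra|].
destruct (Hg (eps / 2)) as [d2 [P2 Q2]]; [lra|].
exists (Rmin d1 d2); split; [now apply Rmin_glb_lt|].
intros v Hv.
specialize (Q1 v (Rlt_le_trans _ _ _ Hv (Rmin_l _ _))).
specialize (Q2 v (Rlt_le_trans _ _ _ Hv (Rmin_r _ _))).
replace (f v + g v - (f z + g z))%C with ((f v - f z) + (g v - g z))%C by ring.
eapply Rle_lt_trans; [apply Cmod_triangle|]; lra.
Qed.

Lemma ccont_opp f z : ccont f z -> ccont (fun w => - f w)%C z.
Proof.
intros H eps He; destruct (H eps He) as [d [d0 Hd]]; exists d; split; auto.
intros w Hw; replace (- f w - - f z)%C with (- (f w - f z))%C by ring.
rewrite Cmod_opp; auto.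
Qed.

Lemma ccont_minus f g z : ccont f z -> ccont g z -> ccont (fun w => f w - g w)%C z.
Proof. intros; apply ccont_plus; auto; now apply ccont_opp. Qed.

Lemma ccont_div f g z : ccont f z -> holo g z -> g z <> 0%C ->
  ccont (fun w => f w / g w)%C z.
Proof. intros; apply ccont_mult; auto; apply holo_ccont; now apply holo_inv. Qed.

Lemma holo_sub_const p z : holo (fun w => w - p)%C z.
Proof. apply holo_minus; [apply holo_id | apply holo_const]. Qed.

Lemma Csub_neq_0 (z w : C) (r : R) : 0 < r -> r <= Cmod (z - w) -> (z - w)%C <> 0%C.
Proof. intros H H1 E; rewrite E, Cmod_0 in H1; lra. Qed.

Lemma lcont_bounded f a b : lcont f -> exists M, forall t, a <= t <= b -> Cmod (f t) <= M.
Proof.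
intros H.
destruct (bounded_continuity (V := C_R_NormedModule) f a b) as [M HM].
- intros x _; apply H.
- exists M; intros t Ht; rewrite Cmod_norm; apply Rlt_le, HM, Ht.
Qed.

Lemma boundary_bounded k a b c d : line_cont k a b c d ->
  exists M, 0 <= M /\ forall z, on_boundary a b c d z -> Cmod (k z) <= M.
Proof.
intros H; apply line_cont_lcont in H; destruct H as (A1 & A2 & A3 & A4).
destruct (lcont_bounded _ a b A1) as [M1 H1], (lcont_bounded _ a b A2) as [M2 H2],
  (lcont_bounded _ c d A3) as [M3 H3], (lcont_bounded _ c d A4) as [M4 H4].
exists (Rmax 0 (Rmax (Rmax M1 M2) (Rmax M3 M4))); split; [apply Rmax_l|].
intros [x y] [Hl [Hx Hy]]; simpl in Hx, Hy.
apply Rle_trans with (2 := Rmax_r _ _).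
pose proof (Rmax_l M1 M2); pose proof (Rmax_r M1 M2).
pose proof (Rmax_l M3 M4); pose proof (Rmax_r M3 M4).
pose proof (Rmax_l (Rmax M1 M2) (Rmax M3 M4)).
pose proof (Rmax_r (Rmax M1 M2) (Rmax M3 M4)).
destruct Hl as [E|[E|[E|E]]]; simpl in E; subst.
- specialize (H4 y Hy); lra.
- specialize (H3 y Hy); lra.
- specialize (H1 x Hx); lra.
- specialize (H2 x Hx); lra.
Qed.

(** This is 2 pi i for [z] inside the square. What the sequel asks of it is that it is holomorphic
    in [z] and bounded away from 0. *)
Definition kernel_int (p : C) (r : R) (z : C) : C := square_contour (fun w => / (w - z))%C p r.

Definition cauchy_int (f : C -> C) (p : C) (r : R) (z : C) : C :=
  square_contour (fun w => f w / (w - z))%C p r.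

Lemma line_cont_div f p r z : 0 < r -> (forall w, sq_lines p r w -> ccont f w) ->
  (forall w, sq_lines p r w -> r / 4 <= Cmod (w - z)) ->
  line_cont (fun w => f w / (w - z))%C (Re p - r) (Re p + r) (Im p - r) (Im p + r).
Proof.
intros Hr Hf Hz w Hw; apply ccont_div; [now apply Hf | apply holo_sub_const |].
apply (Csub_neq_0 w z (r / 4)); [lra | now apply Hz].
Qed.

Lemma core_near p r z : sq_core p r z -> 0 < r ->
  forall w, sq_lines p r w -> r / 4 <= Cmod (w - z).
Proof. intros H Hr w Hw; pose proof (sq_core_dist p r w z Hw H); lra. Qed.

Lemma line_int_im_lower f a b m : a <= b -> lcont f ->
  (forall t, a <= t <= b -> m <= Im (f t)) -> (b - a) * m <= Im (line_int f a b).
Proof.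
intros Hab H Hm.
pose proof (RInt_correct (V := C_R_CompleteNormedModule) f a b (lcont_ex f a b H)) as I.
apply (is_RInt_fct_extend_snd (U := R_NormedModule) (V := R_NormedModule)) in I.
apply (is_RInt_le (fun _ => m) (fun t => snd (f t)) a b); auto.
- apply (is_RInt_const (V := R_NormedModule)).
- intros x Hx; apply Hm; lra.
Qed.

(** Re (1/u) = Re u / |u|^2, where Re u >= r/2 and |u|^2 <= 2 (3r/2)^2 = 9 r^2 / 2; the quotient of
    these bounds is 1/(9r). *)
Lemma re_Cinv_lower (u : C) (r : R) : 0 < r -> r / 2 <= Re u <= 3 / 2 * r ->
  Rabs (Im u) <= 3 / 2 * r -> / (9 * r) <= Re (/ u).
Proof.
destruct u as [x y]; simpl; intros Hr Hx Hy.
apply Rabs_le_between in Hy.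
assert (P : 0 < x * (x * 1) + y * (y * 1)) by nra.
apply Rmult_le_reg_r with (x * (x * 1) + y * (y * 1)); auto.
unfold Rdiv; rewrite (Rmult_assoc x), Rinv_l, Rmult_1_r by lra.
apply Rmult_le_reg_l with (9 * r); [lra|].
rewrite <- Rmult_assoc, Rinv_r, Rmult_1_l by lra.
nra.
Qed.

(** In use [v] is a fourth root of unity that rotates one side of the square to the right-hand side,
    to which the previous bound applies. *)
Lemma re_mult_Cinv_lower (u v w : C) (r : R) : 0 < r -> (w * v)%C = RtoC 1 ->
  r / 2 <= Re (v * u) <= 3 / 2 * r -> Rabs (Im (v * u)) <= 3 / 2 * r ->
  / (9 * r) <= Re (w * / u).
Proof.
intros Hr Hw H1 H2.
assert (Hv : v <> RtoC 0).
{ intros ->; rewrite Cmult_0_r in Hw; injection Hw; lra. }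
assert (Hu : u <> RtoC 0).
{ intros ->; rewrite Cmult_0_r in H1; simpl in H1; lra. }
replace (w * / u)%C with (/ (v * u))%C.
- now apply re_Cinv_lower.
- replace w with (w * v * / v)%C by (field; auto); rewrite Hw; field; auto.
Qed.

Lemma lcont_scal v f : lcont f -> lcont (fun t => v * f t)%C.
Proof.
intros H; apply lcont_intro; intros t eps He.
  pose proof (Cmod_ge_0 v) as V0.
  assert (E0 : 0 < eps / (1 + Cmod v)) by (apply Rdiv_lt_0_compat; lra).
  destruct (proj1 (filterlim_locally (U := C_R_NormedModule) f (f t)) (H t)
     (mkposreal _ (Rdiv_lt_0_compat _ _ E0 (sqrt_lt_R0 2 ltac:(lra))))) as [d Hd].
  exists d; split; [apply cond_pos|]; intros s Hs.
  replace (v * f s - v * f t)%C with (v * (f s - f t))%C by ring.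
  rewrite Cmod_mult.
  assert (Cmod (f s - f t) < eps / (1 + Cmod v)).
  { specialize (Hd s Hs).
    apply (C_NormedModule_mixin_compat2) in Hd; simpl in Hd.
    replace (sqrt 2 * (eps / (1 + Cmod v) / sqrt 2)) with (eps / (1 + Cmod v)) in Hd
      by (field; split; [lra | apply Rgt_not_eq, sqrt_lt_R0; lra]).
    exact Hd. }
  apply Rle_lt_trans with (Cmod v * (eps / (1 + Cmod v))).
  - apply Rmult_le_compat_l; lra.
  - apply Rmult_lt_reg_r with (1 + Cmod v); [lra|].
    replace (Cmod v * (eps / (1 + Cmod v)) * (1 + Cmod v)) with (Cmod v * eps) by (field; lra).
    nra.
Qed.

(** Each of the four sides contributes to the imaginary part at least its length 2 r times 1/(9r),
    that is 2/9. *)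
Lemma kernel_int_lower p r z : 0 < r -> sq_core p r z -> 8 / 9 <= Cmod (kernel_int p r z).
Proof.
intros Hr Hz.
assert (L : line_cont (fun w => / (w - z))%C (Re p - r) (Re p + r) (Im p - r) (Im p + r)).
{ intros w Hw; apply holo_ccont, holo_inv; [apply holo_sub_const|].
  apply (Csub_neq_0 w z (r / 4)); [lra | now apply (core_near p r)]. }
apply Rle_trans with (Im (kernel_int p r z)).
2:{ eapply Rle_trans; [apply Rle_abs|]; destruct (kernel_int p r z) as [u v] eqn:E.
    eapply Rle_trans; [|apply Rmax_Cmod]; apply Rmax_r. }
unfold kernel_int, square_contour, rect_contour.
apply line_cont_lcont in L; destruct L as (A1 & A2 & A3 & A4).
destruct Hz as [Z1 Z2]; apply Rabs_le_between in Z1; apply Rabs_le_between in Z2.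
set (f1 := fun x => (/ ((x, (Im p - r)%R) - z))%C) in *.
set (f2 := fun x => (/ ((x, (Im p + r)%R) - z))%C) in *.
set (f3 := fun y => (/ (((Re p + r)%R, y) - z))%C) in *.
set (f4 := fun y => (/ (((Re p - r)%R, y) - z))%C) in *.
replace (line_int f1 (Re p - r) (Re p + r) - line_int f2 (Re p - r) (Re p + r) +
    Ci * (line_int f3 (Im p - r) (Im p + r) - line_int f4 (Im p - r) (Im p + r)))%C
 with (line_int f1 (Re p - r) (Re p + r) + (-(1)) * line_int f2 (Re p - r) (Re p + r) +
    (Ci * line_int f3 (Im p - r) (Im p + r) + (- Ci) * line_int f4 (Im p - r) (Im p + r)))%C by ring.
rewrite <- !line_int_scal by auto.
rewrite !im_plus.
assert (Q : / (9 * r) * (2 * r) = 2 / 9) by (field; lra).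
assert (I1 : (Re p + r - (Re p - r)) * / (9 * r) <= Im (line_int f1 (Re p - r) (Re p + r))).
{ apply line_int_im_lower; [lra | auto using lcont_scal |]; intros t Ht.
  replace (Im (f1 t)) with (Re (- Ci * f1 t)) by (destruct (f1 t); simpl; ring).
  apply (re_mult_Cinv_lower _ Ci); auto; [apply injective_projections; simpl; ring | |];
    destruct z as [z1 z2]; simpl in *; [lra | apply Rabs_le; lra]. }
assert (I2 : (Re p + r - (Re p - r)) * / (9 * r) <=
  Im (line_int (fun t => (-(1)) * f2 t)%C (Re p - r) (Re p + r))).
{ apply line_int_im_lower; [lra | auto using lcont_scal |]; intros t Ht.
  replace (Im (- (1) * f2 t)) with (Re (Ci * f2 t)) by (destruct (f2 t); simpl; ring).
  apply (re_mult_Cinv_lower _ (- Ci)%C); auto; [apply injective_projections; simpl; ring | |];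
    destruct z as [z1 z2]; simpl in *; [lra | apply Rabs_le; lra]. }
assert (I3 : (Im p + r - (Im p - r)) * / (9 * r) <=
  Im (line_int (fun t => Ci * f3 t)%C (Im p - r) (Im p + r))).
{ apply line_int_im_lower; [lra | auto using lcont_scal |]; intros t Ht.
  replace (Im (Ci * f3 t)) with (Re (1 * f3 t)) by (destruct (f3 t); simpl; ring).
  apply (re_mult_Cinv_lower _ (RtoC 1)); auto; [apply injective_projections; simpl; ring | |];
    destruct z as [z1 z2]; simpl in *; [lra | apply Rabs_le; lra]. }
assert (I4 : (Im p + r - (Im p - r)) * / (9 * r) <=
  Im (line_int (fun t => - Ci * f4 t)%C (Im p - r) (Im p + r))).
{ apply line_int_im_lower; [lra | auto using lcont_scal |]; intros t Ht.
  replace (Im (- Ci * f4 t)) with (Re (- (1) * f4 t)) by (destruct (f4 t); simpl; ring).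
  apply (re_mult_Cinv_lower _ (- RtoC 1)%C); auto; [apply injective_projections; simpl; ring | |];
    destruct z as [z1 z2]; simpl in *; [lra | apply Rabs_le; lra]. }
lra.
Qed.

(** * Cauchy's formula *)

Lemma kernel_int_eq p r z : kernel_int p r z = cauchy_int (fun _ => RtoC 1) p r z.
Proof.
unfold kernel_int, cauchy_int, square_contour; apply rect_contour_ext; intros w _; unfold Cdiv; now rewrite Cmult_1_l.
Qed.

(** Differentiation under the integral, from the exact expansion 1/(w - v) = 1/(w - z) + (v - z)/(w
    - z)^2 + (v - z)^2 / ((w - z)^2 (w - v)). The last integral stays bounded as v tends to z,
    because v keeps its distance from the contour. *)
Lemma cauchy_int_holo f p r z : 0 < r -> (forall w, sq_lines p r w -> ccont f w) ->
  sq_core p r z -> holo (cauchy_int f p r) z.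
Proof.
intros Hr Hf Hz.
destruct (boundary_bounded f _ _ _ _ Hf) as [M [M0 HM]].
set (D := square_contour (fun w => f w / ((w - z) * (w - z)))%C p r).
assert (HL : forall w, sq_lines p r w -> r / 2 <= Cmod (w - z)).
{ intros w Hw; now apply (sq_core_dist p r). }
assert (HL' : forall w, sq_lines p r w -> (w - z)%C <> RtoC 0).
{ intros w Hw; apply (Csub_neq_0 w z (r / 2)); [lra | auto]. }
apply holo_iff; exists D; intros eps He.
set (K := 16 * r * (M / ((r / 2) * (r / 2) * (r / 4)))).
assert (P : 0 < (r / 2) * (r / 2) * (r / 4)).
{ repeat apply Rmult_lt_0_compat; lra. }
assert (K0 : 0 <= K).
{ unfold K; apply Rmult_le_pos; [lra|]; apply Rle_div_r; lra. }
exists (Rmin (r / 4) (eps / (K + 1))); split.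
{ apply Rmin_glb_lt; [lra|apply Rdiv_lt_0_compat; lra]. }
intros v Hv.
assert (V1 := Rlt_le_trans _ _ _ Hv (Rmin_l _ _)).
assert (V2 := Rlt_le_trans _ _ _ Hv (Rmin_r _ _)).
assert (HV : forall w, sq_lines p r w -> r / 4 <= Cmod (w - v)).
{ intros w Hw; apply (sq_lines_dist p r); auto; destruct Hz as [Z1 Z2].
  - pose proof (re_le_Cmod_sub v z) as T; apply Rabs_le_between in T, Z1; apply Rabs_le; lra.
  - pose proof (im_le_Cmod_sub v z) as T; apply Rabs_le_between in T, Z2; apply Rabs_le; lra. }
assert (HV' : forall w, sq_lines p r w -> (w - v)%C <> RtoC 0).
{ intros w Hw; apply (Csub_neq_0 w v (r / 4)); [lra | auto]. }
set (g := fun w => (f w / ((w - z) * (w - z) * (w - v)))%C).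
assert (Cg : line_cont g (Re p - r) (Re p + r) (Im p - r) (Im p + r)).
{ intros w Hw; apply ccont_div; [now apply Hf| |].
  - apply holo_mult; [apply holo_mult|]; apply holo_sub_const.
  - repeat apply Cmult_neq_0; auto. }
assert (Cv : line_cont (fun w => f w / (w - v))%C (Re p - r) (Re p + r) (Im p - r) (Im p + r)).
{ intros w Hw; apply ccont_div; [now apply Hf| apply holo_sub_const|auto]. }
assert (Cz : line_cont (fun w => f w / (w - z))%C (Re p - r) (Re p + r) (Im p - r) (Im p + r)).
{ intros w Hw; apply ccont_div; [now apply Hf| apply holo_sub_const|auto]. }
assert (Cz2 : line_cont (fun w => f w / ((w - z) * (w - z)))%C (Re p - r) (Re p + r) (Im p - r) (Im p + r)).
{ intros w Hw; apply ccont_div; [now apply Hf| |apply Cmult_neq_0; auto].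
  apply holo_mult; apply holo_sub_const. }
assert (E : cauchy_int f p r v =
  (cauchy_int f p r z + (v - z) * D + (v - z) * (v - z) * square_contour g p r)%C).
{ unfold cauchy_int, D, square_contour.
  rewrite <- !rect_contour_scal by auto.
  rewrite <- (rect_contour_plus (fun w => f w / (w - z))%C); auto.
  2:{ intros w Hw; apply ccont_mult; [apply ccont_const | auto]. }
  rewrite <- rect_contour_plus.
  - apply rect_contour_ext; intros w Hw; unfold g.
    specialize (HL' w Hw); specialize (HV' w Hw); field; auto.
  - intros w Hw; apply ccont_plus; auto; apply ccont_mult; [apply ccont_const | auto].
  - intros w Hw; apply ccont_mult; [apply ccont_const | auto]. }
rewrite E.
replace (cauchy_int f p r z + (v - z) * D + (v - z) * (v - z) * square_contour g p r
  - cauchy_int f p r z - (v - z) * D)%C with ((v - z) * ((v - z) * square_contour g p r))%C by ring.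
rewrite !Cmod_mult, (Rmult_comm eps); apply Rmult_le_compat_l; [apply Cmod_ge_0|].
assert (B : Cmod (square_contour g p r) <= K).
{ unfold square_contour; eapply Rle_trans; [apply rect_contour_bound with (M := M / ((r / 2) * (r / 2) * (r / 4)))|];
    auto; try lra.
  - intros w Hw; unfold g; destruct Hw as [Hw Hw'].
    rewrite Cmod_div by (repeat apply Cmult_neq_0; auto).
    rewrite !Cmod_mult.
    specialize (HL w Hw); specialize (HV w Hw).
    assert (r / 2 * (r / 2) * (r / 4) <= Cmod (w - z) * Cmod (w - z) * Cmod (w - v)).
    { apply Rmult_le_compat; try lra; [apply Rmult_le_pos; lra|].
      apply Rmult_le_compat; lra. }
    apply Rmult_le_compat; [apply Cmod_ge_0| |apply HM; split; auto|].
    + left; apply Rinv_0_lt_compat; lra.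
    + apply Rinv_le_contravar; lra.
  - unfold K; apply Rmult_le_compat_r; [apply Rle_div_r; lra|lra]. }
apply Rle_trans with (eps / (K + 1) * K).
- apply Rmult_le_compat; auto using Cmod_ge_0; lra.
- apply Rmult_le_reg_r with (K + 1); [lra|].
  replace (eps / (K + 1) * K * (K + 1)) with (eps * K) by (field; lra); nra.
Qed.

Lemma kernel_int_holo p r z : 0 < r -> sq_core p r z -> holo (kernel_int p r) z.
Proof.
intros Hr Hz; apply (holo_ext_loc (cauchy_int (fun _ => RtoC 1) p r) _ z 1).
- lra.
- intros w _; symmetry; apply kernel_int_eq.
- apply cauchy_int_holo; auto; intros; apply ccont_const.
Qed.

Lemma kernel_int_neq_0 p r z : 0 < r -> sq_core p r z -> kernel_int p r z <> RtoC 0.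
Proof.
intros Hr Hz E; pose proof (kernel_int_lower p r z Hr Hz) as H.
rewrite E, Cmod_0 in H; lra.
Qed.

(** The difference quotient of [h] at [z], completed by the derivative, is continuous everywhere and
    holomorphic off [z] and [E], so its contour integral vanishes. The exceptional list [E] is what
    makes removable singularities accessible. *)
Lemma cauchy_formula (E : list C) h p r z : 0 < r -> sq_core p r z ->
  (forall w, ccont h w) -> (forall w, ~ In w E -> holo h w) -> holo h z ->
  cauchy_int h p r z = (h z * kernel_int p r z)%C.
Proof.
intros Hr Hz Hc Hh Hhz.
pose proof Hhz as [l Hl]; rewrite is_cderive_iff in Hl.
set (k := fun w => if excluded_middle_informative (w = z) then l
   else ((h w - h z) / (w - z))%C).
assert (Kz : k z = l).
{ unfold k; destruct (excluded_middle_informative _); congruence. }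
assert (Kn : forall w, w <> z -> k w = ((h w - h z) / (w - z))%C).
{ intros w Hw; unfold k; destruct (excluded_middle_informative _); congruence. }
assert (Near : forall w, w <> z -> exists d, 0 < d /\
  forall v, Cmod (v - w) < d -> ((h v - h z) / (v - z))%C = k v).
{ intros w Hw; exists (Cmod (w - z)); split; [apply Cmod_gt_0, Cminus_eq_contra; auto|].
  intros v Hv; symmetry; apply Kn; intros ->; rewrite Cmod_sub_comm in Hv; lra. }
assert (Kc : forall w, ccont k w).
{ intros w; destruct (classic (w = z)) as [->|Hw].
  - intros eps He; destruct (Hl (eps / 2)) as [d [d0 Hd]]; [lra|].
    exists d; split; auto; intros v Hv; rewrite Kz.
    destruct (classic (v = z)) as [->|Hv'].
    + rewrite Kz; replace (l - l)%C with (RtoC 0) by ring; rewrite Cmod_0; lra.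
    + rewrite Kn by auto; specialize (Hd v Hv).
      assert (Hn : (v - z)%C <> RtoC 0) by (now apply Cminus_eq_contra).
      assert (Hp : 0 < Cmod (v - z)) by (now apply Cmod_gt_0).
      replace ((h v - h z) / (v - z) - l)%C
        with ((h v - h z - (v - z) * l) / (v - z))%C by (field; auto).
      rewrite Cmod_div by auto.
      apply Rle_lt_trans with (eps / 2); [|lra].
      apply Rle_div_l; lra.
  - destruct (Near w Hw) as [d [d0 Hd]]; intros eps He.
    assert (Q : ccont (fun v => (h v - h z) / (v - z))%C w).
    { apply ccont_div; [apply ccont_minus; auto; apply ccont_const|apply holo_sub_const|].
      now apply Cminus_eq_contra. }
    destruct (Q eps He) as [d' [d0' Hd']].
    exists (Rmin d d'); split; [now apply Rmin_glb_lt|].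
    intros v Hv.
    rewrite <- Hd by (eapply Rlt_le_trans; [exact Hv|apply Rmin_l]).
    rewrite <- (Hd w) by (replace (w - w)%C with (RtoC 0) by ring; now rewrite Cmod_0).
    apply Hd'; eapply Rlt_le_trans; [exact Hv|apply Rmin_r]. }
assert (I : square_contour k p r = RtoC 0).
{ unfold square_contour; apply (goursat_except (z :: E)); auto; try lra.
  intros w Hw _ _.
  assert (Hw1 : w <> z) by (intros ->; apply Hw; now left).
  destruct (Near w Hw1) as [d [d0 Hd]].
  apply (holo_ext_loc _ _ w d d0 Hd).
  apply holo_div; [| apply holo_sub_const | now apply Cminus_eq_contra].
  apply holo_minus; [|apply holo_const]; apply Hh; intros Hi; apply Hw; now right. }
assert (L : forall w, sq_lines p r w -> (w - z)%C <> RtoC 0).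
{ intros w Hw; apply (Csub_neq_0 w z (r / 2)); [lra | now apply (sq_core_dist p r)]. }
assert (C1 : line_cont (fun w => / (w - z))%C (Re p - r) (Re p + r) (Im p - r) (Im p + r)).
{ intros w Hw; apply holo_ccont, holo_inv; [apply holo_sub_const|auto]. }
transitivity (square_contour k p r + h z * kernel_int p r z)%C; [|rewrite I; ring].
unfold cauchy_int, kernel_int, square_contour.
rewrite <- rect_contour_scal by auto.
rewrite <- rect_contour_plus.
- apply rect_contour_ext; intros w Hw; specialize (L w Hw).
  rewrite Kn by (intros ->; apply L; ring). field; auto.
- intros w _; auto.
- intros w Hw; apply ccont_mult; [apply ccont_const | auto].
Qed.

(** Near [p] the formula presents [f] as a quotient of two holomorphic functions of [z]. Both
    removability and stability under limits reduce to this. *)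
Lemma cauchy_repr_holo f p r : 0 < r -> (forall w, ccont f w) ->
  (forall z, Cmod (z - p) <= r / 2 -> cauchy_int f p r z = (f z * kernel_int p r z)%C) ->
  holo f p.
Proof.
intros Hr Hf H.
assert (Hc : forall z, Cmod (z - p) <= r / 2 -> sq_core p r z).
{ intros z Hz; split; (eapply Rle_trans; [|exact Hz]).
  - apply re_le_Cmod_sub.
  - apply im_le_Cmod_sub. }
assert (H0 : Cmod (p - p) <= r / 2).
{ replace (p - p)%C with (RtoC 0) by ring; rewrite Cmod_0; lra. }
apply (holo_ext_loc (fun z => cauchy_int f p r z / kernel_int p r z)%C f p (r / 2)).
- lra.
- intros z Hz; rewrite H by lra; field; apply kernel_int_neq_0; auto; apply Hc; lra.
- apply holo_div; [apply cauchy_int_holo | apply kernel_int_holo | apply kernel_int_neq_0]; auto.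
Qed.

Lemma ccont_eq_off f g p : ccont f p -> ccont g p ->
  (exists r, 0 < r /\ forall z, z <> p -> Cmod (z - p) < r -> f z = g z) -> f p = g p.
Proof.
intros Hf Hg [r [r0 H]].
apply NNPP; intros Hne.
assert (N : 0 < Cmod (f p - g p)) by (apply Cmod_gt_0; now apply Cminus_eq_contra).
destruct (Hf (Cmod (f p - g p) / 2)) as [d1 [P1 Q1]]; [lra|].
destruct (Hg (Cmod (f p - g p) / 2)) as [d2 [P2 Q2]]; [lra|].
set (d := Rmin r (Rmin d1 d2)).
assert (d0 : 0 < d) by (repeat apply Rmin_glb_lt; auto).
assert (D1 : d <= r) by apply Rmin_l.
assert (D2 : d <= d1) by (eapply Rle_trans; [apply Rmin_r|apply Rmin_l]).
assert (D3 : d <= d2) by (eapply Rle_trans; [apply Rmin_r|apply Rmin_r]).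
set (z := (p + RtoC (d / 2))%C).
assert (Ez : (z - p)%C = RtoC (d / 2)) by (unfold z; ring).
assert (Ez' : Cmod (z - p) = d / 2) by (rewrite Ez, Cmod_R, Rabs_pos_eq; lra).
assert (Hz : z <> p).
{ intros e; rewrite e in Ez'; replace (p - p)%C with (RtoC 0) in Ez' by ring.
  rewrite Cmod_0 in Ez'; lra. }
specialize (Q1 z ltac:(lra)); specialize (Q2 z ltac:(lra)).
rewrite (H z Hz) in Q1 by lra.
pose proof (Cmod_triangle (g z - g p) (- (g z - f p))) as T.
replace (g z - g p + - (g z - f p))%C with (f p - g p)%C in T by ring.
rewrite Cmod_opp in T; lra.
Qed.

(** Cauchy's formula with [p] as exceptional point holds at all other points of the disc; both of
    its sides are continuous, so it holds at [p] too. *)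
Lemma removable_singularity h p : (forall z, ccont h z) ->
  (forall z, z <> p -> holo h z) -> entire h.
Proof.
intros Hc Hh z.
destruct (classic (z = p)) as [->|Hz]; [|now apply Hh].
apply (cauchy_repr_holo h p 1); auto; try lra.
assert (Q : forall v, Cmod (v - p) <= 1 / 2 -> sq_core p 1 v).
{ intros v Hv; split; (eapply Rle_trans; [|exact Hv]).
  - apply re_le_Cmod_sub.
  - apply im_le_Cmod_sub. }
assert (F : forall v, v <> p -> Cmod (v - p) <= 1 / 2 ->
  cauchy_int h p 1 v = (h v * kernel_int p 1 v)%C).
{ intros v Hv Hv'; apply (cauchy_formula (p :: nil)); auto; try lra.
  intros w Hw; apply Hh; intros ->; apply Hw; now left. }
intros v Hv; destruct (classic (v = p)) as [->|Hvp]; [|now apply F].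
apply (ccont_eq_off (cauchy_int h p 1) (fun v => h v * kernel_int p 1 v)%C).
- apply holo_ccont, cauchy_int_holo; auto; lra.
- apply ccont_mult; auto; apply holo_ccont, kernel_int_holo; auto; lra.
- exists (1 / 2); split; [lra|]; intros; apply F; auto; lra.
Qed.

Lemma entire_factor f p : entire f -> f p = RtoC 0 ->
  exists h, entire h /\ forall z, f z = ((z - p) * h z)%C.
Proof.
intros Hf Hp.
destruct (Hf p) as [l Hl]; rewrite is_cderive_iff in Hl.
set (k := fun w => if excluded_middle_informative (w = p) then l
   else (f w / (w - p))%C).
assert (Kp : k p = l).
{ unfold k; destruct (excluded_middle_informative _); congruence. }
assert (Kn : forall w, w <> p -> k w = (f w / (w - p))%C).
{ intros w Hw; unfold k; destruct (excluded_middle_informative _); congruence. }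
exists k; split.
2:{ intros z; destruct (classic (z = p)) as [->|Hz].
    - rewrite Hp; ring.
    - rewrite Kn by auto; field; now apply Cminus_eq_contra. }
assert (Hh : forall z, z <> p -> holo k z).
{ intros w Hw; apply (holo_ext_loc (fun w => f w / (w - p))%C k w (Cmod (w - p))).
  - apply Cmod_gt_0, Cminus_eq_contra; auto.
  - intros v Hv; symmetry; apply Kn; intros ->; rewrite Cmod_sub_comm in Hv; lra.
  - apply holo_div; [apply Hf | apply holo_sub_const | now apply Cminus_eq_contra]. }
apply (removable_singularity k p); auto.
intros z; destruct (classic (z = p)) as [->|Hz]; [|now apply holo_ccont, Hh].
intros eps He; destruct (Hl (eps / 2)) as [d [d0 Hd]]; [lra|].
exists d; split; auto; intros v Hv; rewrite Kp.
destruct (classic (v = p)) as [->|Hv'].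
- rewrite Kp; replace (l - l)%C with (RtoC 0) by ring; rewrite Cmod_0; lra.
- rewrite Kn by auto; specialize (Hd v Hv); rewrite Hp in Hd.
  assert (Hn : (v - p)%C <> RtoC 0) by (now apply Cminus_eq_contra).
  assert (Hpos : 0 < Cmod (v - p)) by (now apply Cmod_gt_0).
  replace (f v / (v - p) - l)%C
    with ((f v - 0 - (v - p) * l) / (v - p))%C by (field; auto).
  rewrite Cmod_div by auto.
  apply Rle_lt_trans with (eps / 2); [|lra].
  apply Rle_div_l; lra.
Qed.

Lemma cauchy_int_bound f p r z M : 0 < r -> sq_core p r z ->
  (forall w, sq_lines p r w -> ccont f w) ->
  (forall w, sq_boundary p r w -> Cmod (f w) <= M) ->
  Cmod (cauchy_int f p r z) <= 16 * M.
Proof.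
intros Hr Hz Hf HM; unfold cauchy_int, square_contour.
replace (16 * M) with (2 * ((Re p + r - (Re p - r)) + (Im p + r - (Im p - r))) * (M / (r / 2)))
  by (field; lra).
apply rect_contour_bound; try lra.
- apply line_cont_div; auto; now apply core_near.
- intros w Hw; pose proof (sq_core_dist p r w z (proj1 Hw) Hz).
  rewrite Cmod_div by (apply (Csub_neq_0 w z (r / 2)); lra).
  specialize (HM w Hw).
  apply Rmult_le_compat; auto using Cmod_ge_0.
  + left; apply Rinv_0_lt_compat; lra.
  + apply Rinv_le_contravar; lra.
Qed.

(** The contour integral is at most 16 M, namely perimeter 8 r times M / (r/2), and dividing by the
    lower bound 8/9 of the kernel integral gives 18 M. *)
Lemma cauchy_estimate f p r z M : 0 < r -> sq_core p r z -> entire f ->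
  (forall w, sq_boundary p r w -> Cmod (f w) <= M) -> Cmod (f z) <= 18 * M.
Proof.
intros Hr Hz Hf HM.
assert (Hc : forall w, ccont f w) by (intros; now apply entire_ccont).
pose proof (cauchy_int_bound f p r z M Hr Hz (fun w _ => Hc w) HM) as B.
rewrite (cauchy_formula nil f p r z) in B; auto; [|intros w _; apply Hf|apply Hf].
rewrite Cmod_mult in B.
pose proof (kernel_int_lower p r z Hr Hz).
pose proof (Cmod_ge_0 (f z)); nra.
Qed.

Lemma entire_bounded f r : entire f ->
  exists M, 0 <= M /\ forall z, Cmod z <= r -> Cmod (f z) <= M.
Proof.
intros Hf.
set (s := 2 * (Rabs r + 1)).
assert (s0 : 0 < s) by (unfold s; pose proof (Rabs_pos r); lra).
destruct (boundary_bounded f (Re 0 - s) (Re 0 + s) (Im 0 - s) (Im 0 + s)) as [M [M0 HM]].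
{ intros z _; now apply entire_ccont. }
exists (18 * M); split; [lra|].
intros z Hz; apply (cauchy_estimate f (RtoC 0) s z M); auto.
assert (Hs : Cmod z <= s / 2).
{ apply Rle_trans with (1 := Hz); pose proof (Rle_abs r); unfold s; lra. }
assert (Ez : (z - 0)%C = z) by ring.
split; (apply Rle_trans with (2 := Hs)); rewrite <- Ez at 2.
- apply re_le_Cmod_sub.
- apply im_le_Cmod_sub.
Qed.

Lemma sq_boundary_near p r w : 0 < r -> sq_boundary p r w -> Cmod (w - p) <= 2 * r.
Proof.
intros Hr [_ [H1 H2]]; eapply Rle_trans; [apply Cmod_le_components|].
assert (Rabs (Re w - Re p) <= r) by (apply Rabs_le; lra).
assert (Rabs (Im w - Im p) <= r) by (apply Rabs_le; lra).
lra.
Qed.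

(** Cauchy's formula passes to the limit, since the contour integral is controlled by the supremum
    over the contour; a continuous function satisfying the formula is holomorphic. *)
Lemma entire_locally_uniform_limit (F : nat -> C -> C) f : (forall n, entire (F n)) ->
  (forall R eps, 0 < eps -> exists N, forall z, Cmod z <= R -> Cmod (f z - F N z) <= eps) ->
  entire f.
Proof.
intros HF H.
assert (Hc : forall z, ccont f z).
{ intros z eps He; destruct (H (Cmod z + 1) (eps / 4)) as [N HN]; [lra|].
  destruct (entire_ccont (F N) (HF N) z (eps / 4)) as [d [d0 Hd]]; [lra|].
  exists (Rmin d 1); split; [apply Rmin_glb_lt; lra|]; intros w Hw.
  specialize (Hd w (Rlt_le_trans _ _ _ Hw (Rmin_l _ _))).
  assert (W := Rlt_le_trans _ _ _ Hw (Rmin_r _ _)).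
  pose proof (Cmod_triangle3 w z).
  pose proof (HN w ltac:(lra)); pose proof (HN z ltac:(lra)) as Hz.
  replace (f w - f z)%C with ((f w - F N w) + (F N w - F N z) + - (f z - F N z))%C by ring.
  eapply Rle_lt_trans; [apply Cmod_triangle|].
  eapply Rle_lt_trans; [apply Rplus_le_compat_r, Cmod_triangle|].
  rewrite Cmod_opp; lra. }
intros p; apply (cauchy_repr_holo f p 1); auto; try lra.
intros z Hz.
assert (Q : sq_core p 1 z).
{ split; (eapply Rle_trans; [|exact Hz]); [apply re_le_Cmod_sub | apply im_le_Cmod_sub]. }
apply Ceq_minus, Cmod_eq_0, Rle_antisym; [|apply Cmod_ge_0].
apply le_epsilon; intros eps He; rewrite Rplus_0_l.
set (kk := Cmod (kernel_int p 1 z)).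
assert (k0 : 0 <= kk) by apply Cmod_ge_0.
(* An error e in the function costs 16 e in the contour integral and [kk * e] in the product. The
   radius covers the whole contour, whose points are within 2 of [p]. *)
destruct (H (Cmod p + 2) (eps / (16 + kk))) as [N HN]; [apply Rdiv_lt_0_compat; lra|].
assert (E : cauchy_int f p 1 z =
  (cauchy_int (fun w => f w - F N w)%C p 1 z + cauchy_int (F N) p 1 z)%C).
{ unfold cauchy_int, square_contour; rewrite <- rect_contour_plus.
  - apply rect_contour_ext; intros w Hw; field.
    apply (Csub_neq_0 w z (1 / 2)); [lra|]; now apply (sq_core_dist p 1).
  - apply line_cont_div; try lra; [|now apply core_near; try lra].
    intros w _; apply ccont_minus; auto; now apply entire_ccont.
  - apply line_cont_div; try lra; [|now apply core_near; try lra].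
    intros w _; now apply entire_ccont. }
rewrite E, (cauchy_formula nil (F N)); auto; try lra.
2: intros; now apply entire_ccont.
2: intros; now apply HF.
2: now apply HF.
replace (cauchy_int (fun w => f w - F N w) p 1 z + F N z * kernel_int p 1 z - f z * kernel_int p 1 z)%C
  with (cauchy_int (fun w => f w - F N w) p 1 z + - ((f z - F N z) * kernel_int p 1 z))%C by ring.
eapply Rle_trans; [apply Cmod_triangle|]; rewrite Cmod_opp, Cmod_mult.
fold kk.
assert (Hzn : Cmod z <= Cmod p + 2).
{ pose proof (Cmod_triangle3 z p); lra. }
apply Rle_trans with (16 * (eps / (16 + kk)) + (eps / (16 + kk)) * kk).
- apply Rplus_le_compat; [|apply Rmult_le_compat_r; auto].
  apply cauchy_int_bound; auto; try lra.
  + intros w _; apply ccont_minus; auto; now apply entire_ccont.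
  + intros w Hw; apply HN.
    pose proof (sq_boundary_near p 1 w Rlt_0_1 Hw); pose proof (Cmod_triangle3 w p); lra.
- right; field; lra.
Qed.

(** * Limits and zeros of entire functions *)

Lemma functional_choice_nat {A : Type} (P : nat -> A -> Prop) :
  (forall n, exists a, P n a) -> exists s, forall n, P n (s n).
Proof.
intros H; exists (fun n => proj1_sig (constructive_indefinite_description _ (H n))).
intros n; apply proj2_sig.
Qed.

Lemma pow_half_pos n : 0 < (1 / 2) ^ n.
Proof. apply pow_lt; lra. Qed.

Lemma pow_half_nonneg_inv x c n : 0 <= x -> x <= c * (1 / 2) ^ n -> 0 <= c.
Proof.
intros H1 H2; pose proof (pow_half_pos n).
apply Rmult_le_reg_r with ((1 / 2) ^ n); lra.
Qed.

Lemma pow_half_le n m : (n <= m)%nat -> (1 / 2) ^ m <= (1 / 2) ^ n.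
Proof.
intros H; replace m with (n + (m - n))%nat by lia; rewrite pow_add.
pose proof (pow_half_pos n).
pose proof (pow_incr (1 / 2) 1 (m - n) ltac:(lra)) as H'; rewrite pow1 in H'.
rewrite <- (Rmult_1_r ((1 / 2) ^ n)) at 2; apply Rmult_le_compat_l; lra.
Qed.

(** The subtracted term is exactly what the remaining differences may still use up; it makes the
    induction on [k] close. *)
Lemma geometric_tail (u : nat -> C) (c : R) (K : nat) :
  (forall m, (K <= m)%nat -> Cmod (u (S m) - u m) <= c * (1 / 2) ^ m) ->
  forall m k, (K <= m)%nat -> Cmod (u (m + k)%nat - u m) <= 2 * c * (1 / 2) ^ m - 2 * c * (1 / 2) ^ (m + k).
Proof.
intros H m k Hm; induction k as [|k IH].
- rewrite Nat.add_0_r; replace (u m - u m)%C with (RtoC 0) by ring; rewrite Cmod_0; lra.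
- rewrite Nat.add_succ_r.
  replace (u (S (m + k)) - u m)%C with ((u (S (m + k)) - u (m + k)%nat) + (u (m + k)%nat - u m))%C by ring.
  eapply Rle_trans; [apply Cmod_triangle|].
  specialize (H (m + k)%nat ltac:(lia)); change ((1 / 2) ^ S (m + k)) with (1 / 2 * (1 / 2) ^ (m + k)); lra.
Qed.

Lemma complex_limit (u : nat -> C) (c : R) (K : nat) :
  (forall m, (K <= m)%nat -> Cmod (u (S m) - u m) <= c * (1 / 2) ^ m) ->
  exists l, forall m, (K <= m)%nat -> Cmod (l - u m) <= 2 * c * (1 / 2) ^ m.
Proof.
intros H.
assert (c0 : 0 <= c).
{ exact (pow_half_nonneg_inv _ c K (Cmod_ge_0 _) (H K (Nat.le_refl K))). }
assert (T : forall m k, (K <= m)%nat -> Cmod (u (m + k)%nat - u m) <= 2 * c * (1 / 2) ^ m).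
{ intros m k Hm; pose proof (geometric_tail u c K H m k Hm).
  pose proof (pow_half_pos (m + k)); nra. }
assert (Cau : forall (g : C -> R), (forall a b, Rabs (g a - g b) <= Cmod (a - b)) ->
  Cauchy_crit (fun n => g (u n))).
{ intros g Hg eps He.
  destruct (pow_half_small (4 * c) eps He) as [N HN].
  exists (max K N); intros n m Hn Hm; unfold Rdist.
  assert (B : forall j, (j >= max K N)%nat -> Rabs (g (u j) - g (u (max K N))) < eps / 2).
  { intros j Hj; eapply Rle_lt_trans; [apply Hg|].
    replace j with (max K N + (j - max K N))%nat by lia.
    eapply Rle_lt_trans; [apply T; lia|].
    pose proof (pow_half_le N (max K N) ltac:(lia)).
    assert (c * (1 / 2) ^ max K N <= c * (1 / 2) ^ N) by (now apply Rmult_le_compat_l).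
    lra. }
  pose proof (B n Hn) as B1; pose proof (B m Hm) as B2.
  apply Rabs_lt_between in B1; apply Rabs_lt_between in B2; apply Rabs_lt_between; lra. }
destruct (Rcomplete.R_complete _ (Cau Re re_le_Cmod_sub)) as [l1 H1].
destruct (Rcomplete.R_complete _ (Cau Im im_le_Cmod_sub)) as [l2 H2].
exists (l1, l2); intros m Hm.
apply le_epsilon; intros eps He.
destruct (H1 (eps / 2)) as [N1 Q1]; [lra|].
destruct (H2 (eps / 2)) as [N2 Q2]; [lra|].
set (j := (m + (N1 + N2))%nat).
replace ((l1, l2) - u m)%C with (((l1, l2) - u j) + (u j - u m))%C by ring.
eapply Rle_trans; [apply Cmod_triangle|].
assert (Cmod ((l1, l2) - u j) <= eps).
{ specialize (Q1 j ltac:(unfold j; lia)); specialize (Q2 j ltac:(unfold j; lia)).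
  unfold Rdist in Q1, Q2; rewrite Rabs_minus_sym in Q1, Q2.
  eapply Rle_trans; [apply Cmod_le_components|]; simpl; simpl in Q1, Q2; lra. }
pose proof (T m (N1 + N2)%nat Hm); fold j in H3; lra.
Qed.

Lemma entire_geometric_limit (F : nat -> C -> C) : (forall n, entire (F n)) ->
  (forall r, exists c K, forall m, (K <= m)%nat -> forall z, Cmod z <= r ->
    Cmod (F (S m) z - F m z) <= c * (1 / 2) ^ m) ->
  exists f, entire f /\ forall z eps, 0 < eps -> exists N, forall m, (N <= m)%nat ->
    Cmod (f z - F m z) <= eps.
Proof.
intros HF H.
assert (L : forall z, exists l, forall eps, 0 < eps -> exists N, forall m, (N <= m)%nat ->
  Cmod (l - F m z) <= eps).
{ intros z; destruct (H (Cmod z)) as (c & K & HK).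
  destruct (complex_limit (fun n => F n z) c K) as [l Hl].
  { intros m Hm; apply HK; auto; lra. }
  exists l; intros eps He; destruct (pow_half_small (2 * c) eps He) as [N HN].
  exists (max K N); intros m Hm; eapply Rle_trans; [apply Hl; lia|].
  assert (c0 : 0 <= c).
  { exact (pow_half_nonneg_inv _ c K (Cmod_ge_0 _) (HK K (Nat.le_refl K) z (Rle_refl _))). }
  pose proof (pow_half_le N m ltac:(lia)).
  assert (2 * c * (1 / 2) ^ m <= 2 * c * (1 / 2) ^ N) by (apply Rmult_le_compat_l; lra).
  lra. }
set (f := fun z => proj1_sig (constructive_indefinite_description _ (L z))).
assert (Hf : forall z eps, 0 < eps -> exists N, forall m, (N <= m)%nat ->
    Cmod (f z - F m z) <= eps).
{ intros z; unfold f; apply proj2_sig. }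
exists f; split; auto.
apply (entire_locally_uniform_limit F); auto.
intros r eps He; destruct (H r) as (c & K & HK).
destruct (pow_half_small (2 * c) eps He) as [N HN].
exists (max K N); intros z Hz.
apply le_epsilon; intros e e0.
destruct (Hf z e e0) as [j Hj].
set (m := max K N).
pose proof (geometric_tail (fun n => F n z) c K (fun m Hm => HK m Hm z Hz) m j ltac:(unfold m; lia)) as T.
cbv beta in T.
specialize (Hj (m + j)%nat ltac:(lia)).
replace (f z - F m z)%C with ((f z - F (m + j)%nat z) + (F (m + j)%nat z - F m z))%C by ring.
eapply Rle_trans; [apply Cmod_triangle|].
assert (c0 : 0 <= c).
{ exact (pow_half_nonneg_inv _ c K (Cmod_ge_0 _) (HK K (Nat.le_refl K) z Hz)). }
assert (2 * c * (1 / 2) ^ m <= 2 * c * (1 / 2) ^ N).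
{ apply Rmult_le_compat_l; [lra|].
  apply pow_half_le; unfold m; lia. }
assert (0 <= 2 * c * (1 / 2) ^ (m + j)).
{ apply Rmult_le_pos; [lra|]; left; apply pow_half_pos. }
lra.
Qed.

(** Applied with [u] the partial sums or products and [t] the part beyond stage [n], divided by its
    common factor [q]: the factor [q] then survives in the limit. *)
Lemma limit_transfer (u t : nat -> C) s g a q n :
  (forall eps, 0 < eps -> exists N, forall m, (N <= m)%nat -> Cmod (s - u m) <= eps) ->
  (forall eps, 0 < eps -> exists N, forall m, (N <= m)%nat -> Cmod (g - t m) <= eps) ->
  (forall m, u (n + m)%nat = (a + q * t m)%C) -> s = (a + q * g)%C.
Proof.
intros Hu Ht E.
apply Ceq_minus, Cmod_eq_0, Rle_antisym; [|apply Cmod_ge_0].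
apply le_epsilon; intros eps He; rewrite Rplus_0_l.
pose proof (Cmod_ge_0 q) as q0.
destruct (Hu (eps / 2)) as [N1 H1]; [lra|].
destruct (Ht (eps / (2 * (1 + Cmod q)))) as [N2 H2]; [apply Rdiv_lt_0_compat; lra|].
specialize (H1 (n + (N1 + N2))%nat ltac:(lia)); specialize (H2 (N1 + N2)%nat ltac:(lia)).
rewrite E in H1; set (v := t (N1 + N2)%nat) in *.
replace (s - (a + q * g))%C with ((s - (a + q * v)) + - (q * (g - v)))%C by ring.
eapply Rle_trans; [apply Cmod_triangle|]; rewrite Cmod_opp, Cmod_mult.
assert (Cmod q * Cmod (g - v) <= Cmod q * (eps / (2 * (1 + Cmod q)))) by
  (apply Rmult_le_compat_l; auto).
assert (Cmod q * (eps / (2 * (1 + Cmod q))) <= eps / 2).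
{ apply Rmult_le_reg_r with (2 * (1 + Cmod q)); [lra|].
  replace (Cmod q * (eps / (2 * (1 + Cmod q))) * (2 * (1 + Cmod q))) with (Cmod q * eps)
    by (field; lra).
  nra. }
lra.
Qed.

(** * Lists of roots with multiplicity and the splitting off of zeros *)

Fixpoint rootprod (l : list C) (z : C) : C :=
  match l with
  | nil => RtoC 1
  | w :: l => ((z - w) * rootprod l z)%C
  end.

Lemma rootprod_app l1 l2 z : rootprod (l1 ++ l2) z = (rootprod l1 z * rootprod l2 z)%C.
Proof. induction l1 as [|w l1 IH]; simpl; [|rewrite IH]; ring. Qed.

Lemma entire_sub_const p : entire (fun z => z - p)%C.
Proof. intros z; apply holo_sub_const. Qed.

Lemma rootprod_entire l : entire (rootprod l).
Proof.
induction l as [|w l IH]; [apply entire_const|].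
apply (entire_mult (fun z => z - w)%C (rootprod l)); auto; apply entire_sub_const.
Qed.

Lemma rootprod_root l w : In w l -> rootprod l w = RtoC 0.
Proof.
induction l as [|v l IH]; simpl; [easy|intros [->|H]].
- ring.
- rewrite IH by auto; ring.
Qed.

Lemma rootprod_neq_0 l w : ~ In w l -> rootprod l w <> RtoC 0.
Proof.
induction l as [|v l IH]; simpl; intros H.
- apply C1_nz.
- apply Cmult_neq_0; [apply Cminus_eq_contra; intros -> | apply IH]; tauto.
Qed.

Fixpoint rootbound (l : list C) (r : R) : R :=
  match l with
  | nil => 1
  | w :: l => (1 + r + Cmod w) * rootbound l r
  end.

Lemma rootbound_ge_1 l r : 0 <= r -> 1 <= rootbound l r.
Proof.
intros Hr; induction l as [|w l IH]; simpl; [lra|].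
pose proof (Cmod_ge_0 w); nra.
Qed.

Lemma rootbound_app l1 l2 r : rootbound (l1 ++ l2) r = rootbound l1 r * rootbound l2 r.
Proof. induction l1 as [|w l1 IH]; simpl; [|rewrite IH]; ring. Qed.

Lemma rootprod_bound l r z : Cmod z <= r -> Cmod (rootprod l z) <= rootbound l r.
Proof.
intros Hz; induction l as [|w l IH]; simpl.
- rewrite Cmod_1; lra.
- rewrite Cmod_mult.
  pose proof (Cmod_ge_0 z); pose proof (Cmod_ge_0 w).
  apply Rmult_le_compat; auto using Cmod_ge_0.
  eapply Rle_trans; [apply Cmod_triangle|]; rewrite Cmod_opp; lra.
Qed.

Lemma entire_cancel_root w f g : entire f -> entire g ->
  (forall z, ((z - w) * f z = (z - w) * g z)%C) -> forall z, f z = g z.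
Proof.
intros Hf Hg H.
assert (Off : forall z, z <> w -> f z = g z).
{ intros z Hz; specialize (H z).
  assert (Hn : (z - w)%C <> RtoC 0) by (now apply Cminus_eq_contra).
  replace (f z) with (/ (z - w) * ((z - w) * f z))%C by (field; auto).
  rewrite H; field; auto. }
intros z; destruct (classic (z = w)) as [->|Hz]; auto.
apply ccont_eq_off; try (now apply entire_ccont).
exists 1; split; [lra|auto].
Qed.

Lemma entire_cancel_rootprod l f g : entire f -> entire g ->
  (forall z, (rootprod l z * f z = rootprod l z * g z)%C) -> forall z, f z = g z.
Proof.
intros Hf Hg; induction l as [|w l IH]; simpl; intros H.
- intros z; specialize (H z); rewrite !Cmult_1_l in H; auto.
- apply IH; apply (entire_cancel_root w).
  + apply entire_mult; auto; apply rootprod_entire.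
  + apply entire_mult; auto; apply rootprod_entire.
  + intros z; rewrite !Cmult_assoc; apply H.
Qed.

(** Otherwise [n] linear factors can be split off for every [n]. At [z0] each of them is at most B
    in modulus, on the boundary of the square of half-side 3 B around [z0] at least 2 B. The
    estimate for the cofactor then gives |q z0| <= 18 M 2^-n for all [n], against q z0 <> 0. *)
Lemma finitely_many_zeros q r : entire q -> (exists z, q z <> RtoC 0) ->
  exists l h, entire h /\ (forall z, q z = (rootprod l z * h z)%C) /\
    (forall z, Cmod z <= r -> h z <> RtoC 0).
Proof.
intros Hq [z0 Hz0]; apply NNPP; intros Hno.
assert (Chain : forall n, exists l h, length l = n /\ (forall w, In w l -> Cmod w <= r) /\
  entire h /\ forall z, q z = (rootprod l z * h z)%C).
{ induction n as [|n (l & h & Hl & Hr & Hh & E)].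
  - exists nil, q; repeat split; auto; [easy|]; intros; simpl; ring.
  - assert (Z : exists w, Cmod w <= r /\ h w = RtoC 0).
    { apply NNPP; intros Hz; apply Hno; exists l, h; repeat split; auto.
      intros z Hz1 Hz2; apply Hz; now exists z. }
    destruct Z as (w & Hw & Ew).
    destruct (entire_factor h w Hh Ew) as (h' & Hh' & E').
    exists (w :: l), h'; repeat split; auto.
    + simpl; auto.
    + intros v [<-|Hv]; auto.
    + intros z; rewrite E, E'; simpl; ring. }
set (B := Cmod z0 + Rabs r + 1).
assert (B1 : 1 <= B) by (unfold B; pose proof (Rabs_pos r); pose proof (Cmod_ge_0 z0); lra).
destruct (boundary_bounded q (Re z0 - 3 * B) (Re z0 + 3 * B) (Im z0 - 3 * B) (Im z0 + 3 * B))
  as [M [M0 HM]].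
{ intros z _; now apply entire_ccont. }
assert (Q0 : 0 < Cmod (q z0)) by (now apply Cmod_gt_0).
destruct (pow_half_small (18 * M) _ Q0) as [n Hn].
destruct (Chain n) as (l & h & Hl & Hr & Hh & E).
assert (Hr' : forall w, In w l -> Cmod (z0 - w) <= B).
{ intros w Hw; specialize (Hr w Hw); eapply Rle_trans; [apply Cmod_triangle|].
  rewrite Cmod_opp; unfold B; pose proof (Rle_abs r); lra. }
assert (Up : Cmod (rootprod l z0) <= B ^ n).
{ rewrite <- Hl; clear - Hr' B1; induction l as [|w l IH]; simpl; [rewrite Cmod_1; lra|].
  rewrite Cmod_mult; apply Rmult_le_compat; auto using Cmod_ge_0.
  - apply Hr'; now left.
  - apply IH; intros; apply Hr'; now right. }
assert (Low : forall v, sq_boundary z0 (3 * B) v -> (2 * B) ^ n <= Cmod (rootprod l v)).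
{ intros v Hv; rewrite <- Hl.
  assert (Dist : 3 * B <= Cmod (v - z0)).
  { destruct Hv as [[H|[H|[H|H]]] _].
    1, 2: eapply Rle_trans; [|apply re_le_Cmod_sub].
    3, 4: eapply Rle_trans; [|apply im_le_Cmod_sub].
    all: rewrite H; unfold Rabs; destruct (Rcase_abs _); lra. }
  clear - Hr' B1 Dist; induction l as [|w l IH]; simpl; [rewrite Cmod_1; lra|].
  rewrite Cmod_mult; apply Rmult_le_compat; try lra.
  - apply pow_le; lra.
  - pose proof (Hr' w (or_introl eq_refl)).
    pose proof (Cmod_triangle (v - w) (- (z0 - w))) as T.
    replace (v - w + - (z0 - w))%C with (v - z0)%C in T by ring.
    rewrite Cmod_opp in T; lra.
  - apply IH; intros; apply Hr'; now right. }
assert (P2 : 0 < (2 * B) ^ n) by (apply pow_lt; lra).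
assert (Eh : Cmod (h z0) <= 18 * (M / (2 * B) ^ n)).
{ apply (cauchy_estimate h z0 (3 * B)); auto; [lra| |].
  - split; unfold Rminus; rewrite Rplus_opp_r, Rabs_R0; lra.
  - intros v Hv; specialize (HM v Hv); specialize (Low v Hv).
    rewrite E, Cmod_mult in HM.
    apply Rle_div_r; auto.
    pose proof (Cmod_ge_0 (h v)); nra. }
apply (Rlt_irrefl (Cmod (q z0))).
eapply Rle_lt_trans; [|exact Hn].
rewrite E, Cmod_mult.
eapply Rle_trans; [apply Rmult_le_compat; [apply Cmod_ge_0 | apply Cmod_ge_0 | exact Up | exact Eh]|].
right; rewrite Rpow_mult_distr.
replace ((1 / 2) ^ n) with (/ 2 ^ n).
- field; split; apply pow_nonzero; lra.
- rewrite <- pow_inv; f_equal; lra.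
Qed.

Fixpoint prefix (L : nat -> list C) (n : nat) : list C :=
  match n with
  | O => nil
  | S n => prefix L n ++ L n
  end.

(** Batches of nodes moving off to infinity: whatever is done for [L n] can be made harmless on the
    disc of radius n - 1. *)
Definition shells (L : nat -> list C) : Prop :=
  forall n w, In w (L n) -> INR n <= Cmod w.

(** Stage [n] splits off the zeros of the current cofactor in the disc of radius n + 1. That
    cofactor has no zeros of modulus less than n, which places the whole batch outside that disc. *)
Lemma zero_shells q : entire q -> (exists z, q z <> RtoC 0) ->
  exists (L : nat -> list C) (H : nat -> C -> C), shells L /\
    (forall n, entire (H n)) /\
    (forall n z, q z = (rootprod (prefix L n) z * H n z)%C) /\
    (forall n z, Cmod z < INR n -> H n z <> RtoC 0).
Proof.
intros Hq Hnz.
set (P (n : nat) (h : C -> C) := entire h /\ (exists z, h z <> RtoC 0) /\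
  forall z, Cmod z < INR n -> h z <> RtoC 0).
set (Q (n : nat) (h h' : C -> C) := exists l, (forall w, In w l -> INR n <= Cmod w) /\
  forall z, h z = (rootprod l z * h' z)%C).
assert (D : exists s, forall n, P n (s n) /\ Q n (s n) (s (S n)) /\ (n = O -> s n = q)).
{ destruct (dependent_choice (fun n h => P n h /\ (n = O -> h = q)) Q) as [s Hs].
  - exists q; repeat split; auto; simpl; intros z Hz; pose proof (Cmod_ge_0 z); lra.
  - intros n h [(Hh & Hn & Hv) _].
    destruct (finitely_many_zeros h (INR (S n)) Hh Hn) as (l & h' & Hh' & E & Hv').
    exists h'; split; [split; [split; [auto|split]|easy]|].
    + destruct Hn as [z Hz]; exists z; intros Ez; apply Hz; rewrite E, Ez; ring.
    + intros z Hz; apply Hv'; lra.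
    + exists l; split; auto.
      intros w Hw; apply Rnot_lt_le; intros Hlt; apply (Hv w Hlt).
      rewrite E, rootprod_root by auto; ring.
  - exists s; intros n; destruct (Hs n); tauto. }
destruct D as [s Hs].
destruct (functional_choice_nat (fun n l => (forall w, In w l -> INR n <= Cmod w) /\
  forall z, s n z = (rootprod l z * s (S n) z)%C)) as [L HL].
{ intros n; apply (Hs n). }
exists L, s; repeat split.
- intros n; apply HL.
- intros n; apply (Hs n).
- induction n as [|n IH]; intros z; simpl.
  + rewrite (proj2 (proj2 (Hs O)) eq_refl); ring.
  + rewrite IH, rootprod_app, (proj2 (HL n)); ring.
- intros n; apply (Hs n).
Qed.

(** * Interpolation *)

Lemma entire_Cpow f n : entire f -> entire (fun z => Cpow (f z) n).
Proof.
intros Hf; induction n as [|n IH]; [exact (entire_const (RtoC 1))|].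
exact (entire_mult f (fun z => Cpow (f z) n) Hf IH).
Qed.

(** The function c (z/w)^m with m large: on the disc |z/w| is at most (n - 1)/n, and at [w] the
    power is 1. *)
Lemma damped_constant n w c eps : 0 < eps -> INR n <= Cmod w ->
  exists d, entire d /\ d w = c /\ forall z, Cmod z <= INR n - 1 -> Cmod (d z) <= eps.
Proof.
intros He Hw; destruct n as [|n].
(* For n = 0 the disc has radius -1 and is empty, so the constant itself will do. *)
- exists (fun _ => c); split; [apply entire_const|split; auto].
  intros z Hz; pose proof (Cmod_ge_0 z); simpl in Hz; lra.
- rewrite S_INR in *; pose proof (pos_INR n) as n0.
  set (rho := INR n / (INR n + 1)).
  assert (r0 : 0 <= rho) by (apply Rle_div_r; lra).
  assert (r1 : rho < 1) by (apply Rlt_div_l; lra).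
  assert (w0 : w <> RtoC 0) by (intros ->; rewrite Cmod_0 in Hw; lra).
  pose proof (Cmod_ge_0 c) as c0.
  destruct (pow_lt_1_zero rho ltac:(rewrite Rabs_pos_eq; lra) (eps / (1 + Cmod c)))
    as [m Hm]; [apply Rdiv_lt_0_compat; lra|].
  specialize (Hm m (Nat.le_refl m)).
  rewrite Rabs_pos_eq in Hm by (now apply pow_le).
  exists (fun z => c * Cpow (z / w) m)%C; split; [|split].
  + apply (entire_mult (fun _ => c) (fun z => Cpow (z / w) m)); [apply entire_const|].
    apply (entire_Cpow (fun z => z / w)%C).
    apply (entire_mult (fun z => z) (fun _ => / w)%C); [apply entire_id | apply entire_const].
  + replace (w / w)%C with (RtoC 1) by (field; auto); rewrite Cpow_1_l; ring.
  + intros z Hz; rewrite Cmod_mult, Cmod_pow, Cmod_div by auto.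
    assert (B : Cmod z / Cmod w <= rho).
    { unfold rho; apply Rmult_le_compat; try lra; auto using Cmod_ge_0.
      - left; apply Rinv_0_lt_compat; lra.
      - apply Rinv_le_contravar; lra. }
    assert ((Cmod z / Cmod w) ^ m <= rho ^ m).
    { apply pow_incr; split; auto; apply Rle_div_r; [lra|]; rewrite Rmult_0_l; apply Cmod_ge_0. }
    apply Rle_trans with (Cmod c * (eps / (1 + Cmod c))).
    * apply Rmult_le_compat_l; lra.
    * apply Rmult_le_reg_r with (1 + Cmod c); [lra|].
      replace (Cmod c * (eps / (1 + Cmod c)) * (1 + Cmod c)) with (Cmod c * eps) by (field; lra).
      nra.
Qed.

(* [S l v] reads "v solves the interpolation problem at the nodes l"; the
   Newton-type correction [rootprod l * d] settles one more node without
   spoiling the previous ones, multiplicities being repeated nodes. *)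
Definition nodewise_solvable (adm : list C -> Prop) (S : list C -> (C -> C) -> Prop) : Prop :=
  (forall l l', adm (l ++ l') -> adm l) /\
  (forall l v v' d, S l v -> entire v -> entire d ->
     (forall z, v' z = (v z + rootprod l z * d z)%C) -> S l v') /\
  (forall l w v, adm (l ++ [w]) -> entire v -> S l v ->
     exists c, forall d, entire d -> d w = c ->
       S (l ++ [w]) (fun z => v z + rootprod l z * d z)%C).

Lemma entire_correction l v d : entire v -> entire d ->
  entire (fun z => v z + rootprod l z * d z)%C.
Proof.
intros Hv Hd; apply entire_plus; auto; apply entire_mult; auto; apply rootprod_entire.
Qed.

Lemma nodewise_shell adm S n L : nodewise_solvable adm S ->
  (forall w, In w L -> INR n <= Cmod w) -> forall l v eps, 0 < eps ->
  adm (l ++ L) -> entire v -> S l v ->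
  exists d, entire d /\ S (l ++ L) (fun z => v z + rootprod l z * d z)%C /\
    forall z, Cmod z <= INR n - 1 -> Cmod (d z) <= eps.
Proof.
intros HS; destruct HS as (Hadm & Hext & Hstep).
induction L as [|w L IH]; intros HL l v eps He Ha Hv Hs.
- exists (fun _ => RtoC 0); split; [apply entire_const|split].
  + rewrite app_nil_r; apply (Hext l v _ (fun _ => RtoC 0)); auto; apply entire_const.
  + intros; rewrite Cmod_0; lra.
- replace (l ++ w :: L) with ((l ++ [w]) ++ L) in * by (rewrite <- app_assoc; auto).
  destruct (Hstep l w v (Hadm _ _ Ha) Hv Hs) as [c Hc].
  destruct (damped_constant n w c (eps / 2)) as (d0 & D1 & D2 & D3); [lra|apply HL; now left|].
  set (v1 := fun z => (v z + rootprod l z * d0 z)%C).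
  assert (Hv1 : entire v1) by (now apply entire_correction).
  pose proof (pos_INR n); pose proof (Cmod_ge_0 w).
  (* Later corrections come with the extra factor z - w, which is at most 1 + n + |w| on the disc;
     the tolerance is divided by it in advance. *)
  destruct (IH (fun u Hu => HL u (or_intror Hu)) (l ++ [w]) v1 (eps / (2 * (1 + INR n + Cmod w))))
    as (d1 & E1 & E2 & E3); auto.
  { apply Rdiv_lt_0_compat; lra. }
  { now apply Hc. }
  exists (fun z => d0 z + rootprod [w] z * d1 z)%C; split; [|split].
  + now apply entire_correction.
  + apply (Hext _ (fun z => v1 z + rootprod (l ++ [w]) z * d1 z)%C _ (fun _ => RtoC 0)); auto.
    * now apply entire_correction.
    * apply entire_const.
    * intros z; unfold v1; rewrite rootprod_app; simpl; ring.
  + intros z Hz; specialize (D3 z Hz); specialize (E3 z Hz).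
    eapply Rle_trans; [apply Cmod_triangle|]; rewrite Cmod_mult.
    assert (Cmod (rootprod [w] z) <= 1 + INR n + Cmod w).
    { simpl; rewrite Cmult_1_r; eapply Rle_trans; [apply Cmod_triangle|]; rewrite Cmod_opp; lra. }
    assert (Cmod (rootprod [w] z) * Cmod (d1 z) <=
      (1 + INR n + Cmod w) * (eps / (2 * (1 + INR n + Cmod w)))).
    { apply Rmult_le_compat; auto using Cmod_ge_0. }
    replace ((1 + INR n + Cmod w) * (eps / (2 * (1 + INR n + Cmod w)))) with (eps / 2) in *
      by (field; lra).
    lra.
Qed.

Lemma prefix_add L n k :
  prefix L (n + k) = prefix L n ++ prefix (fun i => L (n + i)%nat) k.
Proof.
induction k as [|k IH]; [now rewrite Nat.add_0_r, app_nil_r|].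
rewrite Nat.add_succ_r; simpl; now rewrite IH, app_assoc.
Qed.

(** A Newton series: stage [n] adds [rootprod (prefix L n) * d n] with [d n] so small that the term
    is at most 2^-n on the disc of radius n - 1. The limit differs from the n-th partial solution by
    a multiple of [rootprod (prefix L n)], and such a change preserves solvedness at the nodes of
    [prefix L n]. *)
Theorem nodewise_interpolation adm S (L : nat -> list C) : nodewise_solvable adm S ->
  shells L -> (forall n, adm (prefix L n)) -> S nil (fun _ => RtoC 0) ->
  exists v, entire v /\ forall n, S (prefix L n) v.
Proof.
intros HS HL Ha H0.
set (P n v := entire v /\ S (prefix L n) v).
set (small n d := entire d /\ forall z, Cmod z <= INR n - 1 ->
  Cmod (d z) <= (1 / 2) ^ n / rootbound (prefix L n) (INR n)).
destruct (dependent_choice P (fun n v v' => exists d, small n d /\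
  forall z, v' z = (v z + rootprod (prefix L n) z * d z)%C)) as [s Hs].
- exists (fun _ => RtoC 0); split; auto; apply entire_const.
- intros n v [Hv Hsv].
  destruct (nodewise_shell adm S n (L n) HS (HL n) (prefix L n) v
    ((1 / 2) ^ n / rootbound (prefix L n) (INR n))) as (d & D1 & D2 & D3); auto.
  { apply Rdiv_lt_0_compat; [apply pow_half_pos|].
    pose proof (rootbound_ge_1 (prefix L n) (INR n) (pos_INR n)); lra. }
  { apply (Ha (1 + n)%nat). }
  exists (fun z => v z + rootprod (prefix L n) z * d z)%C; repeat split; auto.
  + now apply entire_correction.
  + exists d; repeat split; auto.
- destruct (functional_choice_nat (fun n d => small n d /\
    forall z, s (1 + n)%nat z = (s n z + rootprod (prefix L n) z * d z)%C)) as [d Hd].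
  { intros n; apply (Hs n). }
  (* [T n k] is the sum of the stages n, ..., n + k - 1 divided by [rootprod (prefix L n)]. Its
     convergence to an entire function shows that the whole remainder is an entire multiple of that
     product. *)
  set (T n := fix T k z := match k with O => RtoC 0 | Datatypes.S k =>
    (T k z + rootprod (prefix (fun i => L (n + i)%nat) k) z * d (n + k)%nat z)%C end).
  assert (HT : forall n k z, s (n + k)%nat z = (s n z + rootprod (prefix L n) z * T n k z)%C).
  { intros n k z; induction k as [|k IH]; simpl.
    - rewrite Nat.add_0_r; ring.
    - rewrite Nat.add_succ_r; change (Datatypes.S (n + k)) with (1 + (n + k))%nat.
      rewrite (proj2 (Hd _)), IH, prefix_add, rootprod_app; ring. }
  assert (ET : forall n k, entire (T n k)).
  { intros n k; induction k as [|k IH]; simpl; [apply entire_const|].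
    apply entire_correction; auto; apply Hd. }
  assert (Lim : forall n, exists g, entire g /\ forall z eps, 0 < eps ->
    exists N, forall m, (N <= m)%nat -> Cmod (g z - T n m z) <= eps).
  { intros n; apply entire_geometric_limit; auto.
    intros r; destruct (INR_unbounded (r + 1)) as [K HK].
    exists 1, K; intros m Hm z Hz; simpl.
    replace (T n m z + rootprod (prefix (fun i => L (n + i)%nat) m) z * d (n + m)%nat z - T n m z)%C
      with (rootprod (prefix (fun i => L (n + i)%nat) m) z * d (n + m)%nat z)%C by ring.
    assert (Hm' : INR K <= INR (n + m)) by (apply le_INR; lia).
    assert (B := proj2 (proj1 (Hd (n + m)%nat)) z ltac:(lra)).
    rewrite Cmod_mult.
    pose proof (rootprod_bound (prefix (fun i => L (n + i)%nat) m) (INR (n + m)) z ltac:(lra)) as B'.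
    pose proof (rootbound_ge_1 (prefix L n) (INR (n + m)) (pos_INR _)) as G1.
    pose proof (rootbound_ge_1 (prefix (fun i => L (n + i)%nat) m) (INR (n + m)) (pos_INR _)) as G2.
    rewrite prefix_add, rootbound_app in B.
    set (p := rootbound (prefix L n) (INR (n + m))) in *.
    set (q := rootbound (prefix (fun i => L (n + i)%nat) m) (INR (n + m))) in *.
    apply Rle_trans with (q * ((1 / 2) ^ (n + m) / (p * q))).
    - apply Rmult_le_compat; auto using Cmod_ge_0.
    - replace (q * ((1 / 2) ^ (n + m) / (p * q))) with ((1 / 2) ^ (n + m) / p) by (field; lra).
      pose proof (pow_half_pos (n + m)).
      pose proof (pow_half_le m (n + m) ltac:(lia)).
      apply Rle_div_l; [lra|]; nra. }
  destruct (Lim O) as (g0 & G0 & C0).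
  assert (Conv : forall z eps, 0 < eps -> exists N, forall m, (N <= m)%nat ->
    Cmod (s O z + g0 z - s m z) <= eps).
  { intros z eps He; destruct (C0 z eps He) as [N HN]; exists N; intros m Hm.
    pose proof (HT O m z) as E; simpl in E; rewrite E.
    replace (s O z + g0 z - (s O z + 1 * T O m z))%C with (g0 z - T O m z)%C by ring; auto. }
  exists (fun z => s O z + g0 z)%C; split; [apply entire_plus; auto; apply (Hs O)|].
  intros n; destruct (Lim n) as (g & G & Cg).
  apply ((proj1 (proj2 HS)) (prefix L n) (s n) _ g); auto; try apply (Hs n).
  intros z; apply (limit_transfer (fun m => s m z) (fun m => T n m z) _ _ _ _ n); auto.
Qed.

Theorem integer_interpolation (a : Z -> C) :
  exists v, entire v /\ forall n : Z, v (RtoC (IZR n)) = a n.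
Proof.
set (L n := [RtoC (IZR (Z.of_nat n)); RtoC (IZR (- Z.of_nat n))]).
set (adm l := forall w, In w l -> exists n : Z, w = RtoC (IZR n)).
set (S l (v : C -> C) := forall n : Z, In (RtoC (IZR n)) l -> v (RtoC (IZR n)) = a n).
assert (Hadm : forall n, adm (prefix L n)).
{ induction n as [|n IH]; simpl; intros w Hw; [easy|].
  apply in_app_or in Hw; destruct Hw as [Hw|[<-|[<-|[]]]]; eauto. }
destruct (nodewise_interpolation adm S L) as (v & Hv & HS); auto.
- split; [|split].
  + intros l l' H w Hw; apply H, in_or_app; auto.
  + intros l v v' d Hs _ _ E n Hn; rewrite E, rootprod_root by auto.
    rewrite Hs by auto; ring.
  + intros l w v Ha Hv Hs.
    destruct (Ha w) as [m ->]; [apply in_or_app; right; now left|].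
    (* Batch 0 contains the node 0 twice, as 0 and as -0; a repeated node is already settled and any
       correction will do. *)
    destruct (classic (In (RtoC (IZR m)) l)) as [Hin|Hnin].
    * exists (RtoC 0); intros d Hd Ed n Hn.
      assert (Hn' : In (RtoC (IZR n)) l).
      { apply in_app_or in Hn; destruct Hn as [Hn|[<-|[]]]; auto. }
      rewrite rootprod_root, Hs by auto; ring.
    * exists ((a m - v (RtoC (IZR m))) / rootprod l (RtoC (IZR m)))%C; intros d Hd Ed n Hn.
      apply in_app_or in Hn; destruct Hn as [Hn|[Hn|[]]].
      -- rewrite rootprod_root, Hs by auto; ring.
      -- apply RtoC_inj, eq_IZR in Hn; subst n; rewrite Ed; field.
         now apply rootprod_neq_0.
- intros n w Hw; rewrite INR_IZR_INZ.
  destruct Hw as [<-|[<-|[]]]; rewrite Cmod_R; [apply Rle_abs|].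
  rewrite opp_IZR, Rabs_Ropp; apply Rle_abs.
- intros n [].
- exists v; split; auto; intros n.
  apply (HS (1 + Z.abs_nat n)%nat); simpl; apply in_or_app; right.
  unfold L; destruct (Z.abs_spec n) as [[H E]|[H E]].
  + left; do 2 f_equal; lia.
  + right; left; do 2 f_equal; lia.
Qed.

Definition edivides (q f : C -> C) : Prop :=
  exists h, entire h /\ forall z, f z = (q z * h z)%C.

(** On the disc of radius [n] the quotient f/q is [e n / H n] with a zero-free denominator.
    Cancelling the root products shows that these local quotients agree where they overlap, so they
    glue to an entire function. *)
Lemma edivides_of_shells q f L H : entire q -> entire f ->
  (forall n : nat, entire (H n)) ->
  (forall n z, q z = (rootprod (prefix L n) z * H n z)%C) ->
  (forall n z, Cmod z < INR n -> H n z <> RtoC 0) ->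
  (forall n, edivides (rootprod (prefix L n)) f) -> edivides q f.
Proof.
intros Hq Hf HH Eq Hnz Hd.
destruct (functional_choice_nat _ Hd) as [e He].
assert (Hext : forall m n z, (m <= n)%nat -> Cmod z < INR m -> (e m z / H m z = e n z / H n z)%C).
{ intros m n z Hmn Hz.
  replace n with (m + (n - m))%nat in * by lia; set (k := (n - m)%nat) in *.
  set (R := rootprod (prefix (fun i => L (m + i)%nat) k)).
  assert (E1 : forall z, e m z = (R z * e (m + k)%nat z)%C).
  { apply (entire_cancel_rootprod (prefix L m)); [apply He| |].
    - apply entire_mult; [apply rootprod_entire|apply He].
    - intros v; rewrite <- (proj2 (He m)), Cmult_assoc; unfold R.
      rewrite <- rootprod_app, <- prefix_add; apply He. }
  assert (E2 : forall z, H m z = (R z * H (m + k)%nat z)%C).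
  { apply (entire_cancel_rootprod (prefix L m)); auto.
    - apply entire_mult; [apply rootprod_entire|auto].
    - intros v; rewrite <- Eq, Cmult_assoc; unfold R.
      rewrite <- rootprod_app, <- prefix_add; apply Eq. }
  pose proof (Hnz m z Hz) as N; rewrite E1, E2 in *.
  assert (R z <> RtoC 0) by (intros E; apply N; rewrite E; ring).
  assert (H (m + k)%nat z <> RtoC 0) by (intros E; apply N; rewrite E; ring).
  field; auto. }
assert (Big : forall z, exists n, Cmod z < INR n).
{ intros z; destruct (INR_unbounded (Cmod z)) as [n Hn]; now exists n. }
set (idx z := proj1_sig (constructive_indefinite_description _ (Big z))).
assert (Hidx : forall z, Cmod z < INR (idx z)).
{ intros z; unfold idx; apply proj2_sig. }
set (u z := (e (idx z) z / H (idx z) z)%C).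
assert (Hu : forall n z, Cmod z < INR n -> u z = (e n z / H n z)%C).
{ intros n z Hz; unfold u; destruct (Nat.le_ge_cases n (idx z)).
  - symmetry; now apply Hext.
  - apply Hext; auto. }
exists u; split.
- intros p; destruct (Big p) as [n Hn].
  apply (holo_ext_loc (fun z => e n z / H n z)%C u p (INR n - Cmod p)).
  + lra.
  + intros z Hz; symmetry; apply Hu; pose proof (Cmod_triangle3 z p); lra.
  + apply holo_div; [apply He | apply HH | now apply Hnz].
- intros z; unfold u; rewrite (proj2 (He (idx z))), (Eq (idx z) z) at 1.
  field; now apply Hnz.
Qed.

(* The alternative [t w = 0] covers simple roots of [q] at which [b] vanishes. *)
Theorem solve_congruence q b t : entire q -> entire b -> entire t ->
  (exists z, q z <> RtoC 0) ->
  (forall w, q w = RtoC 0 -> b w <> RtoC 0 \/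
     (t w = RtoC 0 /\ ~ edivides (fun z => (z - w) * (z - w))%C q)) ->
  exists v, entire v /\ edivides q (fun z => b z * v z - t z)%C.
Proof.
intros Hq Hb Ht Hnz Hroot.
destruct (zero_shells q Hq Hnz) as (L & H & HL & HH & Eq & Hnv).
set (adm l := edivides (rootprod l) q).
set (S l v := edivides (rootprod l) (fun z => b z * v z - t z)%C).
destruct (nodewise_interpolation adm S L) as (v & Hv & HS).
- split; [|split].
  + intros l l' (h & Hh & E); exists (fun z => rootprod l' z * h z)%C; split.
    * apply entire_mult; auto; apply rootprod_entire.
    * intros z; rewrite E, rootprod_app; ring.
  + intros l v v' d (e & He & E) Hv Hd Ev.
    exists (fun z => e z + b z * d z)%C; split.
    * apply entire_plus; auto; now apply entire_mult.
    * intros z; rewrite Ev; specialize (E z).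
      replace (b z * (v z + rootprod l z * d z) - t z)%C
        with ((b z * v z - t z) + b z * (rootprod l z * d z))%C by ring.
      rewrite E; ring.
  + intros l w v (h & Hh & Eh) Hv (e & He & E).
    (* The correction [rootprod l * d] changes the cofactor [e] into [e + b * d]; this has to vanish
       at [w] for the factor z - w to split off. *)
    assert (Hc : exists c, forall x, x = c -> (e w + b w * x = 0)%C).
    { destruct (classic (b w = RtoC 0)) as [Hbw|Hbw].
      - exists (RtoC 0); intros x ->.
        destruct (Hroot w) as [?|[Htw Hsim]]; [|contradiction|].
        { rewrite Eh, rootprod_app; simpl; ring. }
        (* Here [b w = 0], so the correction has no influence at [w]. Simplicity of the root keeps
           [w] out of [l], and then [t w = 0] already forces [e w = 0]. *)
        assert (Hl : ~ In w l).
        { intros Hin; apply Hsim.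
          apply in_split in Hin; destruct Hin as (l1 & l2 & ->).
          exists (fun z => rootprod (l1 ++ l2) z * h z)%C; split.
          - apply entire_mult; auto; apply rootprod_entire.
          - intros z; rewrite Eh, !rootprod_app; simpl; ring. }
        specialize (E w); rewrite Hbw, Htw in E.
        apply rootprod_neq_0 in Hl.
        replace (e w) with (/ rootprod l w * (rootprod l w * e w))%C by (field; auto).
        rewrite <- E, Hbw; ring.
      - exists (- e w / b w)%C; intros x ->; field; auto. }
    destruct Hc as [c Hc]; exists c; intros d Hd Ed.
    destruct (entire_factor (fun z => e z + b z * d z)%C w) as (k & Hk & Ek).
    * apply entire_plus; auto; now apply entire_mult.
    * now apply Hc.
    * exists k; split; auto; intros z; rewrite rootprod_app; simpl.
      specialize (E z); specialize (Ek z).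
      replace (b z * (v z + rootprod l z * d z) - t z)%C
        with ((b z * v z - t z) + b z * (rootprod l z * d z))%C by ring.
      rewrite E.
      replace (rootprod l z * e z + b z * (rootprod l z * d z))%C
        with (rootprod l z * (e z + b z * d z))%C by ring.
      rewrite Ek; ring.
- exact HL.
- intros n; exists (H n); auto.
- exists (fun z => b z * 0 - t z)%C; split.
  + apply entire_minus; auto; apply entire_mult; auto; apply entire_const.
  + intros z; simpl; ring.
- exists v; split; auto.
  apply (edivides_of_shells q _ L H); auto.
  apply entire_minus; auto; now apply entire_mult.
Qed.

(** * The complex exponential *)

Definition Cexp (z : C) : C := (exp (Re z) * cos (Im z), exp (Re z) * sin (Im z)).

Lemma Cexp_plus z w : Cexp (z + w) = (Cexp z * Cexp w)%C.
Proof.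
unfold Cexp; rewrite re_plus, im_plus, exp_plus, cos_plus, sin_plus.
unfold Cmult; simpl; f_equal; ring.
Qed.

Lemma Cexp_0 : Cexp 0 = RtoC 1.
Proof. unfold Cexp; simpl; rewrite exp_0, cos_0, sin_0; unfold RtoC; f_equal; ring. Qed.

Lemma Cexp_neq_0 z : Cexp z <> RtoC 0.
Proof.
intros H; pose proof (Cexp_plus z (- z)) as E.
replace (z + - z)%C with (RtoC 0) in E by ring.
rewrite Cexp_0, H, Cmult_0_l in E; now apply C1_nz.
Qed.

Lemma Cmod_Cexp z : Cmod (Cexp z) = exp (Re z).
Proof.
unfold Cmod, Cexp; simpl fst; simpl snd.
replace ((exp (Re z) * cos (Im z)) ^ 2 + (exp (Re z) * sin (Im z)) ^ 2) with (exp (Re z) ^ 2).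
- rewrite sqrt_pow2; auto; left; apply exp_pos.
- pose proof (sin2_cos2 (Im z)) as H; unfold Rsqr in H.
  replace ((exp (Re z) * cos (Im z)) ^ 2 + (exp (Re z) * sin (Im z)) ^ 2)
   with (exp (Re z) ^ 2 * (sin (Im z) * sin (Im z) + cos (Im z) * cos (Im z))) by ring.
  rewrite H; ring.
Qed.

Lemma Cexp_surjective w : w <> RtoC 0 -> exists z, Cexp z = w.
Proof.
intros Hw; assert (P : 0 < Cmod w) by (now apply Cmod_gt_0).
set (r := Cmod w) in *; destruct w as [x y].
assert (E : x * x + y * y = r * r).
{ unfold r, Cmod; simpl fst; simpl snd; rewrite sqrt_sqrt; nra. }
set (u := x / r); set (v := y / r).
assert (Euv : u * u + v * v = 1).
{ unfold u, v; replace (x / r * (x / r) + y / r * (y / r)) with ((x * x + y * y) / (r * r))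
    by (field; lra); rewrite E; field; lra. }
assert (Hu : -1 <= u <= 1) by nra.
assert (T : exists t, cos t = u /\ sin t = v).
{ assert (S : sqrt (1 - Rsqr u) = Rabs v).
  { rewrite <- sqrt_Rsqr_abs; f_equal; unfold Rsqr; lra. }
  destruct (Rle_lt_dec 0 v).
  - exists (acos u); rewrite cos_acos, sin_acos by auto; split; auto.
    rewrite S; now apply Rabs_pos_eq.
  - exists (- acos u); rewrite cos_neg, sin_neg, cos_acos, sin_acos by auto; split; auto.
    rewrite S, Rabs_left; lra. }
destruct T as (t & C1 & S1).
exists (ln r, t); unfold Cexp; simpl.
rewrite exp_ln, C1, S1 by auto; unfold u, v; f_equal; field; lra.
Qed.

Lemma cos_minus_1_bound y : Rabs (cos y - 1) <= y * y / 2.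
Proof.
assert (S : forall t, Rabs (sin t) <= Rabs t).
{ assert (S0 : forall t, 0 <= t -> Rabs (sin t) <= t).
  { intros t Ht; destruct (Req_dec t 0) as [->|]; [rewrite sin_0, Rabs_R0; lra|].
    apply Rabs_le; split; [|left; apply sin_lt_x; lra].
    destruct (Rle_lt_dec t PI).
    - pose proof (sin_ge_0 t ltac:(lra) ltac:(lra)); lra.
    - pose proof (SIN_bound t); pose proof PI2_1; lra. }
  intros t; destruct (Rle_lt_dec 0 t).
  - rewrite (Rabs_pos_eq t) by auto; auto.
  - rewrite (Rabs_left t) by auto; rewrite <- Rabs_Ropp, <- sin_neg; apply S0; lra. }
replace y with (2 * (y / 2)) at 1 by field.
rewrite cos_2a_sin.
replace (1 - 2 * sin (y / 2) * sin (y / 2) - 1) with (- (2 * (sin (y / 2) * sin (y / 2)))) by ring.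
specialize (S (y / 2)).
rewrite Rabs_Ropp, Rabs_pos_eq by nra.
apply Rsqr_le_abs_1 in S; unfold Rsqr in S; lra.
Qed.

Lemma sin_minus_id_bound y : Rabs (sin y - y) <= Rabs y * (y * y / 2).
Proof.
destruct (MVT_gen (fun t => sin t - t) 0 y (fun t => cos t - 1)) as (c & Hc & E).
- intros t _; auto_derive; auto; ring.
- intros t _; apply continuity_pt_minus; [apply continuity_sin | apply continuity_pt_id].
- cbv beta in E; rewrite sin_0 in E.
  replace (sin y - y) with ((cos c - 1) * (y - 0)) by lra.
  rewrite Rabs_mult, Rminus_0_r, Rmult_comm.
  apply Rmult_le_compat_l; [apply Rabs_pos|].
  eapply Rle_trans; [apply cos_minus_1_bound|].
  unfold Rmin, Rmax in Hc; destruct (Rle_dec 0 y); nra.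
Qed.

(** From 1 + t <= exp t at t = x and t = -x: the difference is nonnegative and at most 1/(1 - x) - 1
    - x = x^2/(1 - x), where 1 - x >= 1/2. *)
Lemma exp_minus_affine_bound x : Rabs x <= 1 / 2 -> Rabs (exp x - 1 - x) <= 2 * (x * x).
Proof.
intros Hx; apply Rabs_le_between in Hx.
assert (L : forall t, 1 + t <= exp t).
{ intros t; destruct (Req_dec t 0) as [->|H]; [rewrite exp_0; lra|left; now apply exp_ineq1]. }
pose proof (L x) as L1; pose proof (L (- x)) as L2.
assert (E : exp x * exp (- x) = 1) by (rewrite <- exp_plus, Rplus_opp_r; apply exp_0).
rewrite Rabs_pos_eq by lra.
pose proof (exp_pos x); nra.
Qed.

(** The constant is 6 = 2 + 3/4 + 3 + 1/4, one summand for each of the four real terms into which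
    the two components are split. *)
Lemma Cexp_affine_bound h : Cmod h <= 1 / 2 ->
  Cmod (Cexp h - 1 - h) <= 6 * (Cmod h * Cmod h).
Proof.
intros Hh; set (m := Cmod h) in *.
assert (Hx : Rabs (Re h) <= m) by apply re_le_Cmod.
assert (Hy : Rabs (Im h) <= m).
{ eapply Rle_trans; [|apply Rmax_Cmod]; apply Rmax_r. }
destruct h as [x y]; simpl in Hx, Hy.
pose proof (exp_minus_affine_bound x ltac:(lra)) as B1.
pose proof (cos_minus_1_bound y) as B2; pose proof (sin_minus_id_bound y) as B3.
pose proof (COS_bound y) as B4; pose proof (SIN_bound y) as B5.
assert (Xm : x * x <= m * m) by (apply Rabs_le_between in Hx; nra).
assert (Ym : y * y <= m * m) by (apply Rabs_le_between in Hy; nra).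
assert (m0 : 0 <= m) by apply Cmod_ge_0.
unfold Cexp; simpl Re; simpl Im.
replace (((exp x * cos y)%R, (exp x * sin y)%R) - 1 - (x, y))%C
  with ((exp x - 1 - x) * cos y + (1 + x) * (cos y - 1),
        (exp x - 1) * sin y + (sin y - y))
  by (unfold Cminus, Cplus, Copp, RtoC; simpl; f_equal; ring).
eapply Rle_trans; [apply Cmod_pair_le|].
assert (A1 : Rabs ((exp x - 1 - x) * cos y) <= 2 * (m * m)).
{ rewrite Rabs_mult.
  assert (Rabs (cos y) <= 1) by (apply Rabs_le; lra).
  pose proof (Rabs_pos (exp x - 1 - x)); pose proof (Rabs_pos (cos y)); nra. }
assert (A2 : Rabs ((1 + x) * (cos y - 1)) <= 3 / 2 * (m * m / 2)).
{ rewrite Rabs_mult.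
  assert (Rabs (1 + x) <= 3 / 2) by (apply Rabs_le_between in Hx; apply Rabs_le; lra).
  apply Rmult_le_compat; auto using Rabs_pos; lra. }
assert (A3 : Rabs ((exp x - 1) * sin y) <= 3 * (m * m)).
{ rewrite Rabs_mult.
  assert (Rabs (exp x - 1) <= 2 * m).
  { replace (exp x - 1) with ((exp x - 1 - x) + x) by ring.
    eapply Rle_trans; [apply Rabs_triang|]; nra. }
  assert (Rabs (sin y) <= m + m * (m * m / 2)).
  { replace (sin y) with ((sin y - y) + y) by ring.
    eapply Rle_trans; [apply Rabs_triang|].
    assert (Rabs y * (y * y / 2) <= m * (m * m / 2)).
    { apply Rmult_le_compat; auto using Rabs_pos; nra. }
    lra. }
  pose proof (Rabs_pos (exp x - 1)); pose proof (Rabs_pos (sin y)).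
  apply Rle_trans with (2 * m * (m + m * (m * m / 2))).
  - apply Rmult_le_compat; auto.
  - assert (m * (m * (m * m)) <= m * m * 1).
    { replace (m * (m * (m * m))) with (m * m * (m * m)) by ring.
      apply Rmult_le_compat_l; nra. }
    lra. }
assert (A4 : Rabs (sin y - y) <= m * m / 4).
{ eapply Rle_trans; [exact B3|].
  apply Rle_trans with (1 / 2 * (m * m / 2)); [|lra].
  apply Rmult_le_compat; auto using Rabs_pos; nra. }
pose proof (Rabs_triang ((exp x - 1 - x) * cos y) ((1 + x) * (cos y - 1))).
pose proof (Rabs_triang ((exp x - 1) * sin y) (sin y - y)).
assert (0 <= m * m) by nra.
lra.
Qed.

Lemma is_derive_Cexp z : is_derive (K := C_AbsRing) (V := C_NormedModule) Cexp z (Cexp z).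
Proof.
apply is_cderive_iff; intros eps He.
assert (P : 0 < Cmod (Cexp z)) by (apply Cmod_gt_0, Cexp_neq_0).
set (K := Cmod (Cexp z)) in *.
exists (Rmin (1 / 2) (eps / (6 * K))); split.
{ apply Rmin_glb_lt; [lra|apply Rdiv_lt_0_compat; lra]. }
intros w Hw.
assert (W1 := Rlt_le_trans _ _ _ Hw (Rmin_l _ _)).
assert (W2 := Rlt_le_trans _ _ _ Hw (Rmin_r _ _)).
replace w with (z + (w - z))%C at 1 by ring.
set (h := (w - z)%C) in *; rewrite Cexp_plus.
replace (Cexp z * Cexp h - Cexp z - h * Cexp z)%C with (Cexp z * (Cexp h - 1 - h))%C by ring.
rewrite Cmod_mult; fold K.
pose proof (Cexp_affine_bound h ltac:(lra)) as B.
apply Rle_trans with (K * (6 * (Cmod h * Cmod h))).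
- apply Rmult_le_compat_l; lra.
- replace (K * (6 * (Cmod h * Cmod h))) with (Cmod h * (6 * K) * Cmod h) by ring.
  apply Rmult_le_compat_r; [apply Cmod_ge_0|].
  apply Rlt_le, Rle_div_r in W2; lra.
Qed.

Lemma entire_Cexp f : entire f -> entire (fun z => Cexp (f z)).
Proof.
intros Hf z; apply (holo_comp Cexp f); [|apply Hf].
eexists; apply is_derive_Cexp.
Qed.

(** * Weierstrass products *)

Definition cderive (f : C -> C) (z l : C) : Prop :=
  is_derive (K := C_AbsRing) (V := C_NormedModule) f z l.

Lemma cderive_mult f g z lf lg : cderive f z lf -> cderive g z lg ->
  cderive (fun w => f w * g w)%C z (lf * g z + f z * lg)%C.
Proof.
intros Df Dg; apply is_derive_C_AbsRing; apply is_derive_C_AbsRing in Df, Dg.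
exact (is_derive_mult (K := C_AbsRing) f g z lf lg Df Dg Cmult_comm).
Qed.

Lemma cderive_comp f g z lf lg : cderive f (g z) lf -> cderive g z lg ->
  cderive (fun w => f (g w)) z (lg * lf)%C.
Proof.
intros Df Dg; apply is_derive_C_AbsRing in Dg.
exact (is_derive_comp (K := C_AbsRing) (V := C_NormedModule) f g z lf lg Df Dg).
Qed.

Lemma cderive_const c z : cderive (fun _ => c) z (RtoC 0).
Proof. apply (is_derive_const (K := C_AbsRing) (V := C_NormedModule)). Qed.

Lemma cderive_id z : cderive (fun w => w) z (RtoC 1).
Proof.
apply is_derive_C_AbsRing; exact (is_derive_id (K := C_AbsRing) z).
Qed.

Lemma cderive_minus f g z lf lg : cderive f z lf -> cderive g z lg ->
  cderive (fun w => f w - g w)%C z (lf - lg)%C.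
Proof. apply (is_derive_minus (K := C_AbsRing) (V := C_NormedModule)). Qed.

Lemma cderive_Cpow n z :
  cderive (fun w => Cpow w (S n)) z (RtoC (INR (S n)) * Cpow z n)%C.
Proof.
induction n as [|n IH].
- replace (RtoC (INR 1) * Cpow z 0)%C with (1 * RtoC 1 + z * 0)%C by (simpl; ring).
  exact (cderive_mult (fun w => w) (fun _ => RtoC 1) z _ _ (cderive_id z) (cderive_const _ z)).
- replace (RtoC (INR (S (S n))) * Cpow z (S n))%C
    with (1 * Cpow z (S n) + z * (RtoC (INR (S n)) * Cpow z n))%C.
  + exact (cderive_mult (fun w => w) (fun w => Cpow w (S n)) z _ _ (cderive_id z) IH).
  + rewrite (S_INR (S n)), RtoC_plus, Cpow_S; ring.
Qed.

(** There is no mean value equality for complex values, so the real theorem is applied to t -> Re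
    (conj al * f (t u)) with al = f u - f 0, whose increment over [0, 1] is |al|^2. *)
Lemma mean_value_bound f f' u B :
  (forall t : R, 0 <= t <= 1 -> cderive f (RtoC t * u)%C (f' (RtoC t * u)%C) /\
     Cmod (f' (RtoC t * u)%C) <= B) ->
  Cmod (f u - f 0) <= B * Cmod u.
Proof.
intros H.
set (al := (f u - f 0)%C).
set (g t := Re (Cconj al * f (RtoC t * u)%C)).
set (g' t := Re (Cconj al * (u * f' (RtoC t * u)%C))).
assert (D : forall t, 0 <= t <= 1 -> is_derive g t (g' t)).
{ intros t Ht; apply is_derive_Reals; intros eps He.
  destruct (H t Ht) as [Hd _]; unfold cderive in Hd; rewrite is_cderive_iff in Hd.
  pose proof (Cmod_ge_0 al) as A0; pose proof (Cmod_ge_0 u) as U0.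
  assert (P : 0 < (1 + Cmod al) * (1 + Cmod u)) by (apply Rmult_lt_0_compat; lra).
  destruct (Hd (eps / ((1 + Cmod al) * (1 + Cmod u)))) as [d [d0 Hdd]].
  { now apply Rdiv_lt_0_compat. }
  assert (d1 : 0 < d / (1 + Cmod u)) by (apply Rdiv_lt_0_compat; lra).
  exists (mkposreal _ d1); simpl; intros h Hh Hhd.
  assert (Hh0 : 0 < Rabs h) by (now apply Rabs_pos_lt).
  assert (Ew : (RtoC (t + h) * u - RtoC t * u)%C = (RtoC h * u)%C)
    by (rewrite RtoC_plus; ring).
  specialize (Hdd (RtoC (t + h) * u)%C); rewrite Ew, Cmod_mult, Cmod_R in Hdd.
  assert (Hlt : Rabs h * Cmod u < d).
  { apply Rlt_div_r in Hhd; [|lra]; nra. }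
  specialize (Hdd Hlt).
  set (rm := (f (RtoC (t + h) * u) - f (RtoC t * u) - RtoC h * u * f' (RtoC t * u))%C) in *.
  replace ((g (t + h) - g t) / h - g' t) with (Re (Cconj al * rm) / h).
  2:{ unfold g, g', rm; destruct (Cconj al) as [a1 a2], (f (RtoC (t + h) * u)%C) as [b1 b2],
        (f (RtoC t * u)%C) as [c1 c2], (f' (RtoC t * u)%C) as [e1 e2], u as [u1 u2];
      simpl; field; auto. }
  unfold Rdiv; rewrite Rabs_mult, Rabs_inv.
  apply Rmult_lt_reg_r with (Rabs h); auto.
  rewrite Rmult_assoc, Rinv_l, Rmult_1_r by lra.
  eapply Rle_lt_trans; [apply re_le_Cmod|].
  rewrite Cmod_mult, Cmod_conj.
  apply Rle_lt_trans with
    (Cmod al * (eps / ((1 + Cmod al) * (1 + Cmod u)) * (Rabs h * Cmod u))).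
  - apply Rmult_le_compat_l; auto.
  - apply Rmult_lt_reg_r with ((1 + Cmod al) * (1 + Cmod u)); auto.
    replace (Cmod al * (eps / ((1 + Cmod al) * (1 + Cmod u)) * (Rabs h * Cmod u)) *
      ((1 + Cmod al) * (1 + Cmod u))) with (eps * Rabs h * (Cmod al * Cmod u)) by (field; lra).
    apply Rmult_lt_compat_l; [now apply Rmult_lt_0_compat|nra]. }
destruct (MVT_gen g 0 1 g') as (c & Hc & E).
- intros t; rewrite Rmin_left, Rmax_right by lra; intros; apply D; lra.
- intros t; rewrite Rmin_left, Rmax_right by lra; intros Ht.
  apply derivable_continuous_pt; exists (g' t); apply is_derive_Reals, D, Ht.
- rewrite Rmin_left, Rmax_right in Hc by lra.
  assert (Eal : g 1 - g 0 = Cmod al ^ 2).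
  { unfold g; rewrite Cmod2_alt; unfold al; rewrite Cmult_1_l, Cmult_0_l.
    destruct (f u) as [b1 b2], (f (RtoC 0)) as [c1 c2]; simpl; ring. }
  rewrite Eal in E.
  assert (Hb : g' c <= Cmod al * (Cmod u * B)).
  { eapply Rle_trans; [apply Rle_abs|]; eapply Rle_trans; [apply re_le_Cmod|].
    rewrite !Cmod_mult, Cmod_conj.
    apply Rmult_le_compat_l; [apply Cmod_ge_0|].
    apply Rmult_le_compat_l; [apply Cmod_ge_0|]; now apply H. }
  pose proof (Cmod_ge_0 al) as A0; pose proof (Cmod_ge_0 u) as U0.
  destruct (Req_dec (Cmod al) 0) as [Ez|Ez].
  + rewrite Ez; destruct (H 0) as [_ B0]; [lra|].
    pose proof (Cmod_ge_0 (f' (RtoC 0 * u)%C)); nra.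
  + apply Rmult_le_reg_l with (Cmod al); nra.
Qed.

(** The Taylor polynomial of - log (1 - u); [(1 - u) * Cexp (logpoly m u)] is the elementary factor
    of Weierstrass. *)
Fixpoint logpoly (m : nat) (u : C) : C :=
  match m with
  | O => RtoC 0
  | S k => (logpoly k u + Cpow u (S k) / RtoC (INR (S k)))%C
  end.

Lemma INR_S_neq_0 n : RtoC (INR (S n)) <> RtoC 0.
Proof. intros H; apply RtoC_inj in H; now apply (not_0_INR (S n)). Qed.

(* The derivative of a Weierstrass factor is a single monomial times an
   exponential, which makes the factor close to [1] on smaller discs. *)
Lemma cderive_weierstrass_factor m u :
  cderive (fun u => (1 - u) * Cexp (logpoly m u))%C u
    (- (Cpow u m * Cexp (logpoly m u)))%C.
Proof.
induction m as [|m IH].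
- change (cderive (fun u => (1 - u) * Cexp 0)%C u (- (Cpow u 0 * Cexp 0))%C).
  replace (- (Cpow u 0 * Cexp 0))%C with ((0 - 1) * Cexp 0 + (1 - u) * 0)%C by (simpl; ring).
  apply (cderive_mult (fun u => 1 - u)%C (fun _ => Cexp 0)); [|apply cderive_const].
  apply cderive_minus; [apply cderive_const|apply cderive_id].
- set (k := fun w => (Cpow w (S m) / RtoC (INR (S m)))%C).
  assert (Dk : cderive k u (Cpow u m)).
  { replace (Cpow u m) with (RtoC (INR (S m)) * Cpow u m * / RtoC (INR (S m)) + Cpow u (S m) * 0)%C.
    - apply (cderive_mult (fun w => Cpow w (S m)) (fun _ => / RtoC (INR (S m)))%C);
        [apply cderive_Cpow | apply cderive_const].
    - field; apply INR_S_neq_0. }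
  assert (De : cderive (fun w => Cexp (k w)) u (Cpow u m * Cexp (k u))%C).
  { apply (cderive_comp Cexp k); auto; apply is_derive_Cexp. }
  assert (X := cderive_mult _ _ _ _ _ IH De); cbv beta in X.
  change (logpoly (S m) u) with (logpoly m u + k u)%C.
  replace (- (Cpow u (S m) * Cexp (logpoly m u + k u)))%C
    with (- (Cpow u m * Cexp (logpoly m u)) * Cexp (k u) +
      (1 - u) * Cexp (logpoly m u) * (Cpow u m * Cexp (k u)))%C.
  + refine (is_derive_ext (K := C_AbsRing) (V := C_NormedModule) _ _ u _ _ X).
    assert (Ew : forall w, ((1 - w) * Cexp (logpoly m w) * Cexp (k w) =
      (1 - w) * Cexp (logpoly m w + k w))%C) by (intros w; rewrite Cexp_plus; ring).
    exact Ew.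
  + rewrite Cexp_plus, Cpow_S; ring.
Qed.

Lemma logpoly_bound m u rho : Cmod u <= rho -> rho < 1 ->
  Cmod (logpoly m u) <= (rho - rho ^ S m) / (1 - rho).
Proof.
intros Hu Hr; pose proof (Cmod_ge_0 u) as u0.
induction m as [|m IH].
- simpl; rewrite Cmod_0; right; field; lra.
- change (logpoly (S m) u) with (logpoly m u + Cpow u (S m) / RtoC (INR (S m)))%C.
  eapply Rle_trans; [apply Cmod_triangle|].
  rewrite Cmod_div, Cmod_pow, Cmod_R by apply INR_S_neq_0.
  assert (1 <= INR (S m)) by (rewrite S_INR; pose proof (pos_INR m); lra).
  rewrite Rabs_pos_eq by lra.
  assert (0 <= rho ^ S m) by (apply pow_le; lra).
  assert (Cmod u ^ S m / INR (S m) <= rho ^ S m).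
  { apply Rle_div_l; [lra|].
    assert (Cmod u ^ S m <= rho ^ S m) by (apply pow_incr; lra); nra. }
  replace ((rho - rho ^ S (S m)) / (1 - rho)) with ((rho - rho ^ S m) / (1 - rho) + rho ^ S m)
    by (change (rho ^ S (S m)) with (rho * rho ^ S m); field; lra).
  lra.
Qed.

Lemma weierstrass_factor_bound m u rho : Cmod u <= rho -> rho < 1 ->
  Cmod ((1 - u) * Cexp (logpoly m u) - 1) <= rho ^ m * exp (/ (1 - rho)).
Proof.
intros Hu Hr; pose proof (Cmod_ge_0 u) as u0.
assert (E0 : ((1 - 0) * Cexp (logpoly m 0))%C = RtoC 1).
{ assert (L0 : logpoly m 0 = RtoC 0).
  { induction m as [|m IH]; auto.
  change (logpoly (S m) 0) with (logpoly m 0 + Cpow 0 (S m) / RtoC (INR (S m)))%C.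
  rewrite IH, Cpow_S; field; apply INR_S_neq_0. }
  rewrite L0, Cexp_0; ring. }
pose proof (mean_value_bound (fun u => (1 - u) * Cexp (logpoly m u))%C
  (fun u => - (Cpow u m * Cexp (logpoly m u)))%C u (rho ^ m * exp (/ (1 - rho)))) as MV.
cbv beta in MV; rewrite E0 in MV.
eapply Rle_trans; [apply MV|].
- intros t Ht; split; [apply cderive_weierstrass_factor|].
  assert (Htu : Cmod (RtoC t * u) <= rho).
  { rewrite Cmod_mult, Cmod_R, Rabs_pos_eq by lra; nra. }
  rewrite Cmod_opp, Cmod_mult, Cmod_pow, Cmod_Cexp.
  apply Rmult_le_compat; [apply pow_le, Cmod_ge_0|left; apply exp_pos| |].
  + apply pow_incr; split; auto using Cmod_ge_0.
  + assert (Re (logpoly m (RtoC t * u)) <= / (1 - rho)).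
    { eapply Rle_trans; [apply Rle_abs|]; eapply Rle_trans; [apply re_le_Cmod|].
      eapply Rle_trans; [apply (logpoly_bound m _ rho Htu Hr)|].
      apply Rle_div_l; [lra|]; rewrite Rinv_l by lra.
      assert (0 <= rho ^ S m) by (apply pow_le; lra); lra. }
    destruct H as [H|H]; [left; now apply exp_increasing|rewrite H; lra].
- assert (0 <= rho ^ m * exp (/ (1 - rho))).
  { apply Rmult_le_pos; [apply pow_le; lra|left; apply exp_pos]. }
  nra.
Qed.

Lemma entire_logpoly m f : entire f -> entire (fun z => logpoly m (f z)).
Proof.
intros Hf; induction m as [|m IH]; [exact (entire_const (RtoC 0))|].
apply (entire_plus (fun z => logpoly m (f z)) (fun z => Cpow (f z) (S m) / RtoC (INR (S m)))%C); auto.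
apply (entire_mult (fun z => Cpow (f z) (S m)) (fun _ => / RtoC (INR (S m)))%C).
- now apply entire_Cpow.
- apply entire_const.
Qed.

Lemma weierstrass_single n w eps : 0 < eps -> INR n <= Cmod w ->
  exists c, entire c /\ (forall z, c z <> RtoC 0) /\
    forall z, Cmod z <= INR n - 1 -> Cmod ((z - w) * c z - 1) <= eps.
Proof.
intros He Hw; destruct n as [|n].
- exists (fun _ => RtoC 1); split; [apply entire_const|split].
  + intros _; apply C1_nz.
  + intros z Hz; pose proof (Cmod_ge_0 z); simpl in Hz; lra.
- rewrite S_INR in *; pose proof (pos_INR n) as n0.
  set (rho := INR n / (INR n + 1)).
  assert (r0 : 0 <= rho) by (apply Rle_div_r; lra).
  assert (r1 : rho < 1) by (apply Rlt_div_l; lra).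
  assert (w0 : w <> RtoC 0) by (intros ->; rewrite Cmod_0 in Hw; lra).
  destruct (pow_lt_1_zero rho ltac:(rewrite Rabs_pos_eq; lra) (eps / exp (/ (1 - rho))))
    as [m Hm]; [apply Rdiv_lt_0_compat; auto; apply exp_pos|].
  specialize (Hm m (Nat.le_refl m)).
  rewrite Rabs_pos_eq in Hm by (now apply pow_le).
  exists (fun z => - / w * Cexp (logpoly m (z / w)))%C; split; [|split].
  + apply (entire_mult (fun _ => - / w)%C (fun z => Cexp (logpoly m (z / w)))); [apply entire_const|].
    apply entire_Cexp, entire_logpoly.
    apply (entire_mult (fun z => z) (fun _ => / w)%C); [apply entire_id | apply entire_const].
  + intros z; apply Cmult_neq_0; [|apply Cexp_neq_0].
    intros E; apply C1_nz; replace (RtoC 1) with (- w * - / w)%C by (field; auto).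
    rewrite E; ring.
  + intros z Hz.
    replace ((z - w) * (- / w * Cexp (logpoly m (z / w))))%C
      with ((1 - z / w) * Cexp (logpoly m (z / w)))%C by (field; auto).
    eapply Rle_trans; [apply (weierstrass_factor_bound m _ rho); auto|].
    * rewrite Cmod_div by auto; unfold rho; apply Rmult_le_compat; try lra; auto using Cmod_ge_0.
      -- left; apply Rinv_0_lt_compat; lra.
      -- apply Rinv_le_contravar; lra.
    * left; apply Rlt_div_r; auto; apply exp_pos.
Qed.

Lemma weierstrass_shell n L eps : 0 < eps -> (forall w, In w L -> INR n <= Cmod w) ->
  exists c, entire c /\ (forall z, c z <> RtoC 0) /\
    forall z, Cmod z <= INR n - 1 -> Cmod (rootprod L z * c z - 1) <= eps.
Proof.
revert eps; induction L as [|w L IH]; intros eps He HL.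
- exists (fun _ => RtoC 1); split; [apply entire_const|split].
  + intros _; apply C1_nz.
  + intros z _; simpl; replace (1 * 1 - 1)%C with (RtoC 0) by ring; rewrite Cmod_0; lra.
(* With both factors within e <= 1 of 1, the product is within e^2 + 2 e <= 3 e of 1. *)
- set (e := Rmin 1 (eps / 3)).
  assert (e0 : 0 < e) by (apply Rmin_glb_lt; lra).
  assert (e1 : e <= 1) by apply Rmin_l.
  assert (e2 : e <= eps / 3) by apply Rmin_r.
  destruct (IH e e0 (fun u Hu => HL u (or_intror Hu))) as (c1 & C11 & C12 & C13).
  destruct (weierstrass_single n w e e0 (HL w (or_introl eq_refl))) as (c2 & C21 & C22 & C23).
  exists (fun z => c2 z * c1 z)%C; split; [now apply entire_mult|split].
  + intros z; now apply Cmult_neq_0.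
  + intros z Hz; specialize (C13 z Hz); specialize (C23 z Hz); simpl.
    set (a := (rootprod L z * c1 z - 1)%C) in *; set (b := ((z - w) * c2 z - 1)%C) in *.
    replace ((z - w) * rootprod L z * (c2 z * c1 z) - 1)%C with (a * b + a + b)%C
      by (unfold a, b; ring).
    eapply Rle_trans; [apply Cmod_triangle|].
    eapply Rle_trans; [apply Rplus_le_compat_r, Cmod_triangle|].
    rewrite Cmod_mult.
    pose proof (Cmod_ge_0 a); pose proof (Cmod_ge_0 b).
    assert (Cmod a * Cmod b <= e * 1) by (apply Rmult_le_compat; lra).
    lra.
Qed.

(** Each batch product, corrected by a zero-free factor [c n], is within 2^-n / 8 of 1 on the disc
    of radius n - 1. The infinite product therefore converges, and its part beyond stage [n] stays
    away from 0 on that disc. The cofactor [U] is that part times the zero-free corrections of the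
    earlier batches. *)
Theorem weierstrass_product L : shells L ->
  exists s, entire s /\ forall n, exists U, entire U /\
    (forall z, s z = (rootprod (prefix L n) z * U z)%C) /\
    forall z, Cmod z <= INR n - 1 -> U z <> RtoC 0.
Proof.
intros HL.
destruct (functional_choice_nat (fun n c => entire c /\ (forall z, c z <> RtoC 0) /\
    forall z, Cmod z <= INR n - 1 -> Cmod (rootprod (L n) z * c z - 1) <= 1 / 8 * (1 / 2) ^ n))
  as [c Hc].
{ intros n; apply weierstrass_shell; [pose proof (pow_half_pos n); lra | apply HL]. }
set (E n z := (rootprod (L n) z * c n z)%C).
set (T n := fix T k z := match k with O => RtoC 1 | S k => (T k z * E (n + k)%nat z)%C end).
assert (EE : forall n, entire (E n)).
{ intros n; apply entire_mult; [apply rootprod_entire|apply Hc]. }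
assert (ET : forall n k, entire (T n k)).
{ intros n k; induction k as [|k IH]; [exact (entire_const (RtoC 1))|].
  exact (entire_mult (T n k) (E (n + k)%nat) IH (EE _)). }
assert (HE : forall n z, Cmod z <= INR n - 1 -> Cmod (E n z - 1) <= 1 / 8 * (1 / 2) ^ n).
{ intros n; apply Hc. }
(* The factor 2 - 2^-j stands for a uniform bound 2 in a form that is inductive: (2 - x)(1 + x/8) <=
   2 - x/2 for x = 2^-j. *)
assert (Grow : forall n K j z, Cmod z <= INR (n + K) - 1 ->
  Cmod (T n (K + j)%nat z) <= Cmod (T n K z) * (2 - (1 / 2) ^ j)).
{ intros n K j z Hz; induction j as [|j IH].
  - rewrite Nat.add_0_r; simpl; lra.
  - rewrite Nat.add_succ_r; simpl T; rewrite Cmod_mult.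
    assert (HI : INR (n + K) <= INR (n + (K + j))) by (apply le_INR; lia).
    pose proof (HE (n + (K + j))%nat z ltac:(lra)) as B.
    pose proof (Cmod_triangle3 (E (n + (K + j))%nat z) 1) as T3; rewrite Cmod_1 in T3.
    pose proof (pow_half_le j (n + (K + j)) ltac:(lia)).
    pose proof (pow_half_pos j).
    assert (x1 : (1 / 2) ^ j <= 1) by (apply (pow_half_le 0 j); lia).
    change ((1 / 2) ^ S j) with (1 / 2 * (1 / 2) ^ j).
    pose proof (Cmod_ge_0 (T n K z)).
    apply Rle_trans with (Cmod (T n K z) * (2 - (1 / 2) ^ j) * (1 + 1 / 8 * (1 / 2) ^ j)).
    + apply Rmult_le_compat; auto using Cmod_ge_0; lra.
    + rewrite Rmult_assoc; apply Rmult_le_compat_l; auto; nra. }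
assert (Lim : forall n, exists g, entire g /\ forall z eps, 0 < eps ->
  exists N, forall m, (N <= m)%nat -> Cmod (g z - T n m z) <= eps).
{ intros n; apply entire_geometric_limit; auto.
  intros r; destruct (INR_unbounded (r + 1)) as [K HK].
  destruct (entire_bounded (T n K) r (ET n K)) as [B [B0 HB]].
  exists (2 * B), K; intros m Hm z Hz.
  assert (HI : INR K <= INR (n + K)) by (apply le_INR; lia).
  assert (HI' : INR K <= INR (n + m)) by (apply le_INR; lia).
  pose proof (Grow n K (m - K)%nat z ltac:(lra)) as G.
  replace (K + (m - K))%nat with m in G by lia.
  pose proof (HE (n + m)%nat z ltac:(lra)) as HE'.
  simpl T.
  replace (T n m z * E (n + m)%nat z - T n m z)%C with (T n m z * (E (n + m)%nat z - 1))%C by ring.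
  rewrite Cmod_mult; specialize (HB z Hz).
  pose proof (pow_half_pos (m - K)); pose proof (pow_half_le m (n + m) ltac:(lia)).
  pose proof (pow_half_pos m); pose proof (Cmod_ge_0 (T n K z)).
  apply Rmult_le_compat; auto using Cmod_ge_0; [nra|lra]. }
(* A step changes the product by at most 2 times 2^-k / 8, which is exactly the growth of the
   right-hand side. Staying within 1/2 of 1 keeps the limit from vanishing. *)
assert (Near1 : forall n k z, Cmod z <= INR n - 1 ->
  Cmod (T n k z - 1) <= 1 / 2 * (1 - (1 / 2) ^ k)).
{ intros n k z Hz; induction k as [|k IH].
  - simpl; replace (1 - 1)%C with (RtoC 0) by ring; rewrite Cmod_0; lra.
  - simpl T.
    replace (T n k z * E (n + k)%nat z - 1)%C
      with (T n k z * (E (n + k)%nat z - 1) + (T n k z - 1))%C by ring.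
    eapply Rle_trans; [apply Cmod_triangle|]; rewrite Cmod_mult.
    assert (HI : INR n <= INR (n + k)) by (apply le_INR; lia).
    pose proof (HE (n + k)%nat z ltac:(lra)) as B.
    pose proof (Grow n O k z) as G; rewrite Nat.add_0_r in G; specialize (G Hz).
    simpl in G; rewrite Cmod_1 in G.
    pose proof (pow_half_le k (n + k) ltac:(lia)); pose proof (pow_half_pos k).
    assert (Cmod (T n k z) * Cmod (E (n + k)%nat z - 1) <= 2 * (1 / 8 * (1 / 2) ^ k)).
    { apply Rmult_le_compat; auto using Cmod_ge_0; lra. }
    change ((1 / 2) ^ S k) with (1 / 2 * (1 / 2) ^ k); lra. }
destruct (Lim O) as (s & Hs & Cs).
exists s; split; auto.
intros n; destruct (Lim n) as (g & Hg & Cg).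
set (Pc := fix Pc k z := match k with O => RtoC 1 | S k => (Pc k z * c k z)%C end).
assert (HPc : forall k, entire (Pc k) /\ forall z, Pc k z <> RtoC 0).
{ intros k; induction k as [|k [I1 I2]]; simpl.
  - split; [exact (entire_const (RtoC 1))|intros _; apply C1_nz].
  - split; [exact (entire_mult (Pc k) (c k) I1 (proj1 (Hc k)))|].
    intros z; apply Cmult_neq_0; auto; apply Hc. }
assert (HT0 : forall k z, T O k z = (rootprod (prefix L k) z * Pc k z)%C).
{ intros k z; induction k as [|k IH]; simpl; [ring|].
  simpl in IH; rewrite IH, rootprod_app; unfold E; ring. }
assert (HTs : forall k z, T O (n + k)%nat z = (T O n z * T n k z)%C).
{ intros k z; induction k as [|k IH]; [rewrite Nat.add_0_r; simpl; ring|].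
  rewrite Nat.add_succ_r; simpl T; simpl in IH; rewrite IH; ring. }
exists (fun z => Pc n z * g z)%C; split; [apply entire_mult; auto; apply HPc|split].
- intros z; rewrite Cmult_assoc, <- HT0, <- (Cplus_0_l (T O n z * g z)).
  apply (limit_transfer (fun m => T O m z) (fun m => T n m z) _ _ _ _ n); auto.
  intros m; rewrite HTs; ring.
- intros z Hz; apply Cmult_neq_0; [apply HPc|]; intros E0.
  destruct (Cg z (1 / 4)) as [N HN]; [lra|].
  specialize (HN N (Nat.le_refl N)); specialize (Near1 n N z Hz).
  rewrite E0 in HN.
  pose proof (Cmod_triangle (0 - T n N z) (T n N z - 1)) as T3.
  replace (0 - T n N z + (T n N z - 1))%C with (- (1))%C in T3 by ring.
  rewrite Cmod_m1 in T3; pose proof (pow_half_pos N); lra.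
Qed.

(** A Weierstrass product over the zeros of [q], each listed once. *)
Theorem entire_radical q : entire q -> (exists z, q z <> RtoC 0) ->
  exists s, entire s /\ (forall z, q z = RtoC 0 <-> s z = RtoC 0) /\
    forall w, ~ edivides (fun z => (z - w) * (z - w))%C s.
Proof.
intros Hq Hnz.
destruct (zero_shells q Hq Hnz) as (L & H & HL & HH & Eq & Hnv).
(* A zero may recur within a batch, which [nodup] repairs, and across batches, which [fresh]
   repairs. *)
set (fresh n w := if in_dec Ceq_dec w (prefix L n) then false else true).
set (L' n := filter (fresh n) (nodup Ceq_dec (L n))).
assert (InL : forall n w, In w (prefix L' n) <-> In w (prefix L n)).
{ induction n as [|n IH]; intros w; simpl; [tauto|].
  rewrite !in_app_iff, IH; unfold L'; rewrite filter_In, nodup_In; unfold fresh.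
  destruct (in_dec Ceq_dec w (prefix L n)) as [|]; split; intros [|]; tauto. }
assert (ND : forall n, NoDup (prefix L' n)).
{ induction n as [|n IH]; simpl; [constructor|].
  apply NoDup_app; auto; [apply NoDup_filter, NoDup_nodup|].
  intros w Hw Hw'; apply InL in Hw; unfold L' in Hw'.
  apply filter_In in Hw'; destruct Hw' as [_ Hf]; unfold fresh in Hf.
  destruct (in_dec Ceq_dec w (prefix L n)); [discriminate|contradiction]. }
destruct (weierstrass_product L') as (s & Hs & HU).
{ intros n w Hw; apply HL; unfold L' in Hw.
  apply filter_In in Hw; destruct Hw as [Hw _]; now apply nodup_In in Hw. }
exists s; split; auto.
assert (Big : forall z, exists n, Cmod z + 1 < INR n) by (intros; apply INR_unbounded).
split.
- intros z; destruct (Big z) as [n Hn]; destruct (HU n) as (U & _ & EU & NU).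
  rewrite (Eq n), EU; split; intros E.
  + assert (Hin : In z (prefix L n)).
    { apply NNPP; intros Hni; revert E; apply Cmult_neq_0; [now apply rootprod_neq_0|].
      apply Hnv; lra. }
    rewrite rootprod_root by (now apply InL); ring.
  + assert (Hin : In z (prefix L' n)).
    { apply NNPP; intros Hni; revert E; apply Cmult_neq_0; [now apply rootprod_neq_0|].
      apply NU; lra. }
    rewrite rootprod_root by (now apply InL); ring.
- intros w (h & Hh & E).
  destruct (Big w) as [n Hn]; destruct (HU n) as (U & EUn & EU & NU).
  assert (Hin : In w (prefix L' n)).
  { apply NNPP; intros Hni.
    assert (E0 : s w = RtoC 0) by (rewrite E; ring).
    revert E0; rewrite EU; apply Cmult_neq_0; [now apply rootprod_neq_0|apply NU; lra]. }
  apply in_split in Hin; destruct Hin as (l1 & l2 & El).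
  specialize (ND n); rewrite El in ND; apply NoDup_remove_2 in ND.
  (* One factor z - w is cancelled from the two factorizations of [s]; at [w] the left side then
     vanishes, while the right side does not since [w] is listed once. *)
  assert (E' : ((w - w) * h w)%C = (rootprod (l1 ++ l2) w * U w)%C).
  { apply (entire_cancel_root w (fun z => (z - w) * h z)%C (fun z => rootprod (l1 ++ l2) z * U z)%C).
    - apply entire_mult; auto; apply entire_sub_const.
    - apply entire_mult; auto; apply rootprod_entire.
    - intros z; rewrite Cmult_assoc, <- E, EU, El, !rootprod_app; simpl; ring. }
  assert (N : (rootprod (l1 ++ l2) w * U w)%C <> RtoC 0).
  { apply Cmult_neq_0; [now apply rootprod_neq_0|apply NU; lra]. }
  apply N; rewrite <- E'; ring.
Qed.

(** * Squarefree elements *)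

Definition squarefree_int (k : Z) : Prop := forall d : Z, (d * d | k)%Z -> (d | 1)%Z.

Lemma squarefree_int_neq_0 k : squarefree_int k -> k <> 0%Z.
Proof.
intros H ->; specialize (H 2%Z (Z.divide_0_r _)).
apply Z.divide_1_r in H; lia.
Qed.

(** With D = gcd(F, G) and F = F' D, a common divisor d of F' and G also divides D, so d^2 divides F
    and d is a unit. Hence G is invertible modulo F', while D divides the outer factor G. *)
Lemma squarefree_int_regular F G : squarefree_int F ->
  exists V, (F | G * (G * V - 1))%Z.
Proof.
intros HF; pose proof (squarefree_int_neq_0 F HF) as F0.
destruct (Z.gcd_divide_l F G) as [F' EF], (Z.gcd_divide_r F G) as [g EG].
set (D := Z.gcd F G) in *.
assert (R : rel_prime G F').
{ apply Zgcd_1_rel_prime.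
  pose proof (Z.gcd_divide_l G F') as d1; pose proof (Z.gcd_divide_r G F') as d2.
  pose proof (Z.gcd_nonneg G F') as N.
  set (d := Z.gcd G F') in *.
  assert (dD : (d | D)%Z).
  { apply Z.gcd_greatest; auto; rewrite EF; now apply Z.divide_mul_l. }
  assert (X : (d | 1)%Z).
  { apply HF; apply Z.divide_trans with (F' * d)%Z; [now apply Z.mul_divide_mono_r|].
    rewrite EF; now apply Z.mul_divide_mono_l. }
  apply Z.divide_1_r in X; lia. }
apply rel_prime_bezout in R; destruct R as [u v E].
exists u, (- (g * v))%Z.
rewrite EF; replace (G * (G * u - 1))%Z with (- (G * (v * F')))%Z
  by (replace (v * F')%Z with (1 - u * G)%Z by lia; ring).
rewrite EG; ring.
Qed.

(** If k = e d^2 with d not a unit, then d e is smaller in absolute value and k divides (d e)^2; the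
    exponent [j] doubles at each such reduction. *)
Lemma radical_int k : k <> 0%Z ->
  exists r (j : nat), squarefree_int r /\ (k | r ^ Z.of_nat j)%Z.
Proof.
remember (Z.abs_nat k) as m eqn:Em; revert k Em.
induction m as [m IH] using (well_founded_induction lt_wf); intros k -> Hk.
destruct (classic (squarefree_int k)) as [Hs|Hs].
- exists k, 1%nat; split; auto; exists 1%Z; rewrite Z.pow_1_r; ring.
- apply not_all_ex_not in Hs; destruct Hs as [d Hd].
  apply imply_to_and in Hd; destruct Hd as [[e He] Hd].
  assert (d0 : d <> 0%Z) by (intros ->; lia).
  assert (d1 : d <> 1%Z) by (intros ->; apply Hd, Z.divide_refl).
  assert (d2 : d <> (-1)%Z) by (intros ->; apply Hd; exists (-1)%Z; ring).
  assert (e0 : e <> 0%Z) by (intros ->; lia).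
  assert (Hlt : (Z.abs_nat (d * e) < Z.abs_nat k)%nat).
  { assert (Z.abs (d * e) < Z.abs k)%Z; [|lia].
    rewrite He, !Z.abs_mul; nia. }
  destruct (IH _ Hlt (d * e)%Z eq_refl) as (r & j & Hr & Hj); [nia|].
  exists r, (j + j)%nat; split; auto.
  rewrite Nat2Z.inj_add, Z.pow_add_r by lia.
  apply Z.divide_trans with ((d * e) * (d * e))%Z.
  + exists e; subst k; ring.
  + apply Z.divide_trans with (d * e * r ^ Z.of_nat j)%Z.
    * now apply Z.mul_divide_mono_l.
    * now apply Z.mul_divide_mono_r.
Qed.

(** [V] is the geometric sum of the powers of a r below the j-th: modulo [k] the element a r is
    nilpotent. *)
Lemma unipotent_inverse_mod k r (j : nat) a : (k | r ^ Z.of_nat j)%Z ->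
  exists V, (k | (1 - a * r) * V - 1)%Z.
Proof.
intros H.
assert (G : exists V, ((1 - a * r) * V - 1)%Z = (- (a * r) ^ Z.of_nat j)%Z).
{ clear H; induction j as [|j [V E]].
  - exists 0%Z; simpl; ring.
  - exists (1 + a * r * V)%Z; rewrite Nat2Z.inj_succ, Z.pow_succ_r by lia.
    replace (- (a * r * (a * r) ^ Z.of_nat j))%Z with (a * r * - (a * r) ^ Z.of_nat j)%Z by ring.
    rewrite <- E; ring. }
destruct G as [V E]; exists V; rewrite E, Z.pow_mul_l.
apply Z.divide_opp_r; now apply Z.divide_mul_r.
Qed.

Lemma prime_divisor_exists k : ~ (k | 1)%Z -> exists p, prime p /\ (p | k)%Z.
Proof.
remember (Z.abs_nat k) as m eqn:Em; revert k Em.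
induction m as [m IH] using (well_founded_induction lt_wf); intros k -> Hk.
destruct (Z.eq_dec k 0) as [->|k0].
{ exists 2%Z; split; [apply prime_2|apply Z.divide_0_r]. }
assert (k1 : (1 < Z.abs k)%Z).
{ assert (Z.abs k <> 1%Z); [|lia]; intros E; apply Hk.
  apply Z.divide_abs_l; rewrite E; apply Z.divide_refl. }
destruct (prime_dec (Z.abs k)) as [Hp|Hp].
- exists (Z.abs k); split; auto; apply Z.divide_abs_l, Z.divide_refl.
- destruct (not_prime_divide (Z.abs k) k1 Hp) as (d & Hd & Hdk).
  assert (Hlt : (Z.abs_nat d < Z.abs_nat k)%nat) by lia.
  destruct (IH _ Hlt d eq_refl) as (p & Pp & Dp).
  + intros H1; apply Z.divide_1_r in H1; lia.
  + exists p; split; auto; apply Z.divide_trans with d; auto.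
    now apply Z.divide_abs_r.
Qed.

(** * Integer values, divisibility, units and irreducible elements *)

Definition ival (f : ivef) (n : Z) : Z :=
  proj1_sig (constructive_indefinite_description _ (ivef_int f n)).

Lemma ival_spec (f : ivef) n : f (RtoC (IZR n)) = RtoC (IZR (ival f n)).
Proof. unfold ival; apply proj2_sig. Qed.

Lemma ival_unique (f : ivef) n k : f (RtoC (IZR n)) = RtoC (IZR k) -> ival f n = k.
Proof. rewrite ival_spec; intros H; now apply eq_IZR, RtoC_inj. Qed.

Lemma ival_mult (f g : ivef) n : ival (mult f g) n = (ival f n * ival g n)%Z.
Proof. apply ival_unique; simpl; now rewrite !ival_spec, mult_IZR, RtoC_mult. Qed.

Lemma ival_plus (f g : ivef) n : ival (plus f g) n = (ival f n + ival g n)%Z.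
Proof. apply ival_unique; simpl; now rewrite !ival_spec, plus_IZR, RtoC_plus. Qed.

Lemma ival_opp (f : ivef) n : ival (opp f) n = (- ival f n)%Z.
Proof. apply ival_unique; simpl; now rewrite !ival_spec, opp_IZR, RtoC_opp. Qed.

Lemma ival_const k n : ival (ivef_const k) n = k.
Proof. now apply ival_unique. Qed.

Lemma ival_zero n : ival zero n = 0%Z.
Proof. apply (ival_const 0). Qed.

Lemma ival_one n : ival one n = 1%Z.
Proof. apply (ival_const 1). Qed.

Lemma ival_eq_0 (f : ivef) n : ival f n = 0%Z <-> f (RtoC (IZR n)) = RtoC 0.
Proof. split; intros H; [now rewrite ival_spec, H | now apply ival_unique]. Qed.

(** Since [g] does not vanish at the integers, the value of the analytic quotient there is the
    quotient of the values, an integer. *)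
Lemma divides_intro (g f : ivef) : edivides g f ->
  (forall n, ival g n <> 0%Z /\ (ival g n | ival f n)%Z) -> divides g f.
Proof.
intros (h & Hh & E) Hv.
assert (Hi : integer_valued h).
{ intros n; destruct (Hv n) as [g0 [k Hk]]; exists k.
  specialize (E (RtoC (IZR n))); rewrite !ival_spec, Hk, mult_IZR, RtoC_mult in E.
  assert (N : RtoC (IZR (ival g n)) <> RtoC 0).
  { intros E0; apply g0; now apply eq_IZR, RtoC_inj. }
  replace (h (RtoC (IZR n)))
    with (/ RtoC (IZR (ival g n)) * (RtoC (IZR (ival g n)) * h (RtoC (IZR n))))%C by (field; auto).
  rewrite <- E; field; auto. }
exists (Ivef h Hh Hi); apply ivef_ext, E.
Qed.

Lemma is_unit_iff (f : ivef) :
  is_unit f <-> (forall z, f z <> RtoC 0) /\ forall n, (ival f n | 1)%Z.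
Proof.
split.
- intros [c E]; split.
  + intros z Hz; apply C1_nz.
    change (RtoC 1) with ((one : ivef) z); rewrite E; simpl; rewrite Hz; ring.
  + intros n; exists (ival c n).
    rewrite Z.mul_comm, <- ival_mult, <- E; symmetry; apply ival_const.
- intros [Hz Hn]; apply divides_intro.
  + exists (fun z => / f z)%C; split.
    * intros z; apply holo_inv; [apply ivef_entire|auto].
    * intros z; simpl; field; auto.
  + intros n; split.
    * intros E; apply (Hz (RtoC (IZR n))); now apply ival_eq_0.
    * rewrite ival_one; auto.
Qed.

(** Multiply [s] by exp g, where g interpolates logarithms of a(n)/s(n) at the integers. *)
Lemma prescribed_values (s : C -> C) (a : Z -> Z) : entire s ->
  (forall n : Z, s (RtoC (IZR n)) <> RtoC 0) -> (forall n, a n <> 0%Z) ->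
  exists (f : ivef) (c : C -> C), entire c /\ (forall z, c z <> RtoC 0) /\
    (forall z, f z = (s z * c z)%C) /\ forall n, ival f n = a n.
Proof.
intros Hs Hsn Ha.
assert (Hlog : forall n : Z, exists l, Cexp l = (RtoC (IZR (a n)) / s (RtoC (IZR n)))%C).
{ intros n; apply Cexp_surjective; intros E; apply (Ha n), eq_IZR, RtoC_inj.
  replace (RtoC (IZR (a n))) with (RtoC (IZR (a n)) / s (RtoC (IZR n)) * s (RtoC (IZR n)))%C
    by (field; auto).
  rewrite E; ring. }
destruct (integer_interpolation (fun n => proj1_sig (constructive_indefinite_description _ (Hlog n))))
  as (g & Hg & Eg).
assert (Ef : forall n : Z, (s (RtoC (IZR n)) * Cexp (g (RtoC (IZR n))))%C = RtoC (IZR (a n))).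
{ intros n; rewrite Eg; destruct (constructive_indefinite_description _ _) as [l Hl]; simpl.
  rewrite Hl; field; auto. }
assert (He : entire (fun z => s z * Cexp (g z))%C).
{ apply entire_mult; auto; now apply entire_Cexp. }
exists (Ivef _ He (fun n => ex_intro _ (a n) (Ef n))), (fun z => Cexp (g z)).
split; [now apply entire_Cexp|split; [intros; apply Cexp_neq_0|split; [reflexivity|]]].
intros n; apply ival_unique, Ef.
Qed.

(** Factors of a zero-free function are zero-free, so being a unit is decided by the values. Off [n]
    these are units for both factors, and at [n] primality of [p] makes one of them a unit. *)
Lemma irreducible_at_integer n p : prime p ->
  exists d : ivef, irreducible d /\ (forall z, d z <> RtoC 0) /\
    ival d n = p /\ forall m, m <> n -> ival d m = 1%Z.
Proof.
intros Hp; pose proof (prime_ge_2 p Hp) as p2.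
destruct (prescribed_values (fun _ => RtoC 1) (fun m => if Z.eq_dec m n then p else 1%Z))
  as (d & c & Hc & Hcz & E & Ev).
{ apply entire_const. }
{ intros _; apply C1_nz. }
{ intros m; destruct (Z.eq_dec m n); lia. }
assert (Hd : forall z, d z <> RtoC 0).
{ intros z; rewrite E; apply Cmult_neq_0; auto; apply C1_nz. }
assert (En : ival d n = p) by (rewrite Ev; destruct (Z.eq_dec n n); congruence).
assert (Em : forall m, m <> n -> ival d m = 1%Z).
{ intros m Hm; rewrite Ev; destruct (Z.eq_dec m n); congruence. }
exists d; split; [|auto].
split; [|split].
- intros E0; apply (Hd (RtoC 0)); now rewrite E0.
- rewrite is_unit_iff; intros [_ H]; specialize (H n); rewrite En in H.
  apply Z.divide_1_r in H; lia.
- intros b e Ebe.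
  assert (Hval : forall m, ival d m = (ival b m * ival e m)%Z) by (intros; rewrite Ebe; apply ival_mult).
  assert (Hb : forall z, b z <> RtoC 0).
  { intros z Hz; apply (Hd z); rewrite Ebe; simpl; rewrite Hz; ring. }
  assert (He : forall z, e z <> RtoC 0).
  { intros z Hz; apply (Hd z); rewrite Ebe; simpl; rewrite Hz; ring. }
  rewrite !is_unit_iff.
  pose proof (Hval n) as Vn; rewrite En in Vn.
  assert (Hoff : forall m, m <> n -> (ival b m | 1)%Z /\ (ival e m | 1)%Z).
  { intros m Hm; pose proof (Hval m) as Vm; rewrite Em in Vm by auto; split.
    - exists (ival e m); lia.
    - exists (ival b m); lia. }
  assert (Hcase : (ival b n | 1)%Z \/ (ival e n | 1)%Z).
  { destruct (prime_divisors p Hp (ival b n)) as [H|[H|[H|H]]].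
    - exists (ival e n); lia.
    - left; rewrite H; exists (-1)%Z; ring.
    - left; rewrite H; apply Z.divide_refl.
    - right; exists 1%Z; rewrite H in Vn; nia.
    - right; exists (-1)%Z; rewrite H in Vn; nia. }
  destruct Hcase as [H|H]; [left|right]; split; auto; intros m;
    (destruct (Z.eq_dec m n) as [->|Hm]; [exact H | now apply Hoff]).
Qed.

(** The only zero is simple, so it belongs to one factor of a factorization; the other is then
    zero-free, with values 1 or -1 at the integers. *)
Lemma irreducible_at_point w : (forall n : Z, w <> RtoC (IZR n)) ->
  exists (d : ivef) c, irreducible d /\ entire c /\ (forall z, c z <> RtoC 0) /\
    (forall z, d z = ((z - w) * c z)%C) /\ forall n, ival d n = 1%Z.
Proof.
intros Hw.
destruct (prescribed_values (fun z => z - w)%C (fun _ => 1%Z))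
  as (d & c & Hc & Hcz & E & Ev).
{ apply entire_sub_const. }
{ intros n; apply Cminus_eq_contra; auto. }
{ intros; lia. }
exists d, c; split; [|auto].
assert (Hsym : forall b e : ivef, d = mult b e -> b w = RtoC 0 -> is_unit e).
{ intros b e Ebe Hb.
  destruct (entire_factor b w (ivef_entire b) Hb) as (h & Hh & Eh).
  assert (Ec : forall z, (h z * e z)%C = c z).
  { apply (entire_cancel_root w); auto; [apply entire_mult; auto; apply ivef_entire|].
    intros z; rewrite <- E, Ebe; simpl; rewrite Eh; ring. }
  apply is_unit_iff; split.
  - intros z Hz; apply (Hcz z); rewrite <- Ec, Hz; ring.
  - intros n; exists (ival b n); rewrite <- ival_mult, <- Ebe; symmetry; apply Ev. }
split; [|split].
- intros E0; specialize (Ev 0%Z); rewrite E0, ival_zero in Ev; lia.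
- rewrite is_unit_iff; intros [H _]; apply (H w); rewrite E; ring.
- intros b e Ebe.
  assert (E0 : (b w * e w)%C = RtoC 0).
  { transitivity (d w); [rewrite Ebe; reflexivity | rewrite E; ring]. }
  destruct (classic (b w = RtoC 0)) as [Hb|Hb].
  + right; now apply (Hsym b).
  + left; apply (Hsym e); [now rewrite ivef_mult_comm|].
    destruct (classic (e w = RtoC 0)) as [|He]; auto; exfalso; now apply (Cmult_neq_0 (b w) (e w)).
Qed.

Definition squarefree (f : ivef) : Prop :=
  (forall n, squarefree_int (ival f n)) /\
  forall w, ~ edivides (fun z => (z - w) * (z - w))%C f.

Lemma pow_n_2 (d : ivef) : pow_n d 2 = mult d d.
Proof. simpl; now rewrite mult_one_r. Qed.

Lemma squarefree_of_irreducible (f : ivef) :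
  (forall d, irreducible d -> ~ divides (mult d d) f) -> squarefree f.
Proof.
intros H.
assert (Hn : forall n, squarefree_int (ival f n)).
{ intros n d0 Hd0; apply NNPP; intros H1.
  destruct (prime_divisor_exists d0 H1) as (p & Hp & Hpd).
  destruct (irreducible_at_integer n p Hp) as (d & Hd & Hdz & Ed & Ed').
  pose proof (prime_ge_2 p Hp).
  apply (H d Hd), divides_intro.
  - exists (fun z => f z / (d z * d z))%C; split.
    + intros z; apply holo_div; [apply ivef_entire| |now apply Cmult_neq_0].
      apply holo_mult; apply ivef_entire.
    + intros z; simpl; field; auto.
  - intros m; rewrite ival_mult; destruct (Z.eq_dec m n) as [->|Hm].
    + rewrite Ed; split; [lia|].
      apply Z.divide_trans with (d0 * d0)%Z; auto.
      apply Z.divide_trans with (p * d0)%Z; [now apply Z.mul_divide_mono_l | now apply Z.mul_divide_mono_r].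
    + rewrite Ed' by auto; split; [lia|apply Z.divide_1_l]. }
split; auto.
intros w (h & Hh & E).
(* Squarefree values are nonzero, so a multiple zero lies off the integers, where an irreducible
   element with a zero at [w] exists. *)
assert (Hw : forall n : Z, w <> RtoC (IZR n)).
{ intros n ->; apply (squarefree_int_neq_0 _ (Hn n)), ival_eq_0; rewrite E; ring. }
destruct (irreducible_at_point w Hw) as (d & c & Hd & Hc & Hcz & Ed & Ev).
apply (H d Hd), divides_intro.
- exists (fun z => h z / (c z * c z))%C; split.
  + intros z; apply holo_div; [apply Hh| |now apply Cmult_neq_0].
    apply holo_mult; apply Hc.
  + intros z; simpl; rewrite Ed, E; field; auto.
- intros n; rewrite ival_mult, Ev; split; [lia|apply Z.divide_1_l].
Qed.

Lemma squarefree_irreducible (f d : ivef) : squarefree f -> irreducible d ->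
  ~ divides (mult d d) f.
Proof.
intros [Hn Hw] (_ & Hu & _) [e E]; apply Hu, is_unit_iff; split.
- intros w Hdw; apply (Hw w).
  destruct (entire_factor d w (ivef_entire d) Hdw) as (h & Hh & Eh).
  exists (fun z => h z * h z * e z)%C; split.
  + apply (entire_mult (fun z => h z * h z)%C e); [now apply entire_mult | apply ivef_entire].
  + intros z; rewrite E; simpl; rewrite Eh; ring.
- intros n; apply (Hn n); exists (ival e n).
  rewrite E, !ival_mult; ring.
Qed.

Lemma squarefree_irreducible_divisor (f : ivef) : squarefree f -> ~ is_unit f ->
  exists d, irreducible_divisor f d.
Proof.
intros [Hn _] Hu.
destruct (classic (exists w, f w = RtoC 0)) as [[w Hfw]|Hz].
- assert (Hw : forall n : Z, w <> RtoC (IZR n)).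
  { intros n ->; now apply (squarefree_int_neq_0 _ (Hn n)), ival_eq_0. }
  destruct (irreducible_at_point w Hw) as (d & c & Hd & Hc & Hcz & Ed & Ev).
  destruct (entire_factor f w (ivef_entire f) Hfw) as (h & Hh & Eh).
  exists d; split; auto; apply divides_intro.
  + exists (fun z => h z / c z)%C; split.
    * intros z; apply holo_div; auto; [apply Hh | apply Hc].
    * intros z; rewrite Ed, Eh; field; auto.
  + intros n; rewrite Ev; split; [lia|apply Z.divide_1_l].
- assert (Hk : exists n, ~ (ival f n | 1)%Z).
  { apply NNPP; intros Hno; apply Hu, is_unit_iff; split.
    - intros z Hz'; apply Hz; now exists z.
    - intros n; apply NNPP; intros Hn'; apply Hno; now exists n. }
  destruct Hk as [n Hk].
  destruct (prime_divisor_exists _ Hk) as (p & Hp & Hpd).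
  destruct (irreducible_at_integer n p Hp) as (d & Hd & Hdz & Ed & Ed').
  pose proof (prime_ge_2 p Hp).
  exists d; split; auto; apply divides_intro.
  + exists (fun z => f z / d z)%C; split.
    * intros z; apply holo_div; auto; apply ivef_entire.
    * intros z; field; auto.
  + intros m; destruct (Z.eq_dec m n) as [->|Hm].
    * rewrite Ed; split; [lia|auto].
    * rewrite Ed' by auto; split; [lia|apply Z.divide_1_l].
Qed.

Lemma Rbar_lub_correct E : Rbar_is_lub E (Rbar_lub E).
Proof. unfold Rbar_lub; now destruct (Rbar_ex_lub E). Qed.

Lemma mult_order_ge (d f : ivef) k : divides (pow_n d k) f ->
  Rbar_le (Finite (INR k)) (mult_order d f).
Proof.
intros H; apply (proj1 (Rbar_lub_correct _)); now exists k.
Qed.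

Lemma squarefree_of_max_order (f : ivef) : max_order f = Finite 1 -> squarefree f.
Proof.
intros H; apply squarefree_of_irreducible; intros d Hd [e E].
assert (Hdiv : irreducible_divisor f d).
{ split; auto; exists (mult d e); rewrite E; apply ivef_ext; intros; simpl; ring. }
assert (L1 : Rbar_le (mult_order d f) (max_order f)).
{ apply (proj1 (Rbar_lub_correct _)); right; now exists d. }
assert (L2 : Rbar_le (Finite (INR 2)) (mult_order d f)).
{ apply mult_order_ge; rewrite pow_n_2; now exists e. }
rewrite H in L1; pose proof (Rbar_le_trans _ _ _ L2 L1) as L; simpl in L; lra.
Qed.

Lemma max_order_of_squarefree (f : ivef) : squarefree f -> ~ is_unit f ->
  max_order f = Finite 1.
Proof.
intros Hs Hu; apply Rbar_is_lub_unique; split.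
- intros x [->|(d & [Hd _] & ->)]; [simpl; lra|].
  apply (proj2 (Rbar_lub_correct _)); intros x (k & -> & Hk).
  destruct k as [|[|k]]; simpl; try lra.
  exfalso; apply (squarefree_irreducible f d Hs Hd).
  destruct Hk as [e ->]; exists (mult (pow_n d k) e).
  simpl; apply ivef_ext; intros; simpl; ring.
- intros b Hb.
  destruct (squarefree_irreducible_divisor f Hs Hu) as [d Hd].
  eapply Rbar_le_trans; [|apply Hb; right; exists d; split; [exact Hd|reflexivity]].
  apply (mult_order_ge d f 1); simpl; rewrite mult_one_r; apply Hd.
Qed.

(** The bridge from entire functions to the ring: [v1] changes only by a multiple of [q], so a
    congruence modulo [q] is kept, while its values at the integers become arbitrary because [q]
    does not vanish there. *)
Lemma lift_to_integer_valued (q : ivef) v1 (V : Z -> Z) : entire v1 ->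
  (forall n, ival q n <> 0%Z) ->
  exists (v : ivef) e, entire e /\ (forall z, v z = (v1 z + q z * e z)%C) /\
    forall n, ival v n = V n.
Proof.
intros Hv1 Hq.
destruct (integer_interpolation (fun n =>
  (RtoC (IZR (V n)) - v1 (RtoC (IZR n))) / q (RtoC (IZR n)))%C) as (e & He & Ee).
assert (Hv : entire (fun z => v1 z + q z * e z)%C).
{ apply entire_plus; auto; apply entire_mult; auto; apply ivef_entire. }
assert (Hn : forall n : Z, (v1 (RtoC (IZR n)) + q (RtoC (IZR n)) * e (RtoC (IZR n)))%C = RtoC (IZR (V n))).
{ intros n; rewrite Ee; field; intros E0; now apply (Hq n), ival_eq_0. }
exists (Ivef _ Hv (fun n => ex_intro _ (V n) (Hn n))), e.
repeat split; auto; intros n; apply ival_unique, Hn.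
Qed.

Lemma ivef_nonzero (q : ivef) : ival q 0 <> 0%Z -> exists z, q z <> RtoC 0.
Proof. intros H; exists (RtoC (IZR 0)); intros E; now apply H, ival_eq_0. Qed.

Lemma squarefree_regular (f g : ivef) : squarefree f ->
  exists v : ivef, divides f (mult g (plus (mult g v) (opp one))).
Proof.
intros [Hn Hw].
assert (Hf0 : forall n, ival f n <> 0%Z) by (intros; apply squarefree_int_neq_0, Hn).
destruct (solve_congruence f (fun z => g z * g z)%C g) as (v1 & Hv1 & h & Hh & Eh).
- apply ivef_entire.
- apply entire_mult; apply ivef_entire.
- apply ivef_entire.
- now apply ivef_nonzero.
(* The congruence is g^2 v = g modulo [f]. At a zero of [f] where g^2 vanishes the right side
   vanishes too, and simplicity of the zero makes this enough. *)
- intros w _; destruct (classic (g w = RtoC 0)); [right | left; apply Cmult_neq_0]; auto.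
- destruct (lift_to_integer_valued f v1 (fun n => proj1_sig
    (constructive_indefinite_description _ (squarefree_int_regular _ (ival g n) (Hn n)))))
    as (v & e & He & Ev & Hv); auto.
  exists v; apply divides_intro.
  + exists (fun z => h z + g z * g z * e z)%C; split.
    * apply entire_plus; auto.
      apply (entire_mult (fun z => g z * g z)%C e); auto.
      apply entire_mult; apply ivef_entire.
    * intros z; simpl; rewrite Ev.
      replace (g z * (g z * (v1 z + f z * e z) + - (1)))%C
        with ((g z * g z * v1 z - g z) + f z * (g z * g z * e z))%C by ring.
      rewrite Eh; ring.
  + intros n; split; auto.
    rewrite ival_mult, ival_plus, ival_opp, ival_mult, Hv.
    rewrite ival_one.
    destruct (constructive_indefinite_description _ _) as [V HV]; exact HV.
Qed.

(** * Prime and maximal ideals *)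

Lemma ideal_one_full (I : ivef -> Prop) : ideal I -> I one -> forall a, I a.
Proof. intros (_ & _ & H) H1 a; rewrite <- (mult_one_r a); now apply H. Qed.

Lemma ideal_divides (I : ivef -> Prop) a b : ideal I -> divides a b -> I a -> I b.
Proof. intros (_ & _ & H) [c ->] Ha; rewrite ivef_mult_comm; now apply H. Qed.

Lemma proper_ideal_not_unit (P : ivef -> Prop) f : ideal P -> proper P -> P f -> ~ is_unit f.
Proof.
intros HI [x Hx] Hf Hu; apply Hx, ideal_one_full; auto; now apply (ideal_divides P f).
Qed.

Lemma maximal_ideal_inverse (P : ivef -> Prop) x : maximal_ideal P -> ~ P x ->
  exists u, P (plus one (opp (mult u x))).
Proof.
intros ((P0 & PD & PM) & _ & Hmax) Hx.
set (J := fun a : ivef => exists p r : ivef, P p /\ a = plus p (mult r x)).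
assert (HJ : ideal J).
{ split; [|split].
  - exists zero, zero; split; auto; apply ivef_ext; intros; simpl; ring.
  - intros a b (p & r & Hp & ->) (p' & r' & Hp' & ->).
    exists (plus p p'), (plus r r'); split; [now apply PD|].
    apply ivef_ext; intros; simpl; ring.
  - intros s a (p & r & Hp & ->); exists (mult s p), (mult s r); split; [now apply PM|].
    apply ivef_ext; intros; simpl; ring. }
assert (H1 : J one).
{ apply NNPP; intros H1; apply Hx, (Hmax J); auto.
  - now exists one.
  - intros a Ha; exists a, zero; split; auto; apply ivef_ext; intros; simpl; ring.
  - exists zero, one; split; auto; apply ivef_ext; intros; simpl; ring. }
destruct H1 as (p & r & Hp & E); exists r.
replace (plus one (opp (mult r x))) with p; auto.
rewrite E; apply ivef_ext; intros; simpl; ring.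
Qed.

Lemma maximal_ideal_squarefree (P : ivef -> Prop) : maximal_ideal P ->
  exists f, P f /\ squarefree f.
Proof.
intros HM; pose proof HM as (HI & HP & _).
(* Any prime p could replace 2: the constant p is squarefree, and 1 - p u has no integer zeros. *)
destruct (classic (P (ivef_const 2))) as [H2|H2].
{ exists (ivef_const 2); repeat split; auto.
  - intros n d; rewrite ival_const; intros Hd.
    assert (d <> 0%Z) by (intros ->; destruct Hd; lia).
    apply Z.divide_pos_le in Hd; [|lia].
    assert (Hd' : d = 1%Z \/ d = (-1)%Z) by nia.
    destruct Hd' as [->| ->]; [apply Z.divide_refl | exists (-1)%Z; ring].
  - intros w (h & _ & E); specialize (E w); simpl in E.
    assert (E' : RtoC 2 = RtoC 0) by (rewrite E; ring).
    apply RtoC_inj in E'; lra. }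
destruct (maximal_ideal_inverse P _ HM H2) as [u Hq].
set (q := plus one (opp (mult u (ivef_const 2)))) in *.
assert (q0 : forall n, ival q n <> 0%Z).
{ intros n; unfold q; rewrite ival_plus, ival_opp, ival_mult, ival_const.
  rewrite ival_one; lia. }
destruct (entire_radical q (ivef_entire q) (ivef_nonzero q (q0 0%Z))) as (s & Hs & Hz & Hsim).
assert (Hr : forall n, exists r : Z * nat, squarefree_int (fst r) /\
  (ival q n | fst r ^ Z.of_nat (snd r))%Z).
{ intros n; destruct (radical_int _ (q0 n)) as (r & j & H); now exists (r, j). }
set (r n := proj1_sig (constructive_indefinite_description _ (Hr n))).
assert (Hr' : forall n, squarefree_int (fst (r n)) /\
  (ival q n | fst (r n) ^ Z.of_nat (snd (r n)))%Z) by (intros; unfold r; apply proj2_sig).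
destruct (prescribed_values s (fun n => fst (r n))) as (f & c & Hc & Hcz & Ef & Hf); auto.
{ intros n E; apply Hz in E; now apply (q0 n), ival_eq_0. }
{ intros n; apply squarefree_int_neq_0, Hr'. }
assert (Hsf : squarefree f).
{ split.
  - intros n; rewrite Hf; apply Hr'.
  - intros w (h & Hh & E); apply (Hsim w); exists (fun z => h z / c z)%C; split.
    + intros z; apply holo_div; [apply Hh | apply Hc | auto].
    + intros z; specialize (E z); rewrite Ef in E.
      replace (s z) with (s z * c z / c z)%C by (field; auto).
      rewrite E; field; auto. }
exists f; split; auto; apply NNPP; intros HnP.
destruct (maximal_ideal_inverse P f HM HnP) as [a Hb].
set (b := plus one (opp (mult a f))) in *.
destruct (solve_congruence q b (fun _ => RtoC 1)) as (v1 & Hv1 & h & Hh & Eh).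
- apply ivef_entire.
- apply ivef_entire.
- apply entire_const.
- apply ivef_nonzero, q0.
(* [f] vanishes wherever [q] does, so [b = 1 - a f] equals 1 at each zero of [q]; the congruence is
   then solvable to every multiplicity. *)
- intros w Hw; left; unfold b; simpl; rewrite Ef, (proj1 (Hz w) Hw).
  replace (1 + - (a w * (0 * c w)))%C with (RtoC 1) by ring; apply C1_nz.
(* At an integer the value of [f] is nilpotent modulo the value of [q], so the value of [b] is
   invertible. *)
- assert (HV : forall n, exists V, (ival q n | ival b n * V - 1)%Z).
  { intros n; destruct (unipotent_inverse_mod _ _ _ (ival a n) (proj2 (Hr' n))) as [V HV].
    exists V; unfold b; rewrite ival_plus, ival_opp, ival_mult, Hf.
    now rewrite ival_one. }
  destruct (lift_to_integer_valued q v1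
    (fun n => proj1_sig (constructive_indefinite_description _ (HV n))))
    as (v & e & He & Ev & Hv); auto.
  assert (D : divides q (plus (mult b v) (opp one))).
  { apply divides_intro.
    - exists (fun z => h z + b z * e z)%C; split.
      + apply entire_plus; auto; apply entire_mult; auto; apply ivef_entire.
      + intros z; change ((plus (mult b v) (opp one) : ivef) z) with (b z * v z + - (1))%C.
        rewrite Ev.
        replace (b z * (v1 z + q z * e z) + - (1))%C
          with ((b z * v1 z - 1) + q z * (b z * e z))%C by ring.
        rewrite Eh; ring.
    - intros n; split; auto.
      rewrite ival_plus, ival_opp, ival_mult, Hv.
      rewrite ival_one.
      destruct (constructive_indefinite_description _ _) as [V HV']; exact HV'. }
  (* This element is 1: [b] lies in [P] by choice of [a], and b v - 1 as a multiple of [q]. *)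
  assert (D' : P (plus (mult v b) (opp (plus (mult b v) (opp one))))).
  { pose proof HI as (_ & PD & PM); apply PD; [now apply PM|].
    replace (opp (plus (mult b v) (opp one)))
      with (mult (ivef_const (-1)) (plus (mult b v) (opp one)))
      by (apply ivef_ext; intros; simpl; ring).
    apply PM; now apply (ideal_divides P q). }
  destruct HP as [x Hx]; apply Hx, ideal_one_full; auto.
  replace (one : ivef) with (plus (mult v b) (opp (plus (mult b v) (opp one)))); auto.
  apply ivef_ext; intros; simpl; ring.
Qed.

Theorem theorem3p3 : forall P : ivef -> Prop,
  prime_ideal P ->
  (maximal_ideal P <-> exists f : ivef, P f /\ max_order f = Finite 1).
Proof.
intros P (HI & HP & Hprime); split.
- intros HM; destruct (maximal_ideal_squarefree P HM) as (f & Hf & Hs).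
  exists f; split; auto; apply max_order_of_squarefree; auto.
  now apply (proper_ideal_not_unit P).
- intros (f & Hf & Hm); apply squarefree_of_max_order in Hm.
  split; [|split]; auto.
  intros J (J0 & JD & JM) [x Hx] Hsub a Ha; apply NNPP; intros Hna.
  destruct (squarefree_regular f a Hm) as [v Hv].
  destruct (Hprime a (plus (mult a v) (opp one))) as [H|H]; [|contradiction|].
  + now apply (ideal_divides P f).
  + apply Hx, (ideal_one_full J); [now split|].
    replace (one : ivef)
      with (plus (mult v a) (mult (ivef_const (-1)) (plus (mult a v) (opp one))))
      by (apply ivef_ext; intros; simpl; ring).
    apply JD; apply JM; auto.
Qed.
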